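(* Let $p>2$ be a prime and $2\le n\le p-2$. Let $w$ assign a positive real weight to each element of $[p-1]$, and suppose $w(i)=w(p-i)$ for all $i\in[p-1]$. Let $Q=Q^{(n)}$ be the transition matrix of the non-projective summand random walk and let $\bar Q=\bar Q^{(n)}$, $T$ be as defined in the context. Then: (a) $Q^{(n)}=TQ^{(p-n)}=Q^{(p-n)}T$; (b) $TQT=Q$; (c) the non-projective summand random walk is invariant under the relabelling $i\mapsto p-i$ (that is, $Q_{p-i,p-j}=Q_{i,j}$ for all $i,j$); (d) if $n$ is odd, the two irreducible subchains (on the odd states and on the even states) are isomorphic; (e) $\bar Q^{(p-n)}=\bar Q^{(n)}$; (f) with the states ordered as $1,3,\dots,p-2,\,p-1,p-3,\dots,4,2$, we have $$Q=\bar Q\otimes\begin{pmatrix}0&1\\1&0\end{pmatrix}^{n+1};$$ (g) if $n$ is odd, every eigenvalue of $Q$ has even multiplicity; if $n$ is even, the eigenvalues of $Q$ come in signed pairs (that is, $\lambda$ and $-\lambda$ occur with equal multiplicity); (h) for $0<\varepsilon<1$, the non-projective summand random walk has mixing time bounded by $$t_{\mathrm{mix}}(\varepsilon)\le\frac{1}{1-\lambda_\star}\log\left(\frac{1}{\varepsilon\min_i\pi_i}\right),$$ where $\lambda_\star=\max\{|\lambda| : \lambda\ne1\text{ is an eigenvalue of }\bar Q\}$.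
   Context: $k$ is an algebraically closed field of characteristic $p$, $G=\mathrm{SL}_2(\mathbb{F}_p)$, $[r]=\{1,\dots,r\}$. For $n\ge1$, $V_n$ is the $n$-dimensional $kG$-module of homogeneous polynomials over $k$ of degree $n-1$ in $X,Y$, where $\begin{pmatrix}a&b\\c&d\end{pmatrix}$ acts by $f(X,Y)\mapsto f(aX+cY,bX+dY)$. $V_1,\dots,V_{p-1}$ are the non-projective simple $kG$-modules up to isomorphism. $[M:V]$ denotes the multiplicity of $V$ as an indecomposable direct summand of $M$. The non-projective summand random walk is the Markov chain on $[p-1]$ (state $i$ standing for $V_i$) with transition matrix $$Q^{(n)}_{i,j}=\frac{w(j)[V_i\otimes V_n:V_j]}{\sum_{l\in[p-1]}w(l)[V_i\otimes V_n:V_l]};$$ the superscript is suppressed when $n$ is fixed, and $Q^{(p-n)}$ uses the same weight $w$. When $n$ is odd, the chain decomposes into two irreducible aperiodic chains, on the odd and on the even states; when $n$ is even it is irreducible of period $2$. $T$ is the $(p-1)\times(p-1)$ matrix with $T_{i,j}=1$ if $i+j=p$ and $0$ otherwise. $\bar Q^{(n)}$ is the $\frac{p-1}{2}\times\frac{p-1}{2}$ matrix with $\bar Q^{(n)}_{i,j}=Q^{(n)}_{2i-1,2j-1}$ if $n$ is odd and $\bar Q^{(n)}_{i,j}=Q^{(n)}_{2i-1,p+1-2j}$ if $n$ is even. For a $2\times2$ matrix $Y$ and a matrix $X$, $X\otimes Y$ denotes the $2\times2$ block matrix whose $(a,b)$ block is $Y_{a,b}X$. $\pi$ is the stationary distribution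 on $[p-1]$ given by $\pi_i=w(i)\sum_{l}w(l)/C$, where $l$ ranges over the elements of $[p-1]$ with $V_l$ a direct summand of $V_i\otimes V_n$ and $C$ is the normalising constant making $\sum_i\pi_i=1$. For an irreducible aperiodic chain with transition matrix $S$ and stationary distribution $\sigma$, $t_{\mathrm{mix}}(\varepsilon)$ is the least integer $t\ge0$ such that the total variation distance between $S^t(x,\cdot)$ and $\sigma$ is at most $\varepsilon$ for every state $x$. For $n$ odd, the bound in (h) is asserted for each of the two irreducible subchains. For $n$ even, periodicity is eliminated by passing to the lazy chain with transition matrix $\frac12(Q+I)$, which is regarded as converging at half the rate of the original chain, and $t_{\mathrm{mix}}(\varepsilon)$ denotes half of the mixing time of the lazy chain. *)

(* Defs.v *)
From HB Require Import structures.
From mathcomp Require Import all_boot all_order all_algebra all_fingroup.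
From mathcomp Require Import all_character.
From mathcomp Require Import complex mpoly.
From mathcomp Require Import boolp classical_sets reals exp.

Set Implicit Arguments.
Unset Strict Implicit.
Unset Printing Implicit Defensive.

Import Order.TTheory GRing.Theory Num.Theory.
Local Open Scope ring_scope.

Definition SL2 (p : nat) : {set {'GL_2['F_p]}} :=
  [set g : {'GL_2['F_p]} | \det (GLval g) == 1].

Lemma SL2_group_set (p : nat) : group_set (SL2 p).
Proof.
apply/group_setP; split=> [|g h]; first by rewrite inE GL_1E det1.
by rewrite !inE GL_ME det_mulmx => /eqP-> /eqP->; rewrite mulr1.
Qed.

Canonical SL2_group (p : nat) := Group (SL2_group_set p).

(* A ring morphism when k has characteristic p. *)
Definition Fp_embed (p : nat) (k : fieldType) (a : 'F_p) : k := (a : nat)%:R.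

(* f(X, Y) |-> f(aX + cY, bX + dY) for g = (a b; c d), where X = 'X_0 and
   Y = 'X_1: the j-th variable is sent to the sum of the g_ij 'X_i. *)
Definition subst_act (p : nat) (k : fieldType) (g : {'GL_2['F_p]})
    (f : {mpoly k[2]}) : {mpoly k[2]} :=
  f \mPo [tuple \sum_(i < 2) Fp_embed k (GLval g i j) *: 'X_i | j < 2].

(* The exponent of X^j Y^(n-1-j). *)
Definition monXY (n : nat) (j : 'I_n) : 'X_{1..2} :=
  [multinom (if i == ord0 then val j else n.-1 - j)%N | i < 2].

(* The matrix of subst_act g on homogeneous polynomials of degree n - 1, in the
   basis of the monomials X^j Y^(n-1-j); as this is a left action, it is the
   columns that hold the coordinates of the images (see V_mxE below). *)
Definition V_mx (p : nat) (k : fieldType) (n : nat) (g : {'GL_2['F_p]}) :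
    'M[k]_n :=
  \matrix_(i, j) (subst_act g ('X_[monXY j] : {mpoly k[2]}))@_(monXY i).

Section VRepresentation.

Variables (p : nat) (k : fieldType).

Lemma subst_actX (g : {'GL_2['F_p]}) j :
  subst_act g ('X_j : {mpoly k[2]}) =
  \sum_(i < 2) Fp_embed k (GLval g i j) *: 'X_i.
Proof. by rewrite /subst_act comp_mpolyXU -tnth_nth tnth_mktuple. Qed.

Lemma subst_act_homog (g : {'GL_2['F_p]}) d (f : {mpoly k[2]}) :
  f \is d.-homog -> subst_act g f \is d.-homog.
Proof.
move=> hf; rewrite /subst_act comp_mpolyE big_seq; apply: rpred_sum => m mf.
apply: rpredZ; rewrite -(dhomog_mf hf mf) /= mdegE big_ord_recl big_ord1.
rewrite big_ord_recl big_ord1; apply: dhomogM.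
  rewrite -[X in X.-homog]mul1n; apply: dhomogMn; rewrite tnth_mktuple.
  by apply: rpred_sum => i _; apply: rpredZ; rewrite dhomogX; apply/eqP; exact: mdeg1.
rewrite -[X in X.-homog]mul1n; apply: dhomogMn; rewrite tnth_mktuple.
by apply: rpred_sum => i _; apply: rpredZ; rewrite dhomogX; apply/eqP; exact: mdeg1.
Qed.

Lemma mdeg_monXY n (j : 'I_n) : mdeg (monXY j) = n.-1.
Proof.
rewrite mdegE big_ord_recl big_ord1 !mnmE /= subnKC //.
by case: n j => [[]//|n j] /=; rewrite -ltnS.
Qed.

Lemma monXY_inj n : injective (@monXY n).
Proof.
move=> i j /mnmP/(_ ord0); rewrite !mnmE /= => eij; exact: val_inj.
Qed.

Lemma monXY_surj n (m : 'X_{1..2}) :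
  mdeg m = n -> exists j : 'I_n.+1, m = monXY j.
Proof.
rewrite mdegE big_ord_recl big_ord1 => dm.
have lt : (m ord0 < n.+1)%N by rewrite ltnS -dm leq_addr.
exists (Ordinal lt); apply/mnmP => i; rewrite mnmE /=.
have [->//|] := eqVneq i ord0.
move=> ni; rewrite -dm addKn; congr (m _); apply: val_inj => /=.
by case: i ni => [[|[|]]].
Qed.

Lemma homog_monXY n (f : {mpoly k[2]}) :
  f \is n.-homog -> f = \sum_(j < n.+1) f@_(monXY j) *: 'X_[monXY j].
Proof.
move=> hf; apply/mpolyP => m; rewrite raddf_sum /=.
have [/monXY_surj[i ->]|ndm] := eqVneq (mdeg m) n.
  rewrite (bigD1 i) //= mcoeffZ mcoeffX eqxx mulr1 big1 ?addr0 // => j nij.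
  by rewrite mcoeffZ mcoeffX (inj_eq (@monXY_inj _)) (negbTE nij) mulr0.
rewrite (dhomog_nemf_coeff hf ndm) big1 // => j _.
rewrite mcoeffZ mcoeffX; case: eqP => [em|_]; last by rewrite mulr0.
by rewrite -em mdeg_monXY eqxx in ndm.
Qed.

Lemma V_mxE n (g : {'GL_2['F_p]}) (f : {mpoly k[2]}) :
  f \is n.-homog ->
  \col_(i < n.+1) (subst_act g f)@_(monXY i) =
  V_mx k n.+1 g *m \col_(j < n.+1) f@_(monXY j).
Proof.
move=> hf; apply/colP => i; rewrite !mxE {1}(homog_monXY hf) /subst_act.
rewrite (raddf_sum (comp_mpoly _)) raddf_sum /=; apply: eq_bigr => j _.
by rewrite comp_mpolyZ mcoeffZ mulrC !mxE.
Qed.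

Hypothesis pk : p \in [pchar k].

Lemma Fp_embedD : {morph @Fp_embed p k : a b / a + b}.
Proof.
move=> a b; rewrite /Fp_embed -natrD.
have pp := pcharf_prime pk; rewrite -[RHS](GRing.natr_mod_pchar pk) /=.
by congr (_ %% _)%:R; rewrite Fp_Zcast ?Zp_cast ?prime_gt1.
Qed.

Lemma Fp_embedM : {morph @Fp_embed p k : a b / a * b}.
Proof.
move=> a b; rewrite /Fp_embed -natrM.
have pp := pcharf_prime pk; rewrite -[RHS](GRing.natr_mod_pchar pk) /=.
by congr (_ %% _)%:R; rewrite Fp_Zcast ?Zp_cast ?prime_gt1.
Qed.

Lemma subst_act1 (f : {mpoly k[2]}) : subst_act (1%g : {'GL_2['F_p]}) f = f.
Proof.
rewrite -[RHS]comp_mpoly_id /subst_act; congr (_ \mPo _).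
apply: eq_from_tnth => j; rewrite !tnth_mktuple (bigD1 j) // GL_1E.
rewrite big1 => [|i ni]; rewrite ?GL_1E !mxE ?eqxx ?(negbTE ni) /Fp_embed.
  by rewrite scale1r /= addr0.
by rewrite scale0r.
Qed.

Lemma subst_actM (g h : {'GL_2['F_p]}) (f : {mpoly k[2]}) :
  subst_act (g * h)%g f = subst_act g (subst_act h f).
Proof.
rewrite {1 3}/subst_act !comp_mpolyE /subst_act (raddf_sum (comp_mpoly _)) /=.
apply: eq_bigr => m _; rewrite comp_mpolyZ; congr (_ *: _).
rewrite (rmorph_prod (comp_mpoly _)) /=; apply: eq_bigr => j _.
rewrite (rmorphXn (comp_mpoly _)) /= !tnth_mktuple.
congr (_ ^+ _); rewrite (raddf_sum (comp_mpoly _)) /=.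
under [RHS]eq_bigr => i _ do
  rewrite comp_mpolyZ -/(subst_act g 'X_i) subst_actX scaler_sumr.
rewrite exchange_big /=; apply: eq_bigr => i _; rewrite mxE.
under [RHS]eq_bigr => l _ do rewrite scalerA mulrC -Fp_embedM.
by rewrite -scaler_suml !big_ord_recl !big_ord0 !addr0 -Fp_embedD.
Qed.

Lemma V_mx_repr n : mx_repr (SL2_group p) (@V_mx p k n).
Proof.
split=> [|g h _ _].
  by apply/matrixP=> i j; rewrite !mxE subst_act1 mcoeffX
     (inj_eq (@monXY_inj _)) eq_sym.
case: n => [|n]; first by apply/matrixP => -[].
apply/matrixP=> i j; rewrite mxE subst_actM.
have hX : subst_act h ('X_[monXY j] : {mpoly k[2]}) \is n.-homog.
  apply: subst_act_homog; rewrite dhomogX.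
  by apply/eqP; exact: (mdeg_monXY j).
have /colP/(_ i) := V_mxE g hX.
by rewrite !mxE => ->; apply: eq_bigr => l _; rewrite !mxE.
Qed.

Definition V (n : nat) : representation k (SL2_group p) :=
  Representation (MxRepresentation (V_mx_repr n)).

End VRepresentation.

Section Summands.

Variables (F : fieldType) (gT : finGroupType) (G : {group gT}).
Local Notation rep := (representation F G).

Definition tensor (M N : rep) : rep := Representation (prod_repr M N).

Definition indecomposable (M : rep) : Prop :=
  (0 < rdegree M)%N /\
  forall N1 N2 : rep, mx_rsim M (dadd_grepr N1 N2) ->
    rdegree N1 = 0%N \/ rdegree N2 = 0%N.

Definition direct_summand (N M : rep) : Prop :=
  exists N' : rep, mx_rsim M (dadd_grepr N N').

Definition has_multiplicity (M N : rep) (m : nat) : Prop :=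
  exists r (D : 'I_r -> rep),
    [/\ mx_rsim M (\big[dadd_grepr/grepr0]_(i < r) D i),
        forall i, indecomposable (D i) &
        m = #|[pred i | `[< mx_rsim (D i) N >]]| ].

(* By the Krull-Schmidt theorem there is exactly one m such that
   has_multiplicity M N m, so that the default value is irrelevant. *)
Definition multiplicity (M N : rep) : nat := xget 0%N (has_multiplicity M N).

End Summands.

(* States are the natural numbers 1, ..., p - 1; in matrices indexed by
   'I_p.-1, the state i sits at index i - 1. *)
Section Walk.

Variables (p : nat) (k : fieldType) (pk : p \in [pchar k]).
Variables (R : realType) (w : nat -> R) (n : nat).

Definition walk_mult (i j : nat) : nat :=
  multiplicity (tensor (V pk i) (V pk n)) (V pk j).

Definition walk (i j : nat) : R :=
  w j * (walk_mult i j)%:R / \sum_(1 <= l < p) w l * (walk_mult i l)%:R.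

Definition walk_mx : 'M[R]_p.-1 := \matrix_(i, j) walk i.+1 j.+1.

Definition odd_walk_mx : 'M[R]_p.-1./2 :=
  \matrix_(i, j) walk i.*2.+1 j.*2.+1.

Definition even_walk_mx : 'M[R]_p.-1./2 :=
  \matrix_(i, j) walk i.*2.+2 j.*2.+2.

(* With 1-based indices i and j, the entries are walk (2i - 1) (2j - 1) for
   odd n, and walk (2i - 1) (p + 1 - 2j) for even n. *)
Definition walk_bar : 'M[R]_p.-1./2 :=
  \matrix_(i, j) if odd n then walk i.*2.+1 j.*2.+1
                 else walk i.*2.+1 (p + 1 - j.+1.*2)%N.

Definition lazy_walk_mx : 'M[R]_p.-1 := 2^-1 *: (walk_mx + 1%:M).

Definition stat_weight (i : nat) : R :=
  w i * \sum_(1 <= l < p |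
          `[< direct_summand (V pk l) (tensor (V pk i) (V pk n)) >]) w l.

Definition stat_pi (i : nat) : R :=
  stat_weight i / \sum_(1 <= l < p) stat_weight l.

(* The default value 1 is harmless, as stat_pi i <= 1 for all states i. *)
Definition min_stat_pi : R := \big[Order.min/1]_(1 <= i < p) stat_pi i.

(* The state in position a (counting from 0) of the ordering
   1, 3, ..., p - 2, p - 1, p - 3, ..., 4, 2. *)
Definition folded_state (a : nat) : nat :=
  if (a < p.-1./2)%N then a.*2.+1 else (p.-1 - (a - p.-1./2).*2)%N.

Definition folded_walk_mx : 'M[R]_(p.-1./2 + p.-1./2) :=
  \matrix_(a, b) walk (folded_state a) (folded_state b).

End Walk.

Definition reflection_mx (R : realType) (p : nat) : 'M[R]_p.-1 :=
  \matrix_(i, j) (i.+1 + j.+1 == p)%N%:R.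

Definition swap_mx (R : realType) : 'M[R]_2 := \matrix_(a, b) (a != b)%:R.

Definition kron2 (R : realType) (h : nat) (X : 'M[R]_h) (Y : 'M[R]_2) :
    'M[R]_(h + h) :=
  block_mx (Y 0 0 *: X) (Y 0 1 *: X) (Y 1 0 *: X) (Y 1 1 *: X).

Section Chains.

Variable R : realType.

Definition chain_isomorphic (N N' : nat) (S : 'M[R]_N) (S' : 'M[R]_N') : Prop :=
  exists2 f : 'I_N -> 'I_N', bijective f & forall x y, S' (f x) (f y) = S x y.

Definition complex_eigenvalue (N : nat) (S : 'M[R]_N) (l : R[i]) : bool :=
  eigenvalue (map_mx (real_complex R) S) l.

Definition eigen_multiplicity (N : nat) (S : 'M[R]_N) (l : R[i]) : nat :=
  mup l (char_poly (map_mx (real_complex R) S)).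

(* The supremum of a finite set, which is not empty when S is an irreducible
   stochastic matrix of size at least 2. *)
Definition lambda_star (N : nat) (S : 'M[R]_N) : R :=
  sup [set ComplexField.Normc.normc l | l in [set l | complex_eigenvalue S l /\ l != 1]]%classic.

Definition tv_dist (N : nat) (mu nu : 'rV[R]_N) : R :=
  2^-1 * \sum_i `|mu 0 i - nu 0 i|.

Definition stationary (N : nat) (S : 'M[R]_N) (sigma : 'rV[R]_N) : Prop :=
  [/\ forall i, 0 <= sigma 0 i, \sum_i sigma 0 i = 1 & sigma *m S = sigma].

Definition mixed (N : nat) (S : 'M[R]_N) (sigma : 'rV[R]_N) (eps : R)
    (t : nat) : Prop :=
  forall x, tv_dist (row x (S ^+ t)) sigma <= eps.

Definition is_mixing_time (N : nat) (S : 'M[R]_N) (sigma : 'rV[R]_N) (eps : R)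
    (t : nat) : Prop :=
  mixed S sigma eps t /\ forall s, mixed S sigma eps s -> (t <= s)%N.

End Chains.

(* Main.v *)
Require Import Defs.
From HB Require Import structures.
From mathcomp Require Import all_boot all_order all_algebra all_fingroup.
From mathcomp Require Import all_character ring lra zify.
From mathcomp Require Import complex mpoly.
From mathcomp Require Import boolp classical_sets reals sequences exp.

Set Implicit Arguments.
Unset Strict Implicit.
Unset Printing Implicit Defensive.

Import Order.TTheory GRing.Theory Num.Theory.
Local Open Scope ring_scope.

(** Everything rests on one computation, the truncated Clebsch-Gordan rule: for
    states i, j and 1 <= n < p, the module V_j is a summand of the tensor product
    of V_i and V_n at most once, and it is one exactly when i + j + n is odd, the
    strict triangle inequalities hold between i, j and n, and i + j + n < 2p.
    This condition, [fusion], is symmetric in i, j, n and unchanged when two of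
    the three numbers are replaced by their complements to p.  The relations
    between Q^(n), Q^(p-n) and T, the isomorphism of the two subchains and the
    folded form of Q are that symmetry, read on matrices.

    The rule is proved without projective modules.  If N is a brick, that is,
    a nonzero module whose only endomorphisms are scalars, then families of maps
    N -> M and M -> N have a matrix of composites, and the multiplicity of N in
    M is the largest rank of such a matrix ([gram_rank], [gram_attained]); so it
    is additive and independent of the decomposition, which replaces the
    Krull-Schmidt theorem.  For a self-dual W, maps between N and the tensor
    product of M and W are the same as maps between the tensor product of N and
    W and M, with the same traces of composites.  When N tensored with W splits
    as N1 + N2, this gives the multiplicity of N in M tensored with W as the sum
    of those of N1 and N2 in M, except that a brick whose dimension vanishes in
    k contributes nothing since all traces on it vanish ([multiplicity_tensor]).
    With W = V_2 and V_j tensored with V_2 equal to V_{j-1} + V_{j+1}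
    ([V_tensor_V2]) the multiplicities satisfy the recursion
      m_{n+1}(i,j) + m_{n-1}(i,j) = m_n(i,j-1) + m_n(i,j+1)
    in which V_p counts for zero, and [fusion] is its solution
    ([walk_mult_fusion]).

    As for the eigenvalues of Q, the folded matrix is block diagonal with equal
    blocks when n is odd, and block antidiagonal with equal blocks A when n is
    even; in the latter case it is similar to the block diagonal matrix of A
    and - A.

    As for the mixing time, the chain is reversible with respect to pi, so
    conjugating by the square root of pi and subtracting the projection onto the
    stationary direction leaves a real symmetric matrix whose eigenvalues are 0
    and those of the chain other than 1; the spectral theorem bounds the entries
    of its powers ([reversible_mixing]).  That 1 is a simple eigenvalue and that
    no other eigenvalue of Qbar has modulus 1 follows from an energy identity,
    since the states i and i + 2 always have a common neighbour.  The extra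
    factors 1/2 in the total variation distance and in the mass of each subchain
    absorb the rounding of the time to an integer. *)

(** * Intertwiners and direct summands *)

Section Intertwiners.

Variables (F : fieldType) (gT : finGroupType) (G : {group gT}).
Local Notation rep := (representation F G).

Definition intertwines (M N : rep) (A : 'M[F]_(rdegree M, rdegree N)) : Prop :=
  forall g, g \in G -> M g *m A = A *m N g.

Lemma intertwines1 (M : rep) : @intertwines M M 1%:M.
Proof. by move=> g _; rewrite mulmx1 mul1mx. Qed.

Lemma intertwinesM (M N P : rep) A B :
  @intertwines M N A -> @intertwines N P B -> @intertwines M P (A *m B).
Proof. by move=> hA hB g Gg; rewrite mulmxA hA // -!mulmxA hB. Qed.

Lemma intertwines0 (M N : rep) : @intertwines M N 0.
Proof. by move=> g _; rewrite mulmx0 mul0mx. Qed.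

Lemma intertwinesZ (M N : rep) c A :
  @intertwines M N A -> @intertwines M N (c *: A).
Proof. by move=> hA g Gg; rewrite -scalemxAr hA // scalemxAl. Qed.

Lemma rsimP (M N : rep) : mx_rsim M N <->
  exists A B, [/\ @intertwines M N A, @intertwines N M B,
                  A *m B = 1%:M & B *m A = 1%:M].
Proof.
split=> [|[A [B [hA hB AB BA]]]]; last first.
  have dMN : rdegree M = rdegree N.
    by apply/eqP; rewrite eqn_leq (mulmx1_min AB) (mulmx1_min BA).
  by exists A => //; apply/row_freeP; exists B.
case: M N => [m rM] [n rN]; case=> /= A emn; case: n / emn rN A => rN A.
rewrite row_free_unit => uA hA; exists A, (invmx A); split=> //.
- move=> g Gg /=.
  by apply: (canRL (mulKmx uA)); rewrite mulmxA -hA // mulmxK.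
- by rewrite mulmxV.
- by rewrite mulVmx.
Qed.

(** Biproduct form of an internal direct sum, used throughout because tensor
    products and compositions act on inclusions and projections but not on block
    decompositions. *)
Lemma rsim_dadd (M N P : rep) : mx_rsim M (dadd_grepr N P) <->
  exists i1 p1 i2 p2, [/\ [/\ @intertwines N M i1, @intertwines M N p1,
    @intertwines P M i2 & @intertwines M P p2],
    [/\ i1 *m p1 = 1%:M, i2 *m p2 = 1%:M, i1 *m p2 = 0 & i2 *m p1 = 0] &
    p1 *m i1 + p2 *m i2 = 1%:M].
Proof.
split=> [/rsimP[A [B [hA hB AB BA]]]|].
  exists (usubmx B), (lsubmx A), (dsubmx B), (rsubmx A).
  have hA' g : g \in G ->
     M g *m lsubmx A = lsubmx A *m N g /\ M g *m rsubmx A = rsubmx A *m P g.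
    move=> Gg; move: (hA g Gg); rewrite -[A]hsubmxK /= mul_mx_row mul_row_block.
    by rewrite !mulmx0 addr0 add0r => /eq_row_mx; rewrite row_mxKl row_mxKr.
  have hB' g : g \in G ->
     N g *m usubmx B = usubmx B *m M g /\ P g *m dsubmx B = dsubmx B *m M g.
    move=> Gg; move: (hB g Gg); rewrite -[B]vsubmxK /= mul_block_col mul_col_mx.
    by rewrite !mul0mx addr0 add0r => /eq_col_mx; rewrite col_mxKu col_mxKd.
  split; first by split=> g Gg; have [] := (hA' g Gg, hB' g Gg) => -[? ?] [].
    move: BA; rewrite -[A]hsubmxK -[B]vsubmxK mul_col_row scalar_mx_block.
    by move=> /eq_block_mx[]; rewrite row_mxKl row_mxKr col_mxKu col_mxKd.
  by rewrite -AB -[A in RHS]hsubmxK -[B in RHS]vsubmxK mul_row_col.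
move=> [i1 [p1 [i2 [p2 [[hi1 hp1 hi2 hp2] [e1 e2 e12 e21] e]]]]]; apply/rsimP.
exists (row_mx p1 p2), (col_mx i1 i2); split.
- move=> g Gg /=; rewrite mul_mx_row mul_row_block !mulmx0 addr0 add0r.
  by rewrite hp1 ?hp2.
- move=> g Gg /=; rewrite mul_block_col mul_col_mx !mul0mx addr0 add0r.
  by rewrite hi1 ?hi2.
- by rewrite mul_row_col.
- by rewrite mul_col_row e1 e2 e12 e21 scalar_mx_block.
Qed.

(** A split inclusion has the kernel of its retraction as a complement. *)
Lemma direct_summandP (N M : rep) : direct_summand N M <->
  exists i p, [/\ @intertwines N M i, @intertwines M N p & i *m p = 1%:M].
Proof.
split=> [[P /rsim_dadd[i [p [i2 [p2 [[hi hp _ _] [ip _ _ _] _]]]]]]|].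
  by exists i, p.
move=> [i [p [hi hp ip]]].
have modi : mxmodule M i.
  by apply/mxmoduleP => g Gg; rewrite -hi // submxMl.
have modK : mxmodule M (kermx p).
  apply/mxmoduleP => g Gg; rewrite -mulmxA; apply/sub_kermxP.
  by rewrite -mulmxA -mulmxA hp // !mulmxA mulmx_ker !mul0mx.
pose K : rep := Representation (submod_repr modK); exists K.
have hv : @intertwines K M (val_submod 1%:M).
  by move=> g Gg; rewrite -[LHS]/(submod_repr modK g *m _) -val_submodE
       -[submod_repr modK g]mul1mx val_submodJ.
have sK : (1%:M - p *m i <= kermx p)%MS.
  by apply/sub_kermxP; rewrite mulmxBl mul1mx -mulmxA ip mulmx1 subrr.
apply/rsim_dadd.
exists i, p, (val_submod 1%:M), (in_submod (kermx p) (1%:M - p *m i)).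
have vp : val_submod (1%:M : 'M_(\rank (kermx p))) *m p = 0.
  by apply/sub_kermxP; rewrite val_submod1.
split.
- split=> // g Gg; rewrite -[K g]/(submod_repr modK g).
  rewrite -[LHS]/(M g *m in_submod (kermx p) _).
  rewrite -(in_submodJ modK g sK) in_submodE [RHS]in_submodE mulmxA.
  congr (_ *m _).
  by rewrite mulmxBr mulmxBl mulmx1 mul1mx mulmxA hp // -!mulmxA hi.
- split=> //.
  + rewrite in_submodE mulmxA -in_submodE mulmxBr mulmx1 mulmxA vp mul0mx subr0.
    by rewrite val_submodK.
  + rewrite in_submodE mulmxA mulmxBr mulmx1 (mulmxA i p) ip mul1mx subrr.
    by rewrite mul0mx.
by rewrite -val_submodE in_submodK // addrC subrK.
Qed.

Lemma rsim_summand (M N : rep) : mx_rsim M N -> direct_summand M N.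
Proof. by case/rsimP => A [B [? ? ? _]]; apply/direct_summandP; exists A, B. Qed.

Lemma direct_summand_trans (P N M : rep) :
  direct_summand P N -> direct_summand N M -> direct_summand P M.
Proof.
move=> /direct_summandP[i [p [hi hp ip]]] /direct_summandP[j [q [hj hq jq]]].
apply/direct_summandP; exists (i *m j), (q *m p); split.
- exact: intertwinesM hi hj.
- exact: intertwinesM hq hp.
- by rewrite mulmxA -(mulmxA i) jq mulmx1.
Qed.

Lemma rdegree_summand (M N P : rep) : mx_rsim M (dadd_grepr N P) ->
  rdegree M = (rdegree N + rdegree P)%N.
Proof. by case. Qed.

Lemma rsim_degree0 (M N : rep) : rdegree M = 0%N -> rdegree N = 0%N ->
  mx_rsim M N.
Proof.
case: M N => [m rM] [n rN] /= em en; move: rM rN; rewrite em en => rM rN.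
exists 1%:M => // [|g Gg]; first by rewrite /row_free mxrank1.
by rewrite [LHS]flatmx0 [RHS]flatmx0.
Qed.

Lemma dadd_rsim0 (M N P : rep) : mx_rsim M (dadd_grepr N P) ->
  rdegree P = 0%N -> mx_rsim M N.
Proof.
move=> /rsim_dadd[i [p [i2 [p2 [[hi hp _ _] [ip _ _ _] e]]]]] P0.
apply/rsimP; exists p, i; split=> //; rewrite -e.
suff -> : p2 = 0 by rewrite mul0mx addr0.
by case: (P) P0 p2 {i2 e} => n r /= n0 p2; move: p2; rewrite n0 => p2; rewrite thinmx0.
Qed.

Lemma indecomposable_summand (D N : rep) : indecomposable D ->
  direct_summand N D -> (0 < rdegree N)%N -> mx_rsim D N.
Proof.
move=> [_ indD] [N' DN] N_gt0; have [N0|N'0] := indD _ _ DN.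
  by rewrite N0 in N_gt0.
exact: dadd_rsim0 DN N'0.
Qed.

(** Splitting off one indecomposable at a time, rather than refining both halves,
    makes the existence of decompositions a plain induction on the degree. *)
Lemma has_indecomposable_summand (M : rep) : (0 < rdegree M)%N ->
  exists N, [/\ indecomposable N & direct_summand N M].
Proof.
have [n] := ubnP (rdegree M); elim: n M => // n IH M; rewrite ltnS => leMn M_gt0.
have [indM|] := pselect (indecomposable M).
  by exists M; split=> //; apply: rsim_summand; apply: mx_rsim_refl.
move=> nindM; have [N1 [N2 [MN [N1_0 N2_0]]]] : exists N1 N2 : rep,
    mx_rsim M (dadd_grepr N1 N2) /\ rdegree N1 <> 0%N /\ rdegree N2 <> 0%N.
  apply: contrapT => nex; apply: nindM; split=> // N1 N2 MN.
  have [/eqP->|/eqP N1_0] := boolP (rdegree N1 == 0%N); first by left.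
  have [/eqP->|/eqP N2_0] := boolP (rdegree N2 == 0%N); first by right.
  by case: nex; exists N1, N2.
have dM := rdegree_summand MN.
have [||N [indN sNN1]] := IH N1.
- by apply: leq_trans leMn; rewrite dM -addn1 leq_add2l lt0n; apply/eqP.
- by rewrite lt0n; apply/eqP.
by exists N; split=> //; apply: direct_summand_trans sNN1 _; exists N2.
Qed.

Lemma dadd_rsim_r (N P Q : rep) : mx_rsim P Q ->
  mx_rsim (dadd_grepr N P) (dadd_grepr N Q).
Proof.
move=> /rsimP[A [B [hA hB AB BA]]]; apply/rsimP.
exists (block_mx 1%:M 0 0 A), (block_mx 1%:M 0 0 B); split.
- move=> g Gg /=; rewrite !mulmx_block !mulmx0 !mul0mx !addr0 !add0r.
  by rewrite mulmx1 mul1mx hA.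
- move=> g Gg /=; rewrite !mulmx_block !mulmx0 !mul0mx !addr0 !add0r.
  by rewrite mulmx1 mul1mx hB.
- rewrite !mulmx_block !mulmx0 !mul0mx !addr0 !add0r AB mulmx1.
  by rewrite scalar_mx_block.
- rewrite !mulmx_block !mulmx0 !mul0mx !addr0 !add0r BA mulmx1.
  by rewrite scalar_mx_block.
Qed.

Lemma indecomposable_decomposition (M : rep) :
  exists r (D : 'I_r -> rep),
    mx_rsim M (\big[dadd_grepr/grepr0]_(i < r) D i) /\
    forall i, indecomposable (D i).
Proof.
have [n] := ubnP (rdegree M); elim: n M => // n IH M; rewrite ltnS => leMn.
have [/eqP M0|] := boolP (rdegree M == 0%N).
  exists 0%N, (fun _ => M); rewrite big_ord0; split; last by case.
  exact: rsim_degree0.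
rewrite -lt0n => /has_indecomposable_summand[N [indN [P MNP]]].
have [|r [D [PD indD]]] := IH P.
  apply: leq_trans leMn; rewrite (rdegree_summand MNP) -add1n leq_add2r.
  by case: indN.
exists r.+1, (fun i => if unlift ord0 i is Some j then D j else N); split.
  rewrite big_ord_recl unlift_none.
  under eq_bigr do rewrite liftK.
  exact: mx_rsim_trans MNP (dadd_rsim_r N PD).
by move=> i; case: unliftP.
Qed.

Lemma multiplicityP (M N : rep) : has_multiplicity M N (multiplicity M N).
Proof.
have [r [D [MD indD]]] := indecomposable_decomposition M.
by apply: (@xgetPex _ 0%N (has_multiplicity M N)); eexists; exists r, D.
Qed.

(** The rank arguments need all components of a decomposition at once, as inclusions
    and projections. *)
Lemma big_dadd_biproduct (M : rep) r (D : 'I_r -> rep) :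
  mx_rsim M (\big[dadd_grepr/grepr0]_(i < r) D i) ->
  exists (e : forall i, 'M_(rdegree (D i), rdegree M))
         (q : forall i, 'M_(rdegree M, rdegree (D i))),
   [/\ forall i, @intertwines (D i) M (e i) /\ @intertwines M (D i) (q i),
       forall i, e i *m q i = 1%:M,
       forall i j, i != j -> e i *m q j = 0 &
       \sum_i q i *m e i = 1%:M].
Proof.
elim: r D M => [|r IH] D M.
  rewrite big_ord0 => /rsimP[A [B [_ _ AB _]]].
  exists (fun i => 0), (fun i => 0); split=> [[]|[]|[]|] //.
  by rewrite big_ord0 -AB [A]thinmx0 mul0mx.
rewrite big_ord_recl.
set P := (\big[_/_]_(i < r) _) => /rsim_dadd.
move=> [i1 [p1 [i2 [p2 [[hi1 hp1 hi2 hp2] [e1 e2 e12 e21] e]]]]].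
have [e' [q' [h' ee' en' es']]] :=
  IH (fun i => D (lift ord0 i)) P (mx_rsim_refl P).
(* The matrices of the families have sizes depending on the index, so that a
   family on r + 1 indices has to be glued from its head and its tail. *)
have cover (T : forall i : 'I_r.+1, Type) (x0 : T ord0) (xS : forall i, T (lift ord0 i)) :
    exists f : forall i, T i, f ord0 = x0 /\ forall i, f (lift ord0 i) = xS i.
  have spl (i : 'I_r.+1) : {j | i = lift ord0 j} + {i = ord0}.
    by case: (unliftP ord0 i) => [j ->|->]; [left; exists j | right].
  exists (fun i => match spl i with
     | inleft (exist j ej) => eq_rect_r T (xS j) ej
     | inright e => eq_rect_r T x0 e end); split=> [|i].
    case: (spl ord0) => [[j ej]|e0]; first by have := congr1 val ej.
    by rewrite (eq_irrelevance e0 erefl).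
  case: (spl _) => [[j ej]|e0]; last by have := congr1 val e0.
  have eij := lift_inj ej; move: ej; rewrite /=; case: _ / eij => ej.
  by rewrite (eq_irrelevance ej erefl).
have [ee [ee0 eeS]] := cover (fun i => 'M[F]_(rdegree (D i), rdegree M)) i1
  (fun i => e' i *m i2).
have [qq [qq0 qqS]] := cover (fun i => 'M[F]_(rdegree M, rdegree (D i))) p1
  (fun i => p2 *m q' i).
exists ee, qq; split.
- move=> i; case: (unliftP ord0 i) => [j ->|->]; last by rewrite ee0 qq0.
  rewrite eeS qqS; have [hej hqj] := h' j.
  by split; [apply: intertwinesM hej hi2 | apply: intertwinesM hp2 hqj].
- move=> i; case: (unliftP ord0 i) => [j ->|->]; last by rewrite ee0 qq0.
  by rewrite eeS qqS mulmxA -(mulmxA (e' j)) e2 mulmx1.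
- move=> i j; case: (unliftP ord0 i) => [i' ->|->];
    case: (unliftP ord0 j) => [j' ->|->]; rewrite ?eqxx // ?ee0 ?qq0 ?eeS ?qqS.
  + by move=> nij; rewrite mulmxA -(mulmxA (e' i')) e2 mulmx1 en'.
  + by rewrite -mulmxA e21 mulmx0.
  + by rewrite mulmxA e12 mul0mx.
rewrite big_ord_recl ee0 qq0 -[RHS]e; congr (_ + _).
under eq_bigr do rewrite eeS qqS mulmxA -(mulmxA p2).
by rewrite -mulmx_suml -mulmx_sumr es' mulmx1.
Qed.

(** * Multiplicities of bricks *)

(** The zero representation is included; positivity of the degree is asked for
    where it matters. *)
Definition brick (N : rep) : Prop :=
  forall A, @intertwines N N A -> exists c, A = c%:M.

(** The composites of maps from a brick to M and back are scalars, and x is the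
    matrix of these scalars; its rank is a lower bound for the multiplicity of N
    in M that does not refer to any decomposition. *)
Definition gram (N M : rep) s t (x : 'M[F]_(s, t)) : Prop :=
  exists (iota : 'I_s -> 'M[F]_(rdegree N, rdegree M))
         (pi : 'I_t -> 'M[F]_(rdegree M, rdegree N)),
  [/\ forall b, @intertwines N M (iota b), forall a, @intertwines M N (pi a) &
      forall b a, iota b *m pi a = (x b a)%:M].

Lemma brick_gram (N M : rep) s t
    (iota : 'I_s -> 'M_(rdegree N, rdegree M)) (pi : 'I_t -> 'M_(rdegree M, rdegree N)) :
  brick N -> (forall b, @intertwines N M (iota b)) ->
  (forall a, @intertwines M N (pi a)) ->
  exists x : 'M_(s, t), forall b a, iota b *m pi a = (x b a)%:M.
Proof.
move=> brN hi hp; have /choice[x hx] : forall ba, exists c, iota ba.1 *m pi ba.2 = c%:M.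
  by move=> [b a]; apply: brN; apply: intertwinesM (hi b) (hp a).
by exists (\matrix_(b, a) x (b, a)) => b a; rewrite mxE -hx.
Qed.

Lemma scalar_mx_inj n : (0 < n)%N -> injective (@scalar_mx F n).
Proof.
move=> n_gt0 a b /matrixP/(_ (Ordinal n_gt0) (Ordinal n_gt0)).
by rewrite !mxE eqxx !mulr1n.
Qed.

(** A nonzero composite would be invertible, and would split N off D. *)
Lemma brick_off_diagonal (N D : rep) A B : brick N -> (0 < rdegree N)%N ->
  indecomposable D -> ~ mx_rsim D N ->
  @intertwines N D A -> @intertwines D N B -> A *m B = 0.
Proof.
move=> brN N_gt0 indD nDN hA hB.
have [c eAB] := brN _ (intertwinesM hA hB).
have [c0|c_n0] := eqVneq c 0; first by rewrite eAB c0 raddf0.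
case: nDN; apply: indecomposable_summand => //; apply/direct_summandP.
exists A, (c^-1 *: B); split=> //; first exact: intertwinesZ.
by rewrite -scalemxAr eAB scale_scalar_mx mulVf.
Qed.

(** Inserting the decomposition of the identity of M, only the components
    isomorphic to N contribute, each with a matrix of rank one. *)
Lemma gram_rank (N M : rep) m s t (x : 'M_(s, t)) : brick N ->
  (0 < rdegree N)%N -> has_multiplicity M N m -> gram N M x ->
  (\rank x <= m)%N.
Proof.
move=> brN N_gt0 [r [D [MD indD ->]]] [iota [pi [hi hp ip]]].
have [e [q [heq eq1 eq0 qe]]] := big_dadd_biproduct MD.
set J := [pred _ | _].
have uv (i : 'I_r) : exists uv : 'cV[F]_s * 'rV[F]_t,
    forall b a, (iota b *m q i *m (e i *m pi a)) 
        = if i \in J then (uv.1 b 0 * uv.2 0 a)%:M else 0.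
  rewrite inE /=; case: asboolP => [/rsimP[psi [phi [hpsi hphi pq qp]]]|].
    have [hei hqi] := heq i.
    have /choice[u hu] : forall b, exists c, iota b *m q i *m psi = c%:M.
      by move=> b; apply: brN; apply: intertwinesM hpsi; apply: intertwinesM hqi.
    have /choice[v hv] : forall a, exists c, phi *m (e i *m pi a) = c%:M.
      by move=> a; apply: brN; apply: intertwinesM hphi _; apply: intertwinesM hei _.
    exists (\col_b u b, \row_a v a) => b a /=; rewrite !mxE.
    rewrite -[X in _ *m X = _]mul1mx -pq -(mulmxA psi) mulmxA hu hv.
    by rewrite -scalar_mxM.
  move=> nDN; exists (0, 0) => b a; have [hei hqi] := heq i.
  by apply: brick_off_diagonal (indD i) nDN _ _ => //; apply: intertwinesM.
have [uv' huv] := choice uv.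
(* One column of the left factor, and one row of the right factor, for each
   component isomorphic to N. *)
have -> : x = (\matrix_(b < s, k < #|J|) (uv' (enum_val k)).1 b 0) *m
              (\matrix_(k < #|J|, a < t) (uv' (enum_val k)).2 0 a).
  apply/matrixP => b a; rewrite mxE.
  have -> : x b a = \sum_(i in J) (uv' i).1 b 0 * (uv' i).2 0 a.
    apply: (scalar_mx_inj N_gt0).
    rewrite -ip -[iota b]mulmx1 -qe mulmx_sumr mulmx_suml raddf_sum /=.
    rewrite [RHS]big_mkcond.
    by apply: eq_bigr => i _; rewrite -huv -!mulmxA.
  rewrite big_enum_val; apply: eq_bigr => k _; by rewrite !mxE.
by apply: leq_trans (mxrankM_maxr _ _) _; apply: rank_leq_row.
Qed.

Lemma gram_attained (N M : rep) m : has_multiplicity M N m ->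
  gram N M (1%:M : 'M[F]_m).
Proof.
move=> [r [D [MD indD ->]]].
have [e [q [heq eq1 eq0 qe]]] := big_dadd_biproduct MD.
set J := [pred _ | _].
have /choice[ph hph] : forall i,
  exists ph : 'M_(rdegree N, rdegree M) * 'M_(rdegree M, rdegree N),
   i \in J -> [/\ @intertwines N M ph.1, @intertwines M N ph.2,
     ph.1 *m ph.2 = 1%:M, ph.1 *m q i *m e i = ph.1 & q i *m e i *m ph.2 = ph.2].
  move=> i; have [DN|nDN] := pselect (mx_rsim (D i) N); last first.
    by exists (0, 0); rewrite inE /= => /nDN.
  have [psi [phi [hpsi hphi pq qp]]] := (rsimP _ _).1 DN.
  have [hei hqi] := heq i; exists (phi *m e i, q i *m psi) => _; split=> /=.
  - exact: intertwinesM hphi hei.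
  - exact: intertwinesM hqi hpsi.
  - by rewrite mulmxA -(mulmxA phi) eq1 mulmx1.
  - by rewrite -(mulmxA phi) eq1 mulmx1.
  - by rewrite mulmxA -(mulmxA (q i)) eq1 mulmx1.
exists (fun k => (ph (enum_val k)).1), (fun k => (ph (enum_val k)).2).
split=> [k|k|k l].
- by have [] := hph _ (enum_valP k).
- by have [] := hph _ (enum_valP k).
have [_ _ h1 h2 _] := hph _ (enum_valP k); have [_ _ _ _ h3] := hph _ (enum_valP l).
rewrite mxE; case: (eqVneq k l) => [<-|nkl]; first by rewrite h1.
rewrite -h2 -h3 !mulmxA -(mulmxA _ (e _) (q _)) eq0 ?mulmx0 ?mul0mx ?raddf0 //.
by apply: contraNneq nkl => /enum_val_inj ->.
Qed.

(** The Krull-Schmidt theorem for the summands isomorphic to a brick. *)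
Lemma multiplicity_unique (N M : rep) m : brick N -> (0 < rdegree N)%N ->
  has_multiplicity M N m -> m = multiplicity M N.
Proof.
move=> brN N_gt0 hm; have hm' := multiplicityP M N; apply/eqP; rewrite eqn_leq.
have := gram_rank brN N_gt0 hm (gram_attained hm').
have := gram_rank brN N_gt0 hm' (gram_attained hm).
by rewrite !mxrank1 => -> ->.
Qed.

Lemma multiplicity_ge (N M : rep) m : brick N -> (0 < rdegree N)%N ->
  gram N M (1%:M : 'M[F]_m) -> (m <= multiplicity M N)%N.
Proof.
move=> brN N_gt0 /(gram_rank brN N_gt0 (multiplicityP M N)).
by rewrite mxrank1.
Qed.

Lemma multiplicity_rsim (N M M' : rep) : brick N -> (0 < rdegree N)%N ->
  mx_rsim M M' -> multiplicity M N = multiplicity M' N.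
Proof.
move=> brN N_gt0 MM'; apply/esym/multiplicity_unique => //.
have [r [D [MD indD ->]]] := multiplicityP M' N.
by exists r, D; split=> //; apply: mx_rsim_trans MD.
Qed.

Lemma multiplicity_gt0 (N M : rep) : brick N -> (0 < rdegree N)%N ->
  direct_summand N M <-> (0 < multiplicity M N)%N.
Proof.
move=> brN N_gt0; split=> [/direct_summandP[i [p [hi hp ip]]]|].
  apply: multiplicity_ge => //; exists (fun=> i), (fun=> p); split=> // b a.
  by rewrite ip mxE !ord1.
have := gram_attained (multiplicityP M N).
case: (multiplicity M N) => // m [iota [pi [hi hp ip]]] _.
apply/direct_summandP; exists (iota 0), (pi 0); split=> //.
by rewrite ip mxE eqxx.
Qed.

(** The upper bound is subadditivity of the rank; the lower bound puts together
    maximal families of both summands into a block identity matrix. *)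
Lemma multiplicity_dadd (N M M1 M2 : rep) : brick N -> (0 < rdegree N)%N ->
  mx_rsim M (dadd_grepr M1 M2) ->
  multiplicity M N = (multiplicity M1 N + multiplicity M2 N)%N.
Proof.
move=> brN N_gt0 /rsim_dadd.
move=> [i1 [p1 [i2 [p2 [[hi1 hp1 hi2 hp2] [e1 e2 e12 e21] e]]]]].
apply/eqP; rewrite eqn_leq; apply/andP; split.
  have [iota [pi [hi hp ip]]] := gram_attained (multiplicityP M N).
  move: (multiplicity M N) iota pi hi hp ip => m iota pi hi hp ip.
  have [x hx] := brick_gram brN (fun b => intertwinesM (hi b) hp1)
                   (fun a => intertwinesM hi1 (hp a)).
  have [y hy] := brick_gram brN (fun b => intertwinesM (hi b) hp2)
                   (fun a => intertwinesM hi2 (hp a)).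
  have <- : \rank (1%:M : 'M[F]_m) = m by rewrite mxrank1.
  have -> : 1%:M = x + y :> 'M_m.
    apply/matrixP => b a; rewrite [in RHS]mxE.
    apply: (@scalar_mx_inj (rdegree N)) => //; rewrite raddfD /= -hx -hy -ip.
    by rewrite !mulmxA -mulmxDl -!(mulmxA (iota b)) -mulmxDr e mulmx1.
  apply: leq_trans (mxrank_add _ _) _; apply: leq_add.
    apply: (gram_rank brN N_gt0 (multiplicityP M1 N)).
    exists (fun b => iota b *m p1), (fun a => i1 *m pi a); split=> // [b|a].
      exact: intertwinesM (hi _) hp1.
    exact: intertwinesM hi1 (hp _).
  apply: (gram_rank brN N_gt0 (multiplicityP M2 N)).
  exists (fun b => iota b *m p2), (fun a => i2 *m pi a); split=> // [b|a].
    exact: intertwinesM (hi _) hp2.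
  exact: intertwinesM hi2 (hp _).
have [j1 [q1 [hj1 hq1 jq1]]] := gram_attained (multiplicityP M1 N).
have [j2 [q2 [hj2 hq2 jq2]]] := gram_attained (multiplicityP M2 N).
apply: multiplicity_ge => //.
exists (fun b => match split b with inl b => j1 b *m i1 | inr b => j2 b *m i2 end).
exists (fun b => match split b with inl b => p1 *m q1 b | inr b => p2 *m q2 b end).
split=> [b|b|b a].
- by case: split => ?; [apply: intertwinesM hi1 | apply: intertwinesM hi2].
- by case: split => ?; [apply: intertwinesM hp1 _ | apply: intertwinesM hp2 _].
rewrite -(splitK b) -(splitK a) scalar_mx_block !unsplitK.
case: (split b) (split a) => [b'|b'] [a'|a'] /=; rewrite mulmxA.
- by rewrite -(mulmxA (j1 b')) e1 mulmx1 block_mxEul jq1.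
- by rewrite -(mulmxA (j1 b')) e12 mulmx0 mul0mx block_mxEur mxE raddf0.
- by rewrite -(mulmxA (j2 b')) e21 mulmx0 mul0mx block_mxEdl mxE raddf0.
- by rewrite -(mulmxA (j2 b')) e2 mulmx1 block_mxEdr jq2.
Qed.

End Intertwiners.

(** * Tensor products in coordinates *)

Lemma pair_ord_subproof m n (i : 'I_m) (s : 'I_n) : (i * n + s < m * n)%N.
Proof.
by rewrite (@leq_trans (i.+1 * n)) // ?leq_mul2r ?ltn_ord ?orbT // mulSn addnC ltn_add2r.
Qed.

(** The lexicographic index of a pair, which is the one implicit in [tprod]. *)
Definition pair_ord m n (i : 'I_m) (s : 'I_n) : 'I_(m * n) :=
  Ordinal (pair_ord_subproof i s).

Lemma pair_ord_inj m n (i j : 'I_m) (s t : 'I_n) :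
  (pair_ord i s == pair_ord j t) = (i == j) && (s == t).
Proof.
apply/eqP/andP => [/(congr1 val)/= e|[/eqP-> /eqP->]//].
have n_gt0 : (0 < n)%N by apply: leq_ltn_trans (ltn_ord s).
have := congr1 (modn^~ n) e; have := congr1 (divn^~ n) e.
rewrite /= !divnMDl // !modnMDl !divn_small ?modn_small // !addn0 => ei es.
by split; apply/eqP/val_inj.
Qed.

Lemma pair_ord_bij m n :
  bijective (fun u : 'I_m * 'I_n => pair_ord u.1 u.2).
Proof.
apply: inj_card_bij => [[i s] [j t] /eqP|]; last first.
  by rewrite card_prod !card_ord.
by rewrite pair_ord_inj => /andP[/eqP/= -> /eqP/= ->].
Qed.

Lemma pair_ordP m n (u : 'I_(m * n)) : exists i s, u = pair_ord i s.
Proof.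
have [f _ fK] := pair_ord_bij m n.
by exists (f u).1, (f u).2; rewrite fK.
Qed.

Lemma sum_pair_ord (V : nmodType) m n (f : 'I_(m * n) -> V) :
  \sum_u f u = \sum_i \sum_s f (pair_ord i s).
Proof.
by rewrite pair_bigA /= (reindex _ (onW_bij _ (pair_ord_bij m n))).
Qed.

Section TensorEntries.

Variable F : fieldType.

Lemma trowE n1 (A : 'rV[F]_n1) m2 n2 (B : 'M[F]_(m2, n2)) s j t :
  trow A B s (pair_ord j t) = A 0 j * B s t.
Proof.
elim: n1 A j => [A []//|n1 IH A j] /=.
case: (unliftP ord0 j) => [j' ->|->].
  have -> : pair_ord (lift ord0 j') t = rshift n2 (pair_ord j' t).
    by apply: val_inj; rewrite /= /bump /= add1n mulSn addnA.
  rewrite (@row_mxEr F m2 n2) IH mxE; congr (A _ _ * _).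
  by apply: val_inj.
have -> : pair_ord (ord0 : 'I_n1.+1) t = lshift (n1 * n2) t by exact: val_inj.
rewrite (@row_mxEl F m2 n2) !mxE; congr (A _ _ * _).
by apply: val_inj.
Qed.

Lemma tprodEij m1 n1 (A : 'M[F]_(m1, n1)) m2 n2 (B : 'M[F]_(m2, n2)) i s j t :
  tprod A B (pair_ord i s) (pair_ord j t) = A i j * B s t.
Proof.
elim: m1 A i => [A []//|m1 IH A i] /=.
case: (unliftP ord0 i) => [i' ->|->].
  have -> : pair_ord (lift ord0 i') s = rshift m2 (pair_ord i' s).
    by apply: val_inj; rewrite /= /bump /= add1n mulSn addnA.
  rewrite (@col_mxEd F m2) IH mxE; congr (A _ _ * _).
  by apply: val_inj.
have -> : pair_ord (ord0 : 'I_m1.+1) s = lshift (m1 * m2) s by exact: val_inj.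
rewrite (@col_mxEu F m2) trowE mxE; congr (A _ _ * _).
by apply: val_inj.
Qed.

(** Associativity is an equality up to a cast because the lexicographic indices
    of ((i, s), r) and (i, (s, r)) are the same number. *)
Lemma tprodA m1 n1 (A : 'M[F]_(m1, n1)) m2 n2 (B : 'M[F]_(m2, n2))
    m3 n3 (C : 'M[F]_(m3, n3)) :
  castmx (mulnA m1 m2 m3, mulnA n1 n2 n3) (tprod A (tprod B C)) =
  tprod (tprod A B) C.
Proof.
have castP m n q (i : 'I_m) (s : 'I_n) (r : 'I_q) :
    cast_ord (esym (mulnA m n q)) (pair_ord (pair_ord i s) r) = pair_ord i (pair_ord s r).
  by apply: val_inj; rewrite /= mulnDl mulnA addnA.
apply/matrixP => u v; rewrite castmxE.
have [u' [u3 ->]] := pair_ordP u; have [u1 [u2 ->]] := pair_ordP u'.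
have [v' [v3 ->]] := pair_ordP v; have [v1 [v2 ->]] := pair_ordP v'.
by rewrite !castP !tprodEij mulrA.
Qed.

Lemma tprodDr m1 n1 (A : 'M[F]_(m1, n1)) m2 n2 (B C : 'M[F]_(m2, n2)) :
  tprod A (B + C) = tprod A B + tprod A C.
Proof.
apply/matrixP => u v; have [u' [u3 ->]] := pair_ordP u.
have [v' [v3 ->]] := pair_ordP v.
by rewrite mxE !tprodEij mxE mulrDr.
Qed.

Lemma tprod0l m1 n1 m2 n2 (C : 'M[F]_(m2, n2)) :
  tprod (0 : 'M_(m1, n1)) C = 0.
Proof.
apply/matrixP => u v; have [u' [u3 ->]] := pair_ordP u.
have [v' [v3 ->]] := pair_ordP v.
by rewrite tprodEij !mxE mul0r.
Qed.

Lemma tprod0r m1 n1 m2 n2 (A : 'M[F]_(m1, n1)) :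
  tprod A (0 : 'M_(m2, n2)) = 0.
Proof.
apply/matrixP => u v; have [u' [u3 ->]] := pair_ordP u.
have [v' [v3 ->]] := pair_ordP v.
by rewrite tprodEij !mxE mulr0.
Qed.

End TensorEntries.

(** * Tensoring with a self-dual representation *)

Section TensorMultiplicity.

Variables (F : fieldType) (gT : finGroupType) (G : {group gT}).
Local Notation rep := (representation F G).

Lemma tensorA_rsim (M N P : rep) :
  mx_rsim (tensor (tensor M N) P) (tensor M (tensor N P)).
Proof.
have gen m n (e : n = m) (rM : mx_representation F G m) (rN : mx_representation F G n) :
    (forall g, rM g = castmx (e, e) (rN g)) -> mx_rsim rM rN.
  case: m / e rM => rM h; exists 1%:M => //; first by rewrite /row_free mxrank1.
  by move=> g _; rewrite mul1mx mulmx1 h castmx_id.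
by apply: (gen _ _ (mulnA _ _ _)) => g /=; rewrite tprodA.
Qed.

Lemma intertwines_tprod (M M' N N' : rep) A B :
  @intertwines _ _ _ M M' A -> @intertwines _ _ _ N N' B ->
  @intertwines _ _ _ (tensor M N) (tensor M' N') (tprod A B).
Proof. by move=> hA hB g Gg /=; rewrite -!tprodE hA // hB. Qed.

Lemma rsim_tensor_dadd (M N N1 N2 : rep) : mx_rsim N (dadd_grepr N1 N2) ->
  mx_rsim (tensor M N) (dadd_grepr (tensor M N1) (tensor M N2)).
Proof.
move=> /rsim_dadd[i1 [p1 [i2 [p2 [[hi1 hp1 hi2 hp2] [e1 e2 e12 e21] e]]]]].
apply/rsim_dadd.
exists (tprod 1%:M i1), (tprod 1%:M p1), (tprod 1%:M i2), (tprod 1%:M p2).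
split; first by split; apply: intertwines_tprod => //; apply: intertwines1.
  by rewrite -!tprodE !mulmx1 e1 e2 e12 e21 !tprod1 !tprod0r.
by rewrite -!tprodE -tprodDr e mulmx1 tprod1.
Qed.

Section Adjunction.

Variables (N M W : rep) (c c' : 'M[F]_(rdegree W)).
Hypothesis c'c : c' *m c = 1%:M.
Hypothesis Wc : forall g, g \in G -> W g *m c *m (W g)^T = c.

(** A map into, or out of, a tensor product with W is a family of matrices indexed
    by a basis of W; the adjunction acts on these families. *)
Definition slice_r m n (f : 'M[F]_(m, n * rdegree W)) t :=
  \matrix_(x < m, y < n) f x (pair_ord y t).

Definition slice_l m n (f : 'M[F]_(n * rdegree W, m)) t :=
  \matrix_(x < n, y < m) f (pair_ord x t) y.
Let d := rdegree W.

Lemma slice_l_inj m n (f f' : 'M[F]_(n * d, m)) :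
  (forall t, slice_l f t = slice_l f' t) -> f = f'.
Proof.
move=> e; apply/matrixP => u y; have [x [t ->]] := pair_ordP u.
by move: (e t) => /matrixP/(_ x y); rewrite !mxE.
Qed.

Lemma slice_r_inj m n (f f' : 'M[F]_(m, n * d)) :
  (forall t, slice_r f t = slice_r f' t) -> f = f'.
Proof.
move=> e; apply/matrixP => u y; have [x [t ->]] := pair_ordP y.
by move: (e t) => /matrixP/(_ u x); rewrite !mxE.
Qed.

Lemma unslice_l m n (f : 'I_d -> 'M[F]_(n, m)) :
  exists g : 'M_(n * d, m), forall t, slice_l g t = f t.
Proof.
have [h hK _] := pair_ord_bij n d.
exists (\matrix_(u, y) f (h u).2 (h u).1 y) => t; apply/matrixP => x y.
by rewrite !mxE (hK (x, t)).
Qed.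

Lemma unslice_r m n (f : 'I_d -> 'M[F]_(m, n)) :
  exists g : 'M_(m, n * d), forall t, slice_r g t = f t.
Proof.
have [h hK _] := pair_ord_bij n d.
exists (\matrix_(x, u) f (h u).2 x (h u).1) => t; apply/matrixP => x y.
by rewrite !mxE (hK (y, t)).
Qed.

Lemma slice_r_mull m n q (A : 'M[F]_(q, m)) (f : 'M_(m, n * d)) t :
  slice_r (A *m f) t = A *m slice_r f t.
Proof. by apply/matrixP => x y; rewrite !mxE; apply: eq_bigr => z _; rewrite !mxE. Qed.

Lemma slice_l_mulr m n q (A : 'M[F]_(m, q)) (f : 'M_(n * d, m)) t :
  slice_l (f *m A) t = slice_l f t *m A.
Proof. by apply/matrixP => x y; rewrite !mxE; apply: eq_bigr => z _; rewrite !mxE. Qed.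

Lemma slice_r_tprod m n q (f : 'M[F]_(m, n * d)) (A : 'M_(n, q)) (B : 'M_d) t :
  slice_r (f *m tprod A B) t = \sum_s B s t *: (slice_r f s *m A).
Proof.
apply/matrixP => x y; rewrite mxE mxE sum_pair_ord exchange_big summxE.
apply: eq_bigr => s _; rewrite !mxE mulr_sumr; apply: eq_bigr => z _.
by rewrite tprodEij !mxE mulrA mulrC.
Qed.

Lemma slice_l_tprod m n q (f : 'M[F]_(n * d, m)) (A : 'M_(q, n)) (B : 'M_d) t :
  slice_l (tprod A B *m f) t = \sum_s B t s *: (A *m slice_l f s).
Proof.
apply/matrixP => x y; rewrite mxE mxE sum_pair_ord exchange_big summxE.
apply: eq_bigr => s _; rewrite !mxE mulr_sumr; apply: eq_bigr => z _.
by rewrite tprodEij !mxE mulrCA mulrA.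
Qed.

Lemma mxtrace_slices m n (f : 'M[F]_(m, n * d)) (g : 'M_(n * d, m)) :
  \tr (f *m g) = \sum_t \tr (slice_r f t *m slice_l g t).
Proof.
rewrite /mxtrace exchange_big; apply: eq_bigr => x _.
rewrite mxE sum_pair_ord exchange_big; apply: eq_bigr => t _.
by rewrite !mxE; apply: eq_bigr => y _; rewrite !mxE.
Qed.

(** The form c identifies W with its dual, and moves the factor W from the target
    to the source. *)
Lemma adjunct_l f : @intertwines _ _ _ N (tensor M W) f ->
  exists f', @intertwines _ _ _ (tensor N W) M f' /\
    forall s, slice_l f' s = \sum_t c s t *: slice_r f t.
Proof.
move=> hf; have [f' ef] := unslice_l (fun s => \sum_t c s t *: slice_r f t).
exists f'; split=> // g Gg; apply: slice_l_inj => s /=.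
rewrite slice_l_tprod slice_l_mulr ef.
have hs t : N g *m slice_r f t = \sum_s (W g) s t *: (slice_r f s *m M g).
  by rewrite -slice_r_tprod -slice_r_mull hf.
under eq_bigr => u _ do rewrite ef mulmx_sumr scaler_sumr.
under eq_bigr => u _ do under eq_bigr => t _ do
  rewrite -scalemxAr hs !scaler_sumr.
rewrite mulmx_suml.
under eq_bigr => u _ do rewrite exchange_big /=.
rewrite exchange_big /=; apply: eq_bigr => s' _.
rewrite -scalemxAl -{2}(Wc Gg) -mulmxA !mxE.
rewrite scaler_suml; apply: eq_bigr => u _; rewrite mxE mulr_sumr scaler_suml.
by apply: eq_bigr => t _; rewrite !scalerA mxE mulrA.
Qed.

(** The inverse c' of the form is invariant as well, and moves W the other way. *)
Lemma adjunct_r f : @intertwines _ _ _ (tensor M W) N f ->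
  exists f', @intertwines _ _ _ M (tensor N W) f' /\
    forall s, slice_r f' s = \sum_u c' u s *: slice_l f u.
Proof.
move=> hf; have [f' ef] := unslice_r (fun s => \sum_u c' u s *: slice_l f u).
exists f'; split=> // g Gg; apply: slice_r_inj => t /=.
rewrite slice_r_tprod slice_r_mull ef.
have hs u : slice_l f u *m N g = \sum_v (W g) u v *: (M g *m slice_l f v).
  by rewrite -slice_l_tprod -slice_l_mulr -hf.
have Wc' : (W g)^T *m c' *m W g = c'.
  have cc' : c *m c' = 1%:M by exact: mulmx1C.
  have e1 : W g *m (c *m (W g)^T *m c') = 1%:M by rewrite !mulmxA Wc.
  move/mulmx1C: e1; rewrite -!mulmxA => /(congr1 (mulmx c')).
  by rewrite !mulmxA c'c mul1mx mulmx1.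
under [RHS]eq_bigr => s _ do rewrite ef mulmx_suml scaler_sumr.
under [RHS]eq_bigr => s _ do under eq_bigr => u _ do
  rewrite -scalemxAl hs !scaler_sumr.
rewrite mulmx_sumr.
under [RHS]eq_bigr => u _ do rewrite exchange_big /=.
rewrite [RHS]exchange_big /=; apply: eq_bigr => v _.
rewrite -scalemxAr -{1}Wc' !mxE.
rewrite scaler_suml; apply: eq_bigr => s _; rewrite mxE mulr_suml scaler_suml.
apply: eq_bigr => u _; rewrite !scalerA mxE; congr (_ *: _).
by rewrite mulrC mulrA mulrAC.
Qed.

(** The forms c and c' cancel, so the adjunction preserves the trace pairing; this
    is why multiplicities can be read off from traces. *)
Lemma mxtrace_adjunct f g f' g' :
  (forall s, slice_l f' s = \sum_t c s t *: slice_r f t) ->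
  (forall s, slice_r g' s = \sum_u c' u s *: slice_l g u) ->
  \tr (g' *m f' : 'M_(rdegree M)) = \tr (f *m g : 'M_(rdegree N)).
Proof.
move=> ef eg; rewrite !mxtrace_slices.
under eq_bigr => s _ do rewrite ef eg mulmx_sumr raddf_sum /=.
under eq_bigr => s _ do under eq_bigr => t _ do
  rewrite -scalemxAr mxtraceZ mulmx_suml raddf_sum mulr_sumr /=.
rewrite exchange_big /=; apply: eq_bigr => t _.
rewrite exchange_big /= (bigD1 t) //= [X in _ + X]big1 ?addr0.
  under eq_bigr => s _ do rewrite -scalemxAl mxtraceZ mulrA [c _ _ * _]mulrC.
  rewrite -mulr_suml; have /matrixP/(_ t t) := c'c; rewrite !mxE eqxx => ->.
  by rewrite mul1r mxtrace_mulC.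
move=> u nut.
under eq_bigr => s _ do rewrite -scalemxAl mxtraceZ mulrA [c _ _ * _]mulrC.
rewrite -mulr_suml; have /matrixP/(_ u t) := c'c; rewrite !mxE (negbTE nut) => ->.
by rewrite mul0r.
Qed.

End Adjunction.

(** Upper bound: after adjunction, the traces deg(N) times the identity matrix
    become the sum of deg(Nk) times the matrix of composites through Nk, and a
    term whose degree vanishes in F drops out.  Lower bound: every component of M
    isomorphic to N1 or N2 contributes a copy of N after tensoring with W.  The
    strict inequality between degrees makes these two kinds of components
    disjoint. *)
Lemma multiplicity_tensor (N M W N1 N2 : rep) (c c' : 'M[F]_(rdegree W)) :
  c' *m c = 1%:M -> (forall g, g \in G -> W g *m c *m (W g)^T = c) ->
  brick N -> brick N1 -> brick N2 -> (rdegree N)%:R != 0 :> F ->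
  (rdegree N1 < rdegree N2)%N ->
  ((rdegree N1)%:R != 0 :> F -> direct_summand N (tensor N1 W)) ->
  ((rdegree N2)%:R != 0 :> F -> direct_summand N (tensor N2 W)) ->
  mx_rsim (tensor N W) (dadd_grepr N1 N2) ->
  multiplicity (tensor M W) N =
    (((rdegree N1)%:R != 0 :> F)%R * multiplicity M N1 + 
     ((rdegree N2)%:R != 0 :> F)%R * multiplicity M N2)%N.
Proof.
move=> c'c Wc brN brN1 brN2 degN ltN12 sN1 sN2 NW.
have gt0 (P : rep) : (rdegree P)%:R != 0 :> F -> (0 < rdegree P)%N.
  by case: (rdegree P) => //; rewrite eqxx.
have N_gt0 := gt0 _ degN.
apply/eqP; rewrite eqn_leq; apply/andP; split.
  have [iota [pi [hi hp ip]]] := gram_attained (multiplicityP (tensor M W) N).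
  move: (multiplicity _ N) iota pi hi hp ip => m iota pi hi hp ip.
  have /choice[fi hfi] b := adjunct_l Wc (hi b).
  have /choice[fp hfp] a := adjunct_r c'c Wc (hp a).
  move/rsim_dadd: NW => [i1 [p1 [i2 [p2 [[hi1 hp1 hi2 hp2] _ e]]]]].
  have [x hx] := brick_gram brN1 (fun b => intertwinesM hi1 (hfi b).1)
                   (fun a => intertwinesM (hfp a).1 hp1).
  have [y hy] := brick_gram brN2 (fun b => intertwinesM hi2 (hfi b).1)
                   (fun a => intertwinesM (hfp a).1 hp2).
  have exy : (rdegree N)%:R *: 1%:M = (rdegree N1)%:R *: x + (rdegree N2)%:R *: y.
    apply/matrixP => b a; rewrite !mxE.
    have <- : \tr (iota b *m pi a) = (rdegree N)%:R * (b == a)%:R.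
      by rewrite ip mxtrace_scalar mxE mulr_natl.
    rewrite -(mxtrace_adjunct c'c (hfi b).2 (hfp a).2) mxtrace_mulC.
    rewrite -[fi b]mul1mx -e !mulmxDl mxtraceD -!mulmxA.
    rewrite ![\tr (_ *m (_ *m (_ *m _)))]mxtrace_mulC !mulmxA.
    rewrite -[_ *m _ *m _ *m p1]mulmxA hx -[_ *m _ *m _ *m p2]mulmxA hy.
    by rewrite !mxtrace_scalar !mulr_natl.
  have <- : \rank ((rdegree N)%:R *: 1%:M : 'M[F]_m) = m.
    by rewrite mxrank_scale_nz // mxrank1.
  rewrite exy; apply: leq_trans (mxrank_add _ _) _; apply: leq_add.
    case: eqP => [->|/eqP deg1]; first by rewrite scale0r mxrank0.
    rewrite mul1n mxrank_scale_nz //.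
    apply: (gram_rank brN1 (gt0 _ deg1) (multiplicityP M N1)).
    by exists (fun b => i1 *m fi b), (fun a => fp a *m p1); split=> // [b|a];
      [apply: intertwinesM hi1 (hfi b).1 | apply: intertwinesM (hfp a).1 hp1].
  case: eqP => [->|/eqP deg2]; first by rewrite scale0r mxrank0.
  rewrite mul1n mxrank_scale_nz //.
  apply: (gram_rank brN2 (gt0 _ deg2) (multiplicityP M N2)).
  by exists (fun b => i2 *m fi b), (fun a => fp a *m p2); split=> // [b|a];
    [apply: intertwinesM hi2 (hfi b).1 | apply: intertwinesM (hfp a).1 hp2].
have [r [D [MD indD]]] := indecomposable_decomposition M.
have [e [q [heq eq1 eq0 qe]]] := big_dadd_biproduct MD.
(* Both multiplicities are counted in one and the same decomposition of M. *)
pose J P := [pred i | (((rdegree P)%:R : F) != 0) && `[< mx_rsim (D i) P >]].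
have cardJ P : brick P -> (((rdegree P)%:R != 0 :> F)%R * multiplicity M P)%N = #|J P|.
  move=> brP; case: eqP => [degP|/eqP degP].
    by rewrite eq_card0 // => i; rewrite inE /= degP eqxx.
  rewrite mul1n -(multiplicity_unique brP (gt0 _ degP) (m := #|J P|)) //.
  by exists r, D; split=> //; apply: eq_card => i; rewrite !inE degP.
rewrite !cardJ //.
have -> : (#|J N1| + #|J N2|)%N = #|[predU J N1 & J N2]|.
  rewrite -cardUI addnC eq_card0 ?add0n // => i; rewrite !inE.
  apply/negP => /andP[/andP[_ /asboolP r1] /andP[_ /asboolP r2]].
  by move: ltN12; rewrite -(mxrank_rsim r1) -(mxrank_rsim r2) ltnn.
set K := [predU _ & _].
have /choice[ph hph] : forall i, exists ph : 'M_(rdegree N, rdegree M * rdegree W) *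
                                        'M_(rdegree M * rdegree W, rdegree N),
   i \in K -> [/\ @intertwines _ _ _ N (tensor M W) ph.1,
     @intertwines _ _ _ (tensor M W) N ph.2,
     ph.1 *m ph.2 = 1%:M, ph.1 *m tprod (q i *m e i) 1%:M = ph.1 &
     tprod (q i *m e i) 1%:M *m ph.2 = ph.2].
  move=> i; have [Ki|nKi] := boolP (i \in K); last by exists (0, 0).
  have : direct_summand N (tensor (D i) W).
    have trans (P : rep) : mx_rsim (D i) P -> direct_summand N (tensor P W) ->
        direct_summand N (tensor (D i) W).
      move=> /rsimP[A [B [hA hB AB BA]]] /direct_summand_trans; apply.
      apply/direct_summandP; exists (tprod B 1%:M), (tprod A 1%:M); split.
      - by apply: intertwines_tprod hB _; apply: intertwines1.
      - by apply: intertwines_tprod hA _; apply: intertwines1.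
      - by rewrite -tprodE BA mulmx1 tprod1.
    move: Ki; rewrite !inE => /orP[]/andP[degP /asboolP DP]; apply: trans DP _.
      exact: sN1.
    exact: sN2.
  move=> /direct_summandP[h [h' [hh hh' hh1]]]; have [hei hqi] := heq i.
  exists (h *m tprod (e i) 1%:M, tprod (q i) 1%:M *m h') => _; split=> /=.
  - by apply: intertwinesM hh _; apply: intertwines_tprod hei _; apply: intertwines1.
  - by apply: intertwinesM _ hh'; apply: intertwines_tprod hqi _; apply: intertwines1.
  - by rewrite mulmxA -(mulmxA h) -tprodE eq1 mulmx1 tprod1 mulmx1.
  - by rewrite -(mulmxA h) -tprodE mulmxA eq1 mul1mx mulmx1.
  - by rewrite mulmxA -tprodE -(mulmxA (q i)) eq1 !mulmx1.
apply: multiplicity_ge => //.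
exists (fun k => (ph (enum_val k)).1), (fun k => (ph (enum_val k)).2).
split=> [k|k|k l].
- by have [] := hph _ (enum_valP k).
- by have [] := hph _ (enum_valP k).
have [_ _ h1 h2 _] := hph _ (enum_valP k); have [_ _ _ _ h3] := hph _ (enum_valP l).
rewrite mxE; case: (eqVneq k l) => [<-|nkl]; first by rewrite h1.
rewrite -h2 -h3 !mulmxA -(mulmxA _ (tprod _ _) (tprod _ _)) -tprodE.
rewrite mulmxA -(mulmxA _ (e _) (q _)) eq0.
  by rewrite mulmx0 mul0mx tprod0l mulmx0 mul0mx raddf0.
by apply: contraNneq nkl => /enum_val_inj ->.
Qed.

End TensorMultiplicity.

(** * Binary forms over SL2(F_p) *)

Lemma det_mx22 (R : comNzRingType) (A : 'M[R]_2) :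
  \det A = A 0 0 * A 1 1 - A 0 1 * A 1 0.
Proof.
rewrite (expand_det_row _ 0) !big_ord_recl big_ord0 addr0 /cofactor !det_mx11 !mxE /=.
rewrite expr0 expr1 mul1r mulN1r mulrN.
by congr (A _ _ * A _ _ - A _ _ * A _ _); apply: val_inj.
Qed.

Lemma matrix_of_pairs (F : Type) m n q (f : 'I_m -> 'I_n -> 'I_q -> F) :
  exists A : 'M_(m * n, q), forall i s j, A (pair_ord i s) j = f i s j.
Proof.
have [h hK _] := pair_ord_bij m n.
by exists (\matrix_(u, j) f (h u).1 (h u).2 j) => i s j; rewrite mxE (hK (i, s)).
Qed.

Lemma sum_delta (R : nzSemiRingType) n (f : 'I_n -> R) (b : 'I_n -> bool) j :
  (forall i, b i = (i == j)) -> \sum_i f i * (b i)%:R = f j.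
Proof.
move=> hb; rewrite (bigD1 j) //= hb eqxx mulr1 big1 ?addr0 // => i ni.
by rewrite hb (negbTE ni) mulr0.
Qed.

Lemma sum_delta0 (R : nzSemiRingType) n (f : 'I_n -> R) (b : 'I_n -> bool) :
  (forall i, b i = false) -> \sum_i f i * (b i)%:R = 0.
Proof. by move=> hb; rewrite big1 // => i _; rewrite hb mulr0. Qed.

Section BinaryForms.

Variables (p : nat) (k : fieldType).
Implicit Types g : {'GL_2['F_p]}.

Local Notation entry g i j := (Fp_embed k (GLval g i j)).

(** Setting Y = 1 turns forms of degree n - 1 into univariate polynomials of degree
    less than n; these are the images of X and Y under g. *)
Definition imX g : {poly k} := (entry g 0 0)%:P * 'X + (entry g 1 0)%:P.
Definition imY g : {poly k} := (entry g 0 1)%:P * 'X + (entry g 1 1)%:P.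

Definition V_col n g (j : nat) : {poly k} := imX g ^+ j * imY g ^+ (n.-1 - j).

Let dehom (i : 'I_2) : {poly k} := if i == ord0 then 'X else 1.

Lemma coef_dehom n (f : {mpoly k[2]}) (i : 'I_n.+1) : f \is n.-homog ->
  (mmap (@polyC k) dehom f)`_i = f@_(monXY i).
Proof.
move=> /homog_monXY ef; rewrite [X in mmap _ _ X]ef.
rewrite (raddf_sum (mmap (@polyC k) dehom)) coef_sum (bigD1 i) //=.
rewrite [X in _ + X]big1 => [|l nli];
  rewrite mmapZ mmapX /mmap1 big_ord_recl big_ord1 !mnmE /dehom /=;
  rewrite expr1n mulr1 coefCM coefXn.
  by rewrite eqxx mulr1 addr0.
by rewrite (inj_eq val_inj) eq_sym (negbTE nli) mulr0.
Qed.

(** All computations with V_n are made on the dehomogenized images of the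
    monomials. *)
Lemma V_mx_coef n g (i j : 'I_n) : V_mx k n g i j = (V_col n g j)`_i.
Proof.
case: n i j => [[]//|n] i j; rewrite mxE.
rewrite -coef_dehom; last first.
  by apply: subst_act_homog; rewrite dhomogX; apply/eqP; exact: (mdeg_monXY j).
congr (_`_ _).
have dehomE (l : 'I_2) :
    mmap (@polyC k) dehom (tnth [tuple \sum_(i0 < 2) entry g i0 j0 *: 'X_i0 | j0 < 2] l) =
    (entry g 0 l)%:P * 'X + (entry g 1 l)%:P.
  rewrite tnth_mktuple big_ord_recl big_ord1 raddfD /= !mmapZ !mmapX !mmap1U /dehom /=.
  rewrite mulr1; congr (_%:P * _ + _%:P);
  by congr (Fp_embed k (GLval g _ _)); exact: val_inj.
rewrite /subst_act comp_mpolyX rmorph_prod /= big_ord_recl big_ord1.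
rewrite !rmorphXn !mnmE /V_col /= !dehomE.
by have -> : lift ord0 ord0 = 1 :> 'I_2 by exact: val_inj.
Qed.


Hypothesis pk : p \in [pchar k].
Let p_prime : prime p := pcharf_prime pk.

Lemma SL2_elt (A : 'M['F_p]_2) : \det A = 1 ->
  exists2 g, g \in SL2_group p & GLval g = A.
Proof.
move=> dA; have uA : A \is a GRing.unit.
  by rewrite -[_ \is a _]/(A \in unitmx) unitmxE dA unitr1.
by exists (FinRing.unit _ uA); rewrite ?inE //= dA.
Qed.

Lemma Fp_embed_nat a : Fp_embed k (a%:R : 'F_p) = a%:R.
Proof. by rewrite /Fp_embed val_Fp_nat // (GRing.natr_mod_pchar pk). Qed.

Lemma SL2_entries (a b c d : 'F_p) : a * d - b * c = 1 ->
  exists2 g, g \in SL2_group p & [/\ entry g 0 0 = Fp_embed k a,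
   entry g 0 1 = Fp_embed k b, entry g 1 0 = Fp_embed k c & entry g 1 1 = Fp_embed k d].
Proof.
move=> h; pose A : 'M['F_p]_2 := \matrix_(i, j)
  if i == 0 then (if j == 0 then a else b) else (if j == 0 then c else d).
have [|g Gg eg] := @SL2_elt A; first by rewrite det_mx22 !mxE.
by exists g => //; rewrite eg !mxE.
Qed.

Lemma entry_det g : g \in SL2_group p ->
  entry g 0 0 * entry g 1 1 - entry g 0 1 * entry g 1 0 = 1 :> k.
Proof.
rewrite inE => /eqP; rewrite (det_mx22 (GLval g)) => e.
have e' : GLval g 0 0 * GLval g 1 1 = 1 + GLval g 0 1 * GLval g 1 0.
  by rewrite -e subrK.
rewrite -!(Fp_embedM pk) e' (Fp_embedD pk) addrK.
by rewrite -[1]/(1%:R) Fp_embed_nat.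
Qed.

Lemma poly0_of_roots (q : {poly k}) : (size q <= p)%N ->
  (forall a, q.[a%:R] = 0) -> q = 0.
Proof.
move=> sq rq; apply/eqP/negPn/negP => q0.
have := max_poly_roots q0 (rs := [seq i%:R | i <- iota 0 p]).
rewrite size_map size_iota ltnNge sq => /(_ _ _)/negP; case=> //.
  by apply/allP => x /mapP[i _ ->]; apply/rootP.
rewrite map_inj_in_uniq ?iota_uniq // => i j; rewrite !mem_iota /= add0n => ip jp.
have H (a b : nat) : (a <= b)%N -> (b < p)%N -> a%:R = b%:R :> k -> a = b.
  move=> ab bp /eqP; rewrite eq_sym -subr_eq0 -natrB // -(dvdn_pcharf pk) => pd.
  have : (b - a == 0)%N.
    rewrite -leqn0 leqNgt; apply/negP => /dvdn_leq/(_ pd).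
    by rewrite leqNgt (leq_ltn_trans _ bp) // leq_subr.
  by rewrite subn_eq0 => ba; apply/eqP; rewrite eqn_leq ab ba.
by case: (leqP i j) => [ij /H->|/ltnW ij /esym/H->].
Qed.

Lemma bin_neq0 m j : (m < p)%N -> (j <= m)%N -> ('C(m, j))%:R != 0 :> k.
Proof.
move=> mp jm; rewrite -(dvdn_pcharf pk); apply/negP => pd.
have : (p %| m`!)%N by rewrite -(bin_fact jm) dvdn_mulr.
elim: m mp {jm pd} => [|m IH] mp; first by rewrite Euclid_dvd1.
rewrite factS Euclid_dvdM // => /orP[/(dvdn_leq (ltn0Sn m))|]; first by rewrite leqNgt mp.
by apply: IH; apply: ltnW.
Qed.

(** The unipotent X |-> X + Y acts on dehomogenized forms as f(X) |-> f(X + 1), whose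
    fixed vectors are the constants as long as n <= p; so an endomorphism maps
    Y^(n-1) to a multiple of itself.  The translates (bX + Y)^(n-1) span V_n, since
    the binomial coefficients are invertible and a polynomial of degree less than p
    that vanishes on F_p is zero; so the endomorphism is that multiple. *)
Lemma brick_V n : (n <= p)%N -> brick (V pk n).
Proof.
case: n => [|m] mp A hA; first by exists 0; apply/matrixP => -[].
have [l Gl [l00 l01 l10 l11]] : exists2 g, g \in SL2_group p &
  [/\ entry g 0 0 = 1, entry g 0 1 = 0, entry g 1 0 = 1 & entry g 1 1 = 1].
  have [|g Gg] := @SL2_entries 1%:R 0%:R 1%:R 1%:R; first by rewrite mul0r subr0 mulr1.
  by rewrite !Fp_embed_nat; exists g.
have Ai0 i : A i 0 = if i == 0 then A 0 0 else 0.
  pose f := \poly_(j < m.+1) (if insub j is Some i then A i 0 else 0).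
  have fE j : f`_(val j) = A j 0.
    by rewrite coef_poly ltn_ord valK.
  have sf : (size f <= m.+1)%N by apply: size_poly.
  have fX : f \Po ('X + 1) = f.
    apply/polyP => j; case: (ltnP j m.+1) => jm; last first.
      rewrite !nth_default ?(leq_trans sf) // size_comp_poly2 ?(leq_trans sf) //.
      by rewrite -[1]/(1%:P) size_XaddC.
    rewrite -[j]/(val (Ordinal jm)) fE.
    have /matrixP/(_ (Ordinal jm) 0) := hA _ Gl.
    rewrite !mxE [RHS](bigD1 ord0) //= [X in _ = _ + X]big1 => [|j' nj']; last first.
      rewrite /V_mx V_mx_coef /V_col expr0 mul1r /imY l01 l11 mul0r add0r expr1n coef1.
      by rewrite -[(_ == 0)%N]/(j' == ord0) (negbTE nj') mulr0.
    rewrite V_mx_coef /V_col expr0 mul1r /imY l01 l11 mul0r add0r expr1n coef1.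
    rewrite mulr1 addr0 => <-; rewrite comp_polyE coef_sum.
    rewrite (big_ord_widen m.+1 (fun i => (f`_i *: ('X + 1) ^+ i)`_j)) // big_mkcond.
    apply: eq_bigr => s _; rewrite V_mx_coef /V_col /imX /imY l00 l01 l10 l11.
    rewrite mul1r mul0r add0r expr1n mulr1 polyC1 coefZ fE mulrC.
    by case: ltnP => // fi; rewrite -fE (nth_default 0 fi) mulr0.
  (* A polynomial invariant under translation takes the same value at
     0, ..., p - 1. *)
  have f0 : f - (f.[0])%:P = 0.
    apply: poly0_of_roots.
      apply: leq_trans (size_polyD _ _) _; rewrite geq_max size_polyN (leq_trans sf) //.
      by rewrite (leq_trans (size_polyC_leq1 _)) // (prime_gt0 p_prime).
    move=> a; rewrite !hornerE; apply/eqP; rewrite subr_eq0; apply/eqP.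
    elim: a => // a <-; rewrite -[in RHS]fX horner_comp !hornerE.
    by rewrite -natr1.
  have := congr1 (coefp (val i)) f0; rewrite /= coefB fE coefC coef0.
  move/eqP; rewrite subr_eq0 -[(_ == 0)%N]/(i == 0) => /eqP ->.
  case: eqP => // _; by rewrite horner_coef0 -(fE 0).
exists (A 0 0); apply/matrixP => i j; rewrite mxE.
(* The i-th row of A minus the scalar, as a polynomial in the parameter b of
   the translate (bX + Y)^m. *)
pose e (j : nat) := if insub j is Some j' then A i j' - A 0 0 *+ (i == j') else 0.
pose f : {poly k} := \poly_(j < m.+1) (e j * 'C(m, j)%:R).
have f0 : f = 0.
  apply: poly0_of_roots; first by apply: leq_trans mp; apply: size_poly.
  move=> b; have [|g Gg [g00 g01 g10 g11]] := @SL2_entries 1%:R b%:R 0%:R 1%:R.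
    by rewrite mulr0 subr0 mulr1.
  have colE (s : 'I_m.+1) : V_mx k m.+1 g s 0 = b%:R ^+ s * 'C(m, s)%:R.
    rewrite V_mx_coef /V_col expr0 mul1r /imY g01 g11 !Fp_embed_nat subn0 /=.
    rewrite -/(1%:R) addrC exprDn coef_sum (bigD1 s) //= big1 => [|t nt].
      rewrite addr0 expr1n mul1r coefMn exprMn -rmorphXn /= coefCM coefXn eqxx mulr1.
      by rewrite mulr_natr.
    rewrite expr1n mul1r coefMn exprMn -rmorphXn /= coefCM coefXn.
    by rewrite (inj_eq val_inj) eq_sym (negbTE nt) mulr0 mul0rn.
  have /matrixP/(_ i 0) := hA _ Gg; rewrite !mxE.
  rewrite (bigD1 ord0) //= [X in _ + X]big1 => [|j' nj']; last first.
    by rewrite Ai0 (negbTE nj') mulr0.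
  rewrite addr0 colE => VA; rewrite horner_poly.
  have -> : \sum_(s < m.+1) (e s * 'C(m, s)%:R) * b%:R ^+ s =
    \sum_s (A i s * V_mx k m.+1 g s 0 - A 0 0 *+ (i == s) * V_mx k m.+1 g s 0).
    apply: eq_bigr => s _; rewrite /e valK colE mulrBl mulrBl -!mulrA.
    by rewrite ![_%:R * b%:R ^+ s]mulrC.
  rewrite sumrB -VA (bigD1 i) //= eqxx [X in _ - (_ + X)]big1 => [|s ns]; last first.
    by rewrite eq_sym (negbTE ns) mul0r.
  by rewrite colE mulr1n addr0 mulrC; apply: subrr.
have := congr1 (coefp (val j)) f0; rewrite /= coef_poly ltn_ord /e valK coef0.
move/eqP; rewrite mulf_eq0 (negbTE (bin_neq0 mp (leq_ord j))) orbF subr_eq0.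
by move/eqP.
Qed.

Lemma V2_entries g : [/\ V_mx k 2 g 0 0 = entry g 1 1, V_mx k 2 g 0 1 = entry g 1 0,
   V_mx k 2 g 1 0 = entry g 0 1 & V_mx k 2 g 1 1 = entry g 0 0].
Proof.
rewrite !V_mx_coef /V_col !expr0 !expr1 mulr1 mul1r /imX /imY.
by rewrite !coefD !coefC !coefCM !coefX /= !mulr0 !mulr1 !add0r !addr0.
Qed.

(** The invariant form of V_2, coming from the determinant. *)
Definition symplectic : 'M[k]_2 := \matrix_(i, j) if i == j then 0 else (-1) ^+ i.

Lemma symplecticV : (- symplectic) *m symplectic = 1%:M.
Proof.
apply/matrixP => i j; rewrite !mxE big_ord_recl big_ord1 !mxE.
by case: i => [[|[|//]] ?]; case: j => [[|[|//]] ?] //=; ring.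
Qed.

Lemma V2_symplectic g : g \in SL2_group p ->
  V_mx k 2 g *m symplectic *m (V_mx k 2 g)^T = symplectic.
Proof.
move=> /(entry_det) dg; have [e00 e01 e10 e11] := V2_entries g.
have ord2 (i : 'I_2) : i = 0 \/ i = 1.
  by case: i => [[|[|//]] ?]; [left|right]; exact: val_inj.
move: (V_mx k 2 g) e00 e01 e10 e11 => W e00 e01 e10 e11.
apply/matrixP => i j; rewrite !mxE big_ord_recl big_ord1 !mxE.
rewrite !big_ord_recl !big_ord0 !mxE.
have -> : lift ord0 ord0 = 1 :> 'I_2 by exact: val_inj.
have -> : ord0 = 0 :> 'I_2 by [].
rewrite /= expr0 expr1.
move: dg => /=; set D := _ - _ => dg.
case: (ord2 i) => ->; case: (ord2 j) => ->;
  rewrite ?(e00, e01, e10, e11) /= ?expr0 ?expr1.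
- by ring.
- by rewrite -[RHS]dg /D; ring.
- by rewrite -[RHS]mulN1r -[X in -1 * X]dg /D; ring.
- by ring.
Qed.

(** The factor J makes the identity true for J = 0, where the exponent J.-1 is
    truncated. *)
Lemma V_col_step1 n g J : (J <= n)%N ->
  J%:R *: V_col n.+1 g J = J%:R *: (imX g * V_col n g J.-1).
Proof.
case: J => [|J] Jn; first by rewrite !scale0r.
rewrite /V_col /= mulrA -exprS; congr (_ *: (_ * _ ^+ _)).
by case: n Jn => // n _; rewrite subSS.
Qed.

Lemma V_col_step2 n g J : (J <= n)%N ->
  (n - J)%:R *: V_col n.+1 g J = (n - J)%:R *: (imY g * V_col n g J).
Proof.
rewrite leq_eqVlt => /orP[/eqP->|Jn]; first by rewrite subnn !scale0r.
rewrite /V_col /= mulrCA -exprS; congr (_ *: (_ * _ ^+ _)).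
by case: n Jn => // n; rewrite ltnS => Jn /=; rewrite subSn.
Qed.

(** Chain rule: the X-derivative of the image of X^J Y^(n-J) is the combination of
    the images of its two partial derivatives. *)
Lemma V_col_deriv n g J : (J <= n)%N ->
  (V_col n.+1 g J)^`() = J%:R *: ((entry g 0 0) *: V_col n g J.-1) +
    (n - J)%:R *: (entry g 0 1 *: V_col n g J).
Proof.
move=> Jn; rewrite /V_col derivM !deriv_exp /=.
have -> : (imX g)^`() = (entry g 0 0)%:P.
  by rewrite derivD derivC addr0 derivM derivC derivX mul0r add0r mulr1.
have -> : (imY g)^`() = (entry g 0 1)%:P.
  by rewrite derivD derivC addr0 derivM derivC derivX mul0r add0r mulr1.
rewrite [J%:R *: _]scaler_nat [(n - J)%:R *: _]scaler_nat mulrnAl mulrnAr.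
rewrite -!mul_polyC mulrA mulrCA.
congr (_ + _ *+ _); last first.
  congr (_ * (_ * _ ^+ _)).
  by rewrite -subnS; case: (n).
case: J Jn => [|J] Jn //; congr (_ * _ ^+ _ *+ _).
by case: (n) Jn.
Qed.


Lemma size_V_col n g J : (J < n)%N -> (size (V_col n g J) <= n)%N.
Proof.
move=> Jn; have sz (a b : k) : ((size (a%:P * 'X + b%:P)%R).-1 <= 1)%N.
  have s2 : (size (a%:P * 'X + b%:P)%R <= 2)%N.
    apply: leq_trans (size_polyD _ _) _; rewrite geq_max mul_polyC.
    rewrite (leq_trans (size_scale_leq _ _)) ?size_polyX //.
    exact: leq_trans (size_polyC_leq1 _) _.
  by case: (size _) s2.
have sn m : (size (imX g ^+ m) <= m.+1)%N.
  apply: leq_trans (size_poly_exp_leq _ _) _.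
  by rewrite ltnS -[X in (_ <= X)%N]mul1n leq_mul2r sz orbT.
have sd m : (size (imY g ^+ m) <= m.+1)%N.
  apply: leq_trans (size_poly_exp_leq _ _) _.
  by rewrite ltnS -[X in (_ <= X)%N]mul1n leq_mul2r sz orbT.
apply: leq_trans (size_polyMleq _ _) _; rewrite -subn1 leq_subLR.
apply: leq_trans (leq_add (sn _) (sd _)) _.
by rewrite addSn addnS subnKC; case: n Jn => // n; rewrite ltnS.
Qed.

(** Matrix of the map f |-> f_X (x) X + f_Y (x) Y from V_{m+2} to the tensor product
    of V_{m+1} and V_2. *)
Definition is_polarization m (P : 'M[k]_(m.+1 * 2, m.+2)) := forall i s J,
  P (pair_ord i s) J = if s == 0 then (m.+1 - J)%:R * (i == J :> nat)%:R
                       else J%:R * (i.+1 == J :> nat)%:R.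

(** Matrix of the map f |-> fX (x) Y - fY (x) X from V_m to the same tensor product. *)
Definition is_alternation m (P : 'M[k]_(m.+1 * 2, m)) := forall i s J,
  P (pair_ord i s) J = if s == 0 then (i == J.+1 :> nat)%:R
                       else - (i == J :> nat)%:R.

(** The coefficient of X is the chain rule; the coefficient of Y is the chain rule
    combined with Euler's formula, which expresses f_Y as (deg f) f - X f_X after
    setting Y = 1. *)
Lemma polarization_intertwines m P : @is_polarization m P ->
  @intertwines _ _ _ (tensor (V pk m.+1) (V pk 2)) (V pk m.+2) P.
Proof.
move=> hP g Gg; change (tprod (V_mx k m.+1 g) (V_mx k 2 g) *m P = P *m V_mx k m.+2 g).
apply/matrixP => u J; have [i [r ->]] := pair_ordP u.
have Jm : (J <= m.+1)%N by rewrite -ltnS.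
have [e00 e01 e10 e11] := V2_entries g.
rewrite [LHS]mxE [RHS]mxE sum_pair_ord.
under eq_bigr => j _ do rewrite big_ord_recl big_ord1 !tprodEij !hP /=.
have -> : lift ord0 ord0 = 1 :> 'I_2 by exact: val_inj.
under [RHS]eq_bigr => J' _ do rewrite V_mx_coef hP.
have s1 : \sum_j V_mx k m.+1 g i j * (J%:R * (j.+1 == J :> nat)%:R) =
   J%:R * (V_col m.+1 g J.-1)`_i.
  case: (J : nat) Jm => [|J'] Jm'.
    by rewrite mul0r big1 // => j _; rewrite mul0r mulr0.
  under eq_bigr => j _ do rewrite mulrCA.
  by rewrite -mulr_sumr (sum_delta _ (j := Ordinal Jm')) ?V_mx_coef // => j.
have s0 : \sum_j V_mx k m.+1 g i j * ((m.+1 - J)%:R * (j == J :> nat)%:R) =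
   (m.+1 - J)%:R * (V_col m.+1 g J)`_i.
  under eq_bigr => j _ do rewrite mulrCA.
  rewrite -mulr_sumr; move: Jm; rewrite leq_eqVlt => /orP[/eqP->|Jm'].
    by rewrite subnn !mul0r.
  by rewrite (sum_delta _ (j := Ordinal Jm')) ?V_mx_coef // => j.
transitivity (V_mx k 2 g r 0 * ((m.+1 - J)%:R * (V_col m.+1 g J)`_i) +
              V_mx k 2 g r 1 * (J%:R * (V_col m.+1 g J.-1)`_i)).
  rewrite -s0 -s1 !mulr_sumr -big_split; apply: eq_bigr => j _ /=.
  by congr (_ + _); rewrite [RHS]mulrCA [RHS]mulrA.
have step1 := V_col_step1 g Jm; have step2 := V_col_step2 g Jm.
have drv := V_col_deriv g Jm.
have ord2 : r = 0 \/ r = 1.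
  by case: r {hP} => [[|[|//]] ?]; [left|right]; exact: val_inj.
case: ord2 => ->; rewrite ?e00 ?e01 ?e10 ?e11 /=.
  have -> : \sum_(i0 < m.+2) (m.+1 - i0)%:R * (i == i0 :> nat)%:R * (V_col m.+2 g J)`_i0 =
     (m.+1 - i)%:R * (V_col m.+2 g J)`_i.
    under eq_bigr => j _ do rewrite mulrAC.
    by rewrite (sum_delta _ (j := widen_ord (leqnSn _) i)) // => j; rewrite eq_sym.
  (* Coefficient of Y: Euler's formula at the i-th coefficient. *)
  have := congr1 (fun q => ('X * q)`_i) drv.
  have := congr1 (coefp (val i)) step1; have := congr1 (coefp (val i)) step2.
  rewrite /= !mulrDr !coefD -!scalerAr !coefZ.
  rewrite /imY /imX !mulrDl !coefD -!mulrA !coefCM.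
  have -> : ('X * (V_col m.+2 g J)^`())`_i = i%:R * (V_col m.+2 g J)`_i.
    rewrite coefXM coef_deriv; case: (val i) => [|i'] /=; first by rewrite mul0r.
    by rewrite mulr_natl.
  rewrite !natrB //; last by rewrite ltnW.
  move=> h1 h2 h3.
  rewrite [RHS]mulrBl h3.
  have -> : (m.+1)%:R * (V_col m.+2 g J)`_i = 
      J%:R * (V_col m.+2 g J)`_i + ((m.+1)%:R - J%:R) * (V_col m.+2 g J)`_i by ring.
  rewrite h1 h2; ring.
have -> : \sum_(i0 < m.+2) i0%:R * (i.+1 == i0 :> nat)%:R * (V_col m.+2 g J)`_i0 =
     (V_col m.+2 g J)^`()`_i.
  under eq_bigr => j _ do rewrite mulrAC.
  rewrite (sum_delta _ (j := lift ord0 i)) => [|j]; last by rewrite eq_sym.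
  by rewrite coef_deriv /bump /= mulr_natl.
rewrite drv coefD !coefZ; ring.
Qed.

(** X (x) Y - Y (x) X is invariant because the determinant of g is 1. *)
Lemma alternation_intertwines m P : @is_alternation m P ->
  @intertwines _ _ _ (tensor (V pk m.+1) (V pk 2)) (V pk m) P.
Proof.
move=> hP g Gg; change (tprod (V_mx k m.+1 g) (V_mx k 2 g) *m P = P *m V_mx k m g).
apply/matrixP => u J; have [i [r ->]] := pair_ordP u.
have [e00 e01 e10 e11] := V2_entries g; have dg := entry_det Gg.
rewrite [LHS]mxE [RHS]mxE sum_pair_ord.
under eq_bigr => j _ do rewrite big_ord_recl big_ord1 !tprodEij !hP /=.
have -> : lift ord0 ord0 = 1 :> 'I_2 by exact: val_inj.
under [RHS]eq_bigr => J' _ do rewrite V_mx_coef hP.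
transitivity (V_mx k 2 g r 0 * (V_col m.+1 g J.+1)`_i -
              V_mx k 2 g r 1 * (V_col m.+1 g J)`_i).
  have -> : (V_col m.+1 g J.+1)`_i = V_mx k m.+1 g i (lift ord0 J) by rewrite V_mx_coef.
  have -> : (V_col m.+1 g J)`_i = V_mx k m.+1 g i (widen_ord (leqnSn _) J).
    by rewrite V_mx_coef.
  rewrite -(sum_delta (V_mx k m.+1 g i) (b := fun j => j == J.+1 :> nat)) //.
  rewrite -(sum_delta (V_mx k m.+1 g i) (b := fun j => j == J :> nat)) //.
  rewrite !mulr_sumr -sumrB; apply: eq_bigr => j _ /=.
  by congr (_ + _); rewrite ?mulrN; [|congr (- _)]; rewrite [RHS]mulrCA [RHS]mulrA.
set q := V_col m g J.
have -> : V_col m.+1 g J = imY g * q.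
  rewrite /q /V_col /= mulrCA -exprS; congr (_ * _ ^+ _).
  by have := ltn_ord J; lia.
have -> : V_col m.+1 g J.+1 = imX g * q.
  rewrite /q /V_col /= mulrA -exprS; congr (_ * _ ^+ _).
  by have := ltn_ord J; lia.
rewrite /imY /imX !mulrDl !coefD -!mulrA !coefCM.
have ord2 : r = 0 \/ r = 1.
  by case: r {hP} => [[|[|//]] ?]; [left|right]; exact: val_inj.
have qm : q`_m = 0 by rewrite nth_default // size_V_col.
case: ord2 => ->; rewrite ?e00 ?e01 ?e10 ?e11 /=.
  transitivity (('X * q)`_i).
    by rewrite -[RHS]mul1r -dg; ring.
  rewrite coefXM; case: (unliftP ord0 i) => [i' ->|->].
    under eq_bigr => j _ do rewrite mulrC.
    rewrite (sum_delta _ (j := i')) ?lift0 // => j.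
    by rewrite eqSS eq_sym.
  by rewrite big1 // => j _; rewrite mul0r.
transitivity (- q`_i); first by rewrite -[q`_i in RHS]mul1r -dg; ring.
under eq_bigr => j _ do rewrite mulNr mulrC.
rewrite sumrN; congr (- _); case: (unliftP ord_max i) => [i' ->|->].
  by rewrite (sum_delta _ (j := i')) => [|j]; rewrite ?(eq_sym j) lift_max.
by rewrite sum_delta0 // => j; rewrite eq_sym ltn_eqF //=.
Qed.

(** A linear form v vanishing on the images of both maps satisfies, with Y = 1 in
    the first factor, v(X^(J+1) (x) Y) = v(X^J (x) X) and
    J v(X^(J-1) (x) X) + (m+1-J) v(X^J (x) Y) = 0; substituting the first in the
    second gives m + 1 times a coordinate, so all coordinates vanish and the two
    maps are jointly bijective. *)
Lemma V_tensor_V2 m : (m.+1)%:R != 0 :> k ->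
  mx_rsim (tensor (V pk m.+1) (V pk 2)) (dadd_grepr (V pk m) (V pk m.+2)).
Proof.
move=> m0.
have [P hP] : exists P, @is_polarization m P by exact: matrix_of_pairs.
have [A hA] : exists A, @is_alternation m A by exact: matrix_of_pairs.
exists (row_mx A P) => /=.
- by lia.
- apply: inj_row_free => v; rewrite mul_mx_row -[0]row_mx0 => /eq_row_mx[vA vP].
  have oneE : lift ord0 ord0 = 1 :> 'I_2 by exact: val_inj.
  have eA (J : 'I_m) : v 0 (pair_ord (lift ord0 J) 0) =
      v 0 (pair_ord (widen_ord (leqnSn _) J) 1).
    move/rowP/(_ J): vA; rewrite !mxE sum_pair_ord.
    under eq_bigr => j _ do rewrite big_ord_recl big_ord1 !hA /= oneE.
    rewrite big_split /= (sum_delta _ (j := lift ord0 J)) //.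
    under eq_bigr => j _ do rewrite mulrN.
    rewrite sumrN (sum_delta _ (j := widen_ord (leqnSn _) J)) //.
    by move/eqP; rewrite subr_eq0 => /eqP.
  have eP (J : 'I_m.+2) :
     (\sum_j v 0 (pair_ord j 0) * ((m.+1 - J)%:R * (j == J :> nat)%:R)) +
     \sum_(j < m.+1) v 0 (pair_ord j 1) * (J%:R * (j.+1 == J :> nat)%:R) = 0.
    move/rowP/(_ J): vP; rewrite !mxE sum_pair_ord => e; rewrite -[RHS]e.
    under [RHS]eq_bigr => j _ do rewrite big_ord_recl big_ord1 !hP /= oneE.
    by rewrite big_split.
  have v0 j : v 0 (pair_ord j 0) = 0.
    have := eP (widen_ord (leqnSn _) j); rewrite /=.
    under eq_bigr => i _ do rewrite mulrCA.
    rewrite -mulr_sumr (sum_delta _ (j := j)) //.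
    under eq_bigr => i _ do rewrite mulrCA.
    rewrite -mulr_sumr; case: (unliftP ord0 j) => [j' ->|->].
      rewrite (sum_delta _ (j := widen_ord (leqnSn _) j')) // -eA -mulrDl -natrD.
      rewrite subnK; last by rewrite ltnW.
      by move/eqP; rewrite mulf_eq0 (negbTE m0) => /eqP.
    rewrite mul0r addr0 subn0.
    by move/eqP; rewrite mulf_eq0 (negbTE m0) => /eqP.
  have v1 j : v 0 (pair_ord j 1) = 0.
    case: (unliftP ord_max j) => [j' ->|->].
      have -> : lift ord_max j' = widen_ord (leqnSn _) j'.
        by apply: val_inj; exact: lift_max.
      by rewrite -eA v0.
    have := eP ord_max; rewrite /= subnn big1 ?add0r => [|i _].
      2: by rewrite mul0r mulr0.
    under eq_bigr => i _ do rewrite mulrCA.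
    rewrite -mulr_sumr (sum_delta _ (j := ord_max)) //.
    by move/eqP; rewrite mulf_eq0 (negbTE m0) => /eqP.
  apply/rowP => u; have [j [s ->]] := pair_ordP u; rewrite mxE.
  have [->|->] : s = 0 \/ s = 1.
    by case: s => [[|[|//]] ?]; [left|right]; exact: val_inj.
  exact: v0.
  exact: v1.
- move=> g Gg; have hPg := polarization_intertwines hP Gg.
  have hAg := alternation_intertwines hA Gg.
  by rewrite mul_mx_row mul_row_block !mulmx0 addr0 add0r; congr row_mx.
Qed.

Lemma V1_trivial g : V_mx k 1 g = 1%:M.
Proof.
apply/matrixP => i j; rewrite !ord1 V_mx_coef /V_col !expr0 mulr1 coef1.
by rewrite mxE.
Qed.

Lemma V_tensor_V1 n : mx_rsim (tensor (V pk n) (V pk 1)) (V pk n).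
Proof.
have [B hB] := matrix_of_pairs (fun (i : 'I_n) (s : 'I_1) (j : 'I_n) => (i == j)%:R : k).
exists B => /=; first by rewrite muln1.
- apply: inj_row_free => v vB; apply/rowP => u; have [j [s ->]] := pair_ordP u.
  move/rowP/(_ j): vB; rewrite !mxE sum_pair_ord => e; rewrite -[RHS]e.
  under eq_bigr => i _ do rewrite big_ord1 hB.
  by rewrite (sum_delta _ (j := j)) // ord1.
move=> g Gg; change (tprod (V_mx k n g) (V_mx k 1 g) *m B = B *m V_mx k n g).
rewrite V1_trivial; apply/matrixP => u J.
have [i [r ->]] := pair_ordP u; rewrite [LHS]mxE [RHS]mxE sum_pair_ord.
have e1 : (1%:M : 'M[k]_1) r ord0 = 1 by rewrite mxE (ord1 r).
under eq_bigr => j _ do rewrite big_ord1 tprodEij hB e1 mulr1.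
rewrite (sum_delta _ (j := J)) //.
under eq_bigr => j _ do rewrite hB mulrC.
by rewrite (sum_delta _ (j := i)) // => j; rewrite eq_sym.
Qed.

End BinaryForms.

(** * The truncated Clebsch-Gordan rule *)

Section BrickIndecomposable.
Variables (F : fieldType) (gT : finGroupType) (G : {group gT}).
Local Notation rep := (representation F G).

Lemma mulmx1_neq0 m n (A : 'M[F]_(m, n)) B : (0 < m)%N -> A *m B = 1%:M -> A != 0.
Proof.
move=> m_gt0; apply: contra_eqN => /eqP->; rewrite mul0mx eq_sym.
apply/negP => /eqP/matrixP/(_ (Ordinal m_gt0) (Ordinal m_gt0)) /eqP.
by rewrite !mxE eqxx oner_eq0.
Qed.

(** In a sum of two nonzero modules, the projection onto one of them is an
    endomorphism which is neither zero nor injective. *)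
Lemma brick_indecomposable (N : rep) : brick N -> (0 < rdegree N)%N ->
  indecomposable N.
Proof.
move=> brN N_gt0; split=> // N1 N2 /rsim_dadd.
move=> [i1 [p1 [i2 [p2 [[hi1 hp1 hi2 hp2] [e1 e2 e12 e21] _]]]]].
have [c hc] := brN _ (intertwinesM hp1 hi1).
have [|N1_gt0] := posnP (rdegree N1); first by left.
have [|N2_gt0] := posnP (rdegree N2); first by right.
have := congr1 (mulmx i1) hc; rewrite mulmxA e1 mul1mx mul_mx_scalar => ei1.
have := congr1 (mulmx i2) hc; rewrite mulmxA e21 mul0mx mul_mx_scalar => /esym/eqP.
rewrite scaler_eq0 (negbTE (mulmx1_neq0 N2_gt0 e2)) orbF => /eqP c0.
by move: (mulmx1_neq0 N1_gt0 e1); rewrite ei1 c0 scale0r eqxx.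
Qed.

Lemma multiplicity_brick (N M : rep) : brick N -> brick M -> (0 < rdegree N)%N ->
  (0 < rdegree M)%N -> rdegree M != rdegree N -> multiplicity M N = 0%N.
Proof.
move=> brN brM N_gt0 M_gt0 nMN; apply/eqP; rewrite -leqn0 leqNgt; apply/negP.
move=> /(multiplicity_gt0 _ brN N_gt0).
move=> /(indecomposable_summand (brick_indecomposable brM M_gt0))/(_ N_gt0).
by move=> /mxrank_rsim /eqP; apply/negP.
Qed.

Lemma multiplicity_self (N : rep) : brick N -> (0 < rdegree N)%N ->
  multiplicity N N = 1%N.
Proof.
move=> brN N_gt0; apply/esym/multiplicity_unique => //.
exists 1%N, (fun => N); split=> [|_|]; last first.
- rewrite -[LHS](card_ord 1); apply: eq_card => i; rewrite !inE.
  exact/esym/asboolP/mx_rsim_refl.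
- exact: brick_indecomposable.
rewrite big_ord_recl big_ord0; apply/rsim_dadd.
exists 1%:M, 1%:M, 0, 0; rewrite !mulmx0 ?mulmx1 addr0; split=> //.
  by split=> //; try exact: intertwines1; exact: intertwines0.
by split=> //; rewrite ?mul0mx // [RHS]flatmx0.
Qed.

End BrickIndecomposable.

(** The condition |i - n| < j < min(i + n, 2p - i - n) with j of the parity of
    i + n - 1, in a form that shows its symmetry in i, j and n. *)
Definition fusion (p n i j : nat) : bool :=
  [&& odd (i + j + n), i < j + n, j < i + n, n < i + j & i + j + n < p.*2]%N.

(** Unless i + j + n is even, all terms vanish.  If it is, each term is a conjunction
    of the same four inequalities, each taken strictly or weakly.  For i, n and j
    between 0 and p no two of them are equalities at once, and where one is, the two
    sides lose one term each. *)
Lemma fusion_rec p n i j : (0 < i < p)%N -> (0 < n < p)%N -> (0 < j < p)%N ->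
  (fusion p n.-1 i j + fusion p n.+1 i j = fusion p n i j.-1 + fusion p n i j.+1)%N.
Proof.
case: n => [|n] //; case: j => [|j] //.
move=> /andP[i0 ip] /andP[_ np] /andP[_ jp]; rewrite /fusion /=.
have eqo : ((odd (i + j.+1 + n) = ~~ odd (i + j + n))
  * (odd (i + j.+1 + n.+2) = ~~ odd (i + j + n))
  * (odd (i + j + n.+1) = ~~ odd (i + j + n))
  * (odd (i + j.+2 + n.+1) = ~~ odd (i + j + n)))%type.
  by rewrite !(addnS, addSn) /= !negbK.
rewrite !eqo {eqo}; case: (boolP (odd _)) => //= od.
have -> : (i < j.+1 + n)%N = (i < j + n.+1)%N by rewrite addSnnS.
have -> : (i < j.+1 + n.+2)%N = (i <= j + n.+2)%N by apply/idP/idP; lia.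
have -> : (i < j.+2 + n.+1)%N = (i <= j + n.+2)%N by apply/idP/idP; lia.
have -> : (i < j + n.+1)%N = (i < j + n.+2)%N by apply/idP/idP; lia.
have -> : (j.+1 < i + n)%N = (j < i + n)%N by apply/idP/idP; lia.
have -> : (j.+1 < i + n.+2)%N = (j <= i + n)%N by apply/idP/idP; lia.
have -> : (j < i + n.+1)%N = (j <= i + n)%N by apply/idP/idP; lia.
have -> : (j.+2 < i + n.+1)%N = (j < i + n)%N by apply/idP/idP; lia.
have -> : (n < i + j.+1)%N = (n <= i + j)%N by apply/idP/idP; lia.
have -> : (n.+2 < i + j.+1)%N = (n < i + j)%N by apply/idP/idP; lia.
have -> : (n.+1 < i + j)%N = (n < i + j)%N by apply/idP/idP; lia.
have -> : (n.+1 < i + j.+2)%N = (n <= i + j)%N by apply/idP/idP; lia.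
have -> : (i + j.+1 + n < p.*2)%N = (i + j + n.+2 <= p.*2)%N by apply/idP/idP; lia.
have -> : (i + j + n.+1 < p.*2)%N = (i + j + n.+2 <= p.*2)%N by apply/idP/idP; lia.
have -> : (i + j.+1 + n.+2 < p.*2)%N = (i + j + n.+2 < p.*2)%N by apply/idP/idP; lia.
have -> : (i + j.+2 + n.+1 < p.*2)%N = (i + j + n.+2 < p.*2)%N by apply/idP/idP; lia.
case: (ltngtP i (j + n.+2)) => // a; case: (ltngtP j (i + n)) => // b;
case: (ltngtP n (i + j)) => // c; case: (ltngtP (i + j + n.+2) p.*2) => // d;
by exfalso; lia.
Qed.

Lemma fusion_p p n i : fusion p n i p = false.
Proof. by rewrite /fusion; lia. Qed.

Lemma fusion_0 p n i : fusion p n i 0 = false.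
Proof. by rewrite /fusion; lia. Qed.

Section FusionRule.

Variables (p : nat) (k : fieldType) (pk : p \in [pchar k]).
Let p_prime : prime p := pcharf_prime pk.

Lemma natk_neq0 j : (j <= p)%N -> (j%:R != 0 :> k) = (0 < j < p)%N.
Proof.
move=> jp; rewrite -(dvdn_pcharf pk); case: j jp => [|j] jp; first by rewrite dvdn0.
move: jp; rewrite leq_eqVlt => /orP[/eqP->|jp]; first by rewrite dvdnn ltnn andbF.
by rewrite gtnNdvd // jp.
Qed.

Lemma dadd_summand_r (F : fieldType) (gT : finGroupType) (G : {group gT})
  (M N P : representation F G) : mx_rsim M (dadd_grepr N P) -> direct_summand P M.
Proof.
move=> /rsim_dadd[i1 [p1 [i2 [p2 [[_ _ hi2 hp2] [_ e2 _ _] _]]]]].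
by apply/direct_summandP; exists i2, p2.
Qed.

(** Two-step induction on n.  The multiplicity of V_j in the triple tensor product
    of V_i, V_{n+1} and V_2 is computed by splitting off V_2 against V_{n+1}, and by
    adjunction against V_j. *)
Lemma walk_mult_fusion n i j : (n < p)%N -> (0 < i < p)%N -> (0 < j < p)%N ->
  walk_mult pk n i j = fusion p n i j.
Proof.
move=> np ip jp; move: np j jp.
suff H : forall j, (0 < j < p)%N ->
   ((n < p)%N -> walk_mult pk n i j = fusion p n i j) /\
   ((n.+1 < p)%N -> walk_mult pk n.+1 i j = fusion p n.+1 i j).
  by move=> np j /H[+ _]; apply.
have brj j : (0 < j < p)%N -> brick (V pk j) /\ (0 < rdegree (V pk j))%N.
  by move=> /andP[j0 jp]; split=> //; apply: brick_V; apply: ltnW.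
elim: n => [|n IH] j jp; have [bj j0] := brj j jp.
  split=> _.
    have -> : fusion p 0 i j = false by rewrite /fusion; lia.
    apply/eqP; rewrite -leqn0 leqNgt; apply/negP => /(multiplicity_gt0 _ bj j0).
    move=> [N /mxrank_rsim /= ]; lia.
  rewrite /walk_mult (multiplicity_rsim bj j0 (V_tensor_V1 pk i)).
  have [bi i0] := brj i ip.
  have [eij|nij] := eqVneq i j.
    by rewrite eij multiplicity_self //; rewrite /fusion; lia.
  by rewrite multiplicity_brick //; rewrite /fusion; lia.
split=> [|np]; first by case: (IH j jp).
have nk : (n.+1)%:R != 0 :> k by rewrite natk_neq0; lia.
(* The two bracketings of the triple product give the two sides of the
   recursion. *)
have := multiplicity_rsim bj j0 (tensorA_rsim (V pk i) (V pk n.+1) (V pk 2)).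
rewrite (multiplicity_dadd bj j0 (rsim_tensor_dadd (V pk i) (V_tensor_V2 pk nk))).
rewrite -/(walk_mult pk n i j) -/(walk_mult pk n.+2 i j).
case: j jp bj j0 => [|j] jp bj j0; first by [].
have jk : (j.+1)%:R != 0 :> k by rewrite natk_neq0; lia.
rewrite (@multiplicity_tensor _ _ _ (V pk j.+1) (tensor (V pk i) (V pk n.+1)) (V pk 2)
  (V pk j) (V pk j.+2) (symplectic k) (- symplectic k)) //; first last.
- by have := V_tensor_V2 pk jk.
- by move=> /= h; have := V_tensor_V2 pk h; exists (V pk j.+3).
- case: j jp bj j0 jk => [|j] jp bj j0 jk /= h; first by rewrite eqxx in h.
  by have := V_tensor_V2 pk h; apply: dadd_summand_r.
- by apply: brick_V; lia.
- by apply: brick_V; lia.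
- by move=> g Gg; apply: V2_symplectic.
- exact: symplecticV.
rewrite -!/(walk_mult pk n.+1 i _) /=.
have -> : walk_mult pk n i j.+1 = fusion p n i j.+1.
  by have [H _] := IH _ jp; apply: H; lia.
have -> : ((j%:R != 0 :> k)%R * walk_mult pk n.+1 i j = fusion p n.+1 i j)%N.
  rewrite natk_neq0; last by lia.
  case: (boolP (0 < j < p)%N) => [jp'|njp].
    2: by rewrite (_ : j = 0%N) ?fusion_0 //; lia.
  by rewrite mul1n; have [_ H] := IH _ jp'; rewrite H //; lia.
have -> : ((j.+2%:R != 0 :> k)%R * walk_mult pk n.+1 i j.+2 = fusion p n.+1 i j.+2)%N.
  rewrite natk_neq0; last by lia.
  case: (boolP (0 < j.+2 < p)%N) => [jp'|njp].
    by rewrite mul1n; have [_ H] := IH _ jp'; rewrite H //; lia.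
  by rewrite (_ : j.+2 = p) ?fusion_p //; lia.
have np' : (0 < n.+1 < p)%N by lia.
have := fusion_rec ip np' jp; rewrite /=; lia.
Qed.

End FusionRule.

(** * Symmetries of the walk *)

Lemma rev_state p (i : 'I_p.-1) : (rev_ord i).+1 = (p - i.+1)%N.
Proof. by rewrite /=; have := ltn_ord i; lia. Qed.

Lemma state_bounds p (i : 'I_p.-1) : (0 < i.+1 < p)%N.
Proof. by have := ltn_ord i; lia. Qed.

Section WalkSymmetry.

Variables (p : nat) (k : fieldType) (pk : p \in [pchar k]).
Variables (R : realType) (w : nat -> R).
Hypothesis p_gt2 : (2 < p)%N.
Hypothesis w_sym : forall i : nat, (1 <= i <= p - 1)%N -> w i = w (p - i)%N.
Let p_prime : prime p := pcharf_prime pk.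

Lemma odd_p : odd p.
Proof. by have /even_prime[p2|//] := p_prime; move: p_gt2; rewrite p2. Qed.

Definition edge_weight n i : R := \sum_(1 <= l < p) w l * (fusion p n i l)%:R.

Lemma walkE n i j : (n < p)%N -> (0 < i < p)%N -> (0 < j < p)%N ->
  walk pk w n i j = w j * (fusion p n i j)%:R / edge_weight n i.
Proof.
move=> np ip jp; rewrite /walk walk_mult_fusion //; congr (_ / _).
by apply: eq_big_nat => l lp; rewrite walk_mult_fusion.
Qed.

(** This and [fusion_flip_r] are the only facts about multiplicities behind the
    symmetries of the walk; the parity condition survives since p is odd. *)
Lemma fusion_flip_l n i j : (n < p)%N -> (0 < i < p)%N -> (0 < j < p)%N ->
  fusion p (p - n) (p - i) j = fusion p n i j.
Proof. have := odd_p; rewrite /fusion; lia. Qed.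

Lemma fusion_flip_r n i j : (n < p)%N -> (0 < i < p)%N -> (0 < j < p)%N ->
  fusion p (p - n) i (p - j) = fusion p n i j.
Proof. have := odd_p; rewrite /fusion; lia. Qed.

Lemma sum_flip (f : nat -> R) : \sum_(1 <= l < p) f (p - l)%N = \sum_(1 <= l < p) f l.
Proof.
rewrite [RHS]big_nat_rev; apply: eq_big_nat => l lp /=; congr (f _); lia.
Qed.

Lemma walk_flip_l n i j : (0 < n < p)%N -> (0 < i < p)%N -> (0 < j < p)%N ->
  walk pk w (p - n) (p - i) j = walk pk w n i j.
Proof.
move=> np ip jp; rewrite !walkE ?fusion_flip_l //; try lia.
congr (_ / _); apply: eq_big_nat => l lp; rewrite fusion_flip_l //; lia.
Qed.

Lemma walk_flip_r n i j : (0 < n < p)%N -> (0 < i < p)%N -> (0 < j < p)%N ->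
  walk pk w (p - n) i (p - j) = walk pk w n i j.
Proof.
move=> np ip jp; rewrite !walkE ?fusion_flip_r //; try lia.
rewrite -w_sym; last by lia.
congr (_ / _); rewrite /edge_weight -sum_flip; apply: eq_big_nat => l lp.
by rewrite fusion_flip_r -?(@w_sym l) //; lia.
Qed.

Lemma walk_flip n i j : (0 < n < p)%N -> (0 < i < p)%N -> (0 < j < p)%N ->
  walk pk w n (p - i) (p - j) = walk pk w n i j.
Proof.
move=> np ip jp; rewrite -[in LHS](subKn (_ : n <= p)%N); last by lia.
by rewrite walk_flip_l ?walk_flip_r //; lia.
Qed.

Lemma reflection_mull (A : 'M[R]_p.-1) :
  reflection_mx R p *m A = \matrix_(i, j) A (rev_ord i) j.
Proof.
apply/matrixP => i j; rewrite !mxE (bigD1 (rev_ord i)) //= big1 => [|l nl].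
  by rewrite addr0 mxE /= (_ : _ == _) ?mul1r //; have := ltn_ord i; lia.
rewrite mxE (_ : (_ == _) = false) ?mul0r //; apply: contraNF nl => /eqP e.
by apply/eqP/val_inj => /=; have := ltn_ord i; lia.
Qed.

Lemma reflection_mulr (A : 'M[R]_p.-1) :
  A *m reflection_mx R p = \matrix_(i, j) A i (rev_ord j).
Proof.
apply/matrixP => i j; rewrite !mxE (bigD1 (rev_ord j)) //= big1 => [|l nl].
  by rewrite addr0 mxE /= (_ : _ == _) ?mulr1 //; have := ltn_ord j; lia.
rewrite mxE (_ : (_ == _) = false) ?mulr0 //; apply: contraNF nl => /eqP e.
by apply/eqP/val_inj => /=; have := ltn_ord j; lia.
Qed.

Variables (n : nat) (n_bounds : (2 <= n <= p - 2)%N).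
Let n_range : (0 < n < p)%N. Proof. by lia. Qed.

Lemma walk_mx_reflect_l :
  walk_mx pk w n = reflection_mx R p *m walk_mx pk w (p - n).
Proof.
rewrite reflection_mull; apply/matrixP => i j; rewrite !mxE rev_state.
by rewrite walk_flip_l ?state_bounds.
Qed.

Lemma walk_mx_reflect_r :
  walk_mx pk w n = walk_mx pk w (p - n) *m reflection_mx R p.
Proof.
rewrite reflection_mulr; apply/matrixP => i j; rewrite !mxE rev_state.
by rewrite walk_flip_r ?state_bounds.
Qed.

Lemma walk_mx_reflect :
  reflection_mx R p *m walk_mx pk w n *m reflection_mx R p = walk_mx pk w n.
Proof.
rewrite reflection_mull reflection_mulr; apply/matrixP => i j; rewrite !mxE !rev_state.
by rewrite walk_flip ?state_bounds.
Qed.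

Local Notation h := p.-1./2.

Lemma even_walk_rev i j :
  even_walk_mx pk w n (rev_ord i) (rev_ord j) = odd_walk_mx pk w n i j.
Proof.
rewrite !mxE /=; have := (ltn_ord i, ltn_ord j, odd_p) => -[[ih jh] op].
have -> : (h - i.+1).*2.+2 = (p - i.*2.+1)%N by lia.
have -> : (h - j.+1).*2.+2 = (p - j.*2.+1)%N by lia.
by rewrite walk_flip //; lia.
Qed.

Lemma odd_even_isomorphic :
  chain_isomorphic (odd_walk_mx pk w n) (even_walk_mx pk w n).
Proof.
exists (@rev_ord _); last exact: even_walk_rev.
exact: (inv_bij (@rev_ordK _)).
Qed.

Lemma walk_bar_odd : odd n -> walk_bar pk w n = odd_walk_mx pk w n.
Proof. by move=> on; apply/matrixP => i j; rewrite !mxE on. Qed.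

Lemma walk_bar_sym : walk_bar pk w (p - n) = walk_bar pk w n.
Proof.
apply/matrixP => i j; rewrite !mxE.
have := (ltn_ord i, ltn_ord j, odd_p) => -[[ih jh] op].
have -> : (p + 1 - j.+1.*2)%N = (p - j.*2.+1)%N by lia.
have -> : odd (p - n) = ~~ odd n by lia.
case: (odd n) => /=; first by rewrite walk_flip_r //; lia.
rewrite -[in RHS](subKn (_ : n <= p)%N); last by lia.
by rewrite walk_flip_r //; lia.
Qed.

Lemma walk_parity i j : (0 < i < p)%N -> (0 < j < p)%N -> odd (i + j + n) = false ->
  walk pk w n i j = 0.
Proof.
move=> ip jp pij; rewrite walkE //; last by lia.
by rewrite /fusion pij mulr0 mul0r.
Qed.

Lemma swap_sqr : swap_mx R *m swap_mx R = 1%:M.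
Proof.
apply/matrixP => i j; rewrite !mxE big_ord_recl big_ord1 !mxE.
by case: i => [[|[|//]] ?]; case: j => [[|[|//]] ?] //=;
  rewrite !(mulr0, mul0r, mulr1, add0r, addr0).
Qed.

Lemma swap_exp : swap_mx R ^+ n.+1 = if odd n then 1 else swap_mx R.
Proof.
rewrite -[n.+1]odd_double_half exprD -muln2 mulnC exprM.
have -> : swap_mx R ^+ 2 = 1 by rewrite expr2; exact: swap_sqr.
by rewrite expr1n mulr1 /=; case: (odd n).
Qed.

Lemma folded_walk_kron :
  folded_walk_mx pk w n = kron2 (walk_bar pk w n) (swap_mx R ^+ n.+1).
Proof.
have op := odd_p.
have fl (a : 'I_h) : folded_state p (lshift h a) = a.*2.+1.
  by rewrite /folded_state /= ltn_ord.
have fr (a : 'I_h) : folded_state p (rshift h a) = (p - a.*2.+1)%N.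
  by rewrite /folded_state /= ltnNge leq_addr /=; lia.
apply/matrixP => a b; rewrite -[a]splitK -[b]splitK swap_exp /kron2.
case: (split a) (split b) => [a'|a'] [b'|b'] /=;
  rewrite mxE ?fl ?fr ?(block_mxEul, block_mxEur, block_mxEdl, block_mxEdr) !mxE;
  have := (ltn_ord a', ltn_ord b') => -[ah bh];
  have eb : (p + 1 - b'.+1.*2)%N = (p - b'.*2.+1)%N by lia.
- case: ifP => on; rewrite !mxE ?mul1r //= mul0r.
  by rewrite walk_parity //; lia.
- case: ifP => on; rewrite !mxE ?mul1r ?eb //= mul0r.
  by rewrite walk_parity //; lia.
- case: ifP => on; rewrite !mxE /= ?mul1r ?mul0r ?eb.
    by rewrite walk_parity //; lia.
  rewrite -[in LHS](subKn (_ : b'.*2.+1 <= p)%N); last by lia.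
  by rewrite walk_flip //; lia.
case: ifP => on; rewrite !mxE /= ?mul1r ?mul0r ?eb.
  by rewrite walk_flip //; lia.
by rewrite walk_parity //; lia.
Qed.

End WalkSymmetry.

(** * Characteristic polynomials *)

Lemma det_mxsub_bij (R : comNzRingType) m n (f : 'I_m -> 'I_n) (A : 'M[R]_n) :
  m = n -> injective f -> \det (mxsub f f A) = \det A.
Proof.
move=> e; case: n / e f A => f A f_inj; pose s := perm f_inj.
have -> : mxsub f f A = row_perm s (col_perm s A).
  by apply/matrixP => i j; rewrite !mxE !permE.
rewrite row_permE col_permE !det_mulmx !det_perm mulrCA -signr_addb.
by rewrite odd_permV addbb mulr1.
Qed.

Lemma char_poly_mxsub_bij (R : comNzRingType) m n (f : 'I_m -> 'I_n) (A : 'M[R]_n) :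
  m = n -> injective f -> char_poly (mxsub f f A) = char_poly A.
Proof.
move=> e f_inj; rewrite /char_poly -(det_mxsub_bij _ e f_inj); congr (\det _).
by apply/matrixP => i j; rewrite !mxE (inj_eq f_inj).
Qed.

Lemma char_poly_block_diag (R : comNzRingType) m n (A : 'M[R]_m) (B : 'M_n) :
  char_poly (block_mx A 0 0 B) = char_poly A * char_poly B.
Proof. by rewrite /char_poly char_block_diag_mx det_ublock. Qed.

Lemma char_poly_similar (F : fieldType) n (A B P : 'M[F]_n) :
  P \in unitmx -> P *m A = B *m P -> char_poly A = char_poly B.
Proof.
move=> uP PA; have := congr1 (map_mx (@polyC F)) PA; rewrite !map_mxM /= => PA'.
have e : map_mx (@polyC F) P *m char_poly_mx A = char_poly_mx B *m map_mx (@polyC F) P.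
  by rewrite /char_poly_mx mulmxBr mulmxBl PA' scalar_mxC.
have := congr1 determinant e; rewrite !det_mulmx mulrC => /mulIf; apply.
by rewrite det_map_mx polyC_eq0 -unitfE -unitmxE.
Qed.

(** The block matrix with rows (1, 1) and (1, -1) conjugates the antidiagonal block
    matrix into a diagonal one. *)
Lemma char_poly_block_antidiag (F : numFieldType) n (A : 'M[F]_n) :
  char_poly (block_mx 0 A A 0) = char_poly A * char_poly (- A).
Proof.
rewrite -char_poly_block_diag.
apply: (@char_poly_similar _ _ _ _ (block_mx 1%:M 1%:M 1%:M (- 1%:M))); last first.
  rewrite !mulmx_block !(mul0mx, mulmx0, mul1mx, mulmx1, mulNmx, mulmxN).
  by rewrite !(addr0, add0r) opprK.
set P := block_mx _ _ _ _.
have PP : P *m (2^-1 *: P) = 1%:M.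
  have two : 2^-1 *: (1%:M + 1%:M) = 1%:M :> 'M[F]_n.
    by rewrite -raddfD /= scale_scalar_mx mulVf // (pnatr_eq0 F 2).
  rewrite -scalemxAr mulmx_block !(mul1mx, mulmx1, mulNmx, mulmxN) opprK subrr.
  by rewrite scale_block_mx !scaler0 two -scalar_mx_block.
by case/mulmx1_unit: PP.
Qed.

Lemma char_polyN (C : comNzRingType) n (A : 'M[C]_n) :
  char_poly A \Po - 'X = (-1) ^+ n * char_poly (- A).
Proof.
rewrite /char_poly -detZ -det_map_mx; congr (\det _).
apply/matrixP => i j; rewrite !mxE /= comp_polyB comp_polyC.
rewrite raddfMn /= comp_polyX polyCN mulN1r opprD opprK; congr (_ - _).
by rewrite mulNrn.
Qed.

Lemma mup_opp (F : fieldType) (q : {poly F}) l : q != 0 ->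
  mup l (q \Po - 'X) = mup (- l) q.
Proof.
move=> q0; have compXX r : (r \Po - 'X) \Po - 'X = r :> {poly F}.
  by rewrite -comp_polyA rmorphN /= comp_polyX opprK comp_polyXr.
have q0' : q \Po - 'X != 0.
  by apply: contra_neq q0 => e; rewrite -[q]compXX e comp_poly0.
have le (r : {poly F}) a : r != 0 -> r \Po - 'X != 0 ->
    (mup (- a) r <= mup a (r \Po - 'X))%N.
  move=> r0 r0'; rewrite mup_geq //; have := leqnn (mup (- a) r).
  rewrite {1}mup_geq // => /(dvdp_comp_poly (- 'X)).
  rewrite rmorphXn /= comp_polyB comp_polyX comp_polyC polyCN opprK.
  have -> : - 'X + a%:P = -1 * ('X - a%:P) by rewrite mulN1r opprB addrC.
  rewrite exprMn.
  exact/dvdp_trans/dvdp_mulIr.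
apply/eqP; rewrite eqn_leq le // andbT.
by rewrite -{2}[q]compXX -{1}[l]opprK le // compXX.
Qed.

Lemma mup_char_polyN (C : fieldType) n (A : 'M[C]_n) l :
  mup l (char_poly (- A)) = mup (- l) (char_poly A).
Proof.
have c0 (B : 'M[C]_n) : char_poly B != 0 by rewrite monic_neq0 ?char_poly_monic.
rewrite -mup_opp // char_polyN -signr_odd; case: (odd n); rewrite ?expr0 ?mul1r //.
by rewrite expr1 mupMr // rootN root1.
Qed.


(** * Reversible chains *)

Section NormalPowers.

Local Open Scope sesquilinear_scope.

Variable C : numClosedFieldType.

Lemma normM_le_mean_sqr (a b : C) : `|a| * `|b| <= (`|a| ^+ 2 + `|b| ^+ 2) / 2.
Proof.
rewrite ler_pdivlMr ?ltr0n // -subr_ge0.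
have -> : `|a| ^+ 2 + `|b| ^+ 2 - `|a| * `|b| * 2 = (`|a| - `|b|) ^+ 2 by ring.
by rewrite real_exprn_even_ge0 ?rpredB ?normr_real.
Qed.

Lemma diag_mxX N (d : 'rV[C]_N) t :
  diag_mx d ^+ t = diag_mx (\row_l d 0 l ^+ t).
Proof.
elim: t => [|t IH].
  by rewrite expr0; apply/matrixP => i j; rewrite !mxE expr0.
rewrite exprS IH [LHS]mulmx_diag; apply/matrixP => i j; rewrite !mxE.
by case: eqP => [->|_]; rewrite ?mulr0n // exprS.
Qed.

(** In an orthonormal eigenbasis, an entry of the t-th power is a combination of
    the t-th powers of the eigenvalues whose coefficients have absolute sum at most
    1, since the columns of a unitary matrix are unit vectors. *)
Lemma normal_power_entry N (B : 'M[C]_N) (lam : C) :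
  B \is normalmx -> (forall a, eigenvalue B a -> `|a| <= lam) ->
  forall t x y, `|(B ^+ t) x y| <= lam ^+ t.
Proof.
move=> /orthomx_spectralP; set P := spectralmx B; set d := spectral_diag B => eB hB t x y.
have uP : P \is unitarymx by exact: spectral_unitarymx.
have PV : invmx P = P ^t* by exact: invmx_unitary.
have PP : P ^t* *m P = 1%:M by rewrite -PV mulVmx // unitarymx_unit.
have d_le l : `|d 0 l| <= lam.
  apply: hB; apply/eigenvalueP; exists (row l P).
    rewrite eB !mulmxA -row_mul mulmxV ?unitarymx_unit // row1 -rowE.
    by rewrite row_diag_mx -scalemxAl -rowE.
  apply/eqP => Pl; have := congr1 (row l) (mulmxV (unitarymx_unit uP)).
  rewrite row_mul Pl mul0mx row1 => /rowP/(_ l); rewrite !mxE !eqxx => /eqP.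
  by rewrite eq_sym oner_eq0.
have Bt : B ^+ t = P ^t* *m diag_mx (\row_l d 0 l ^+ t) *m P.
  rewrite -diag_mxX; elim: t => [|t IH]; first by rewrite !expr0 mulmx1 PP.
  rewrite !exprS -[B * _]/(B *m _) IH {1}eB PV -[diag_mx d * _]/(_ *m _).
  transitivity (P ^t* *m diag_mx d *m (P *m P ^t* ) *m diag_mx d ^+ t *m P).
    by rewrite !mulmxA.
  by rewrite -PV mulmxV ?unitarymx_unit // mulmx1 !mulmxA.
have col1 z : \sum_l `|P l z| ^+ 2 = 1.
  have /matrixP/(_ z z) := PP; rewrite !mxE eqxx => e; rewrite -[RHS]e.
  by apply: eq_bigr => l _; rewrite !mxE normCKC.
have lam_ge0 : 0 <= lam by apply: le_trans (d_le x).
rewrite Bt mxE; apply: le_trans (ler_norm_sum _ _ _) _.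
apply: (@le_trans _ _ (\sum_l lam ^+ t * ((`|P l x| ^+ 2 + `|P l y| ^+ 2) / 2))).
  apply: ler_sum => l _; rewrite mul_mx_diag !mxE !normrM norm_conjC normrX.
  rewrite mulrAC mulrC; apply: ler_pM; rewrite ?exprn_ge0 ?mulr_ge0 //.
    by rewrite lerXn2r ?nnegrE.
  exact: normM_le_mean_sqr.
rewrite -mulr_sumr -mulr_suml big_split /= !col1.
by rewrite (_ : (1 + 1) / 2 = 1) ?mulr1 //; field.
Qed.

End NormalPowers.

Section ReversibleChain.

Local Open Scope sesquilinear_scope.

Variables (R : realType) (N : nat) (S : 'M[R]_N) (m : 'I_N -> R).
Hypothesis m_gt0 : forall x, 0 < m x.
Hypothesis S_rev : forall x y, m x * S x y = m y * S y x.
Hypothesis S_sum1 : forall x, \sum_y S x y = 1.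

Local Notation C := R[i].
Local Notation toC := (real_complex R).
Local Notation SC := (map_mx toC S).

(** Eigenvectors are row vectors, whereas the energy argument below needs
    eigenfunctions; reversibility turns one into the other through division by m. *)
Lemma left_eigen_right (u : 'rV[C]_N) (l : C) : u *m SC = l *: u ->
  forall x, \sum_y toC (S x y) * (u 0 y / toC (m y)) = l * (u 0 x / toC (m x)).
Proof.
move=> hu x; have mx0 : toC (m x) != 0 by rewrite fmorph_eq0 gt_eqF.
have /rowP/(_ x) := hu; rewrite !mxE mulrA => <-.
apply: (mulfI mx0); rewrite [RHS]mulrC divfK // mulr_sumr.
apply: eq_bigr => y _; have my0 : toC (m y) != 0 by rewrite fmorph_eq0 gt_eqF.
rewrite [LHS]mulrA -(rmorphM (real_complex R)) S_rev rmorphM mxE /=.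
by field.
Qed.

Section Eigen.

Hypothesis S_ge0 : forall x y, 0 <= S x y.
Variables (r : 'I_N -> C) (l : C).
Hypothesis r_eigen : forall x, \sum_y toC (S x y) * r y = l * r x.
Hypothesis r_neq0 : exists x, r x != 0.

Let E := \sum_x toC (m x) * (r x * (r x)^*).

Let E_gt0 : 0 < E.
Proof.
have [x0 rx0] := r_neq0; rewrite /E (bigD1 x0) //= ltr_pwDl //.
  by rewrite mulr_gt0 ?ltcR // mul_conjC_gt0.
by apply: sumr_ge0 => x _; rewrite mulr_ge0 ?mul_conjC_ge0 // lecR ltW.
Qed.

Let toC_conj (a : R) : (toC a)^* = toC a. Proof. exact: conjc_real. Qed.

Let lE : l * E = \sum_x \sum_y toC (m x * S x y) * (r y * (r x)^* ).
Proof.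
rewrite /E mulr_sumr; apply: eq_bigr => x _.
transitivity (toC (m x) * (r x)^* * (l * r x)); first by ring.
rewrite -r_eigen mulr_sumr; apply: eq_bigr => y _.
by rewrite rmorphM; ring.
Qed.

Let l_real : l^* = l.
Proof.
have E_real : E^* = E by apply: geC0_conj; rewrite ltW.
apply: (mulIf (lt0r_neq0 E_gt0)).
rewrite -{1}E_real -rmorphM lE rmorph_sum /= exchange_big /=; apply: eq_bigr => x _.
rewrite rmorph_sum /=; apply: eq_bigr => y _.
rewrite rmorphM /= toC_conj S_rev; congr (_ * _).
by rewrite rmorphM /= conjCK mulrC.
Qed.

(** Dirichlet form of the chain, with the sign s = 1 or s = -1 on the edges. *)
Let energy (s : C) : s^* = s -> s * s = 1 ->
  \sum_x \sum_y toC (m x * S x y) * ((r x - s * r y) * (r x - s * r y)^* ) =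
  2 * (1 - s * l) * E.
Proof.
move=> s_real ss.
have e1 : \sum_x \sum_y toC (m x * S x y) * (r x * (r x)^* ) = E.
  apply: eq_bigr => x _; rewrite -mulr_suml -rmorph_sum -mulr_sumr S_sum1 mulr1.
  by [].
have e2 : \sum_x \sum_y toC (m x * S x y) * (r y * (r y)^* ) = E.
  rewrite exchange_big -[RHS]e1; apply: eq_bigr => x _; apply: eq_bigr => y _ /=.
  by rewrite S_rev.
have e3 : \sum_x \sum_y toC (m x * S x y) * (r x * (r y)^* ) = l * E.
  rewrite lE exchange_big; apply: eq_bigr => x _; apply: eq_bigr => y _ /=.
  by rewrite S_rev.
transitivity (E + E - s * (l * E) - s * (l * E)); last by ring.
rewrite -{1}e1 -{1}e2 -{1}e3 lE !mulr_sumr -big_split -!sumrB.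
apply: eq_bigr => x _ /=; rewrite !mulr_sumr -big_split -!sumrB.
apply: eq_bigr => y _ /=; rewrite rmorphB /= [(s * r y)^* ]rmorphM /= s_real.
rewrite -[r y * (r y)^* in RHS]mul1r -ss; ring.
Qed.

Let term_ge0 (s : C) x y :
  0 <= toC (m x * S x y) * ((r x - s * r y) * (r x - s * r y)^* ).
Proof.
by rewrite mulr_ge0 ?mul_conjC_ge0 // lecR mulr_ge0 // ltW.
Qed.

Let energy_ge0 (s : C) : s^* = s -> s * s = 1 -> 0 <= 1 - s * l.
Proof.
move=> s_real ss; rewrite -(pmulr_lge0 _ E_gt0) -(pmulr_rge0 _ (ltr0n _ 2)) mulrA.
by rewrite -energy //; apply: sumr_ge0 => x _; apply: sumr_ge0 => y _.
Qed.

Let l_Creal : l \is Num.real. Proof. by apply/CrealP. Qed.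

Lemma reversible_eigen_norm : `|l| <= 1.
Proof.
have h1 := @energy_ge0 1 (rmorph1 _) (mul1r _).
have h2 : 0 <= 1 - -1 * l by apply: energy_ge0; [exact: rmorphN1 | ring].
have l_le1 : l <= 1 by rewrite -subr_ge0 -[l]mul1r.
have l_geN1 : -1 <= l by rewrite -subr_ge0 opprK addrC; rewrite mulN1r opprK in h2.
by rewrite real_ler_norml // l_le1 l_geN1.
Qed.

Lemma reversible_eigen_sqr : `|l| = 1 -> l * l = 1.
Proof. by move=> l1; rewrite -expr2 -(real_normK l_Creal) l1 expr1n. Qed.

(** At l = 1 or l = -1 the energy vanishes, and so does each of its terms. *)
Lemma reversible_eigen_edge x y : `|l| = 1 -> S x y != 0 -> r x = l * r y.
Proof.
move=> /reversible_eigen_sqr ll Sxy.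
have := energy l_real ll; rewrite ll subrr mulr0 mul0r.
have ge0 z : 0 <= \sum_y0 toC (m z * S z y0) * ((r z - l * r y0) * (r z - l * r y0)^* ).
  by apply: sumr_ge0 => y0 _.
move=> /(psumr_eq0P (fun z _ => ge0 z))/(_ x isT).
move=> /(psumr_eq0P (fun z _ => term_ge0 l x z))/(_ y isT)/eqP.
rewrite mulf_eq0 mul_conjC_eq0 fmorph_eq0 mulf_eq0 (negbTE Sxy) orbF gt_eqF //=.
by rewrite subr_eq0 => /eqP.
Qed.

End Eigen.

(** A is the symmetrization of S and E its projection onto the stationary
    direction.  As A E = E A = E, the powers of A - E are the A^t - E, and an
    eigenvector of A - E for a nonzero eigenvalue is orthogonal to that direction,
    so it is an eigenvector of A for an eigenvalue of S other than 1. *)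
Lemma reversible_mixing (mu lam : R) :
  \sum_x m x = 1 -> (forall x, mu <= m x) -> 0 < mu ->  0 <= lam ->
  (forall l : C, complex_eigenvalue S l -> l = 1 \/ ComplexField.Normc.normc l <= lam) ->
  (forall u : 'rV[C]_N, u *m SC = u -> exists c, forall x, u 0 x = c * toC (m x)) ->
  forall t x, tv_dist (row x (S ^+ t)) (\row_y m y) <= lam ^+ t / (2 * mu).
Proof.
move=> m_sum1 mu_le mu_gt0 lam_ge0 hl hfix t x.
pose s y := Num.sqrt (m y).
have s_gt0 y : 0 < s y by rewrite sqrtr_gt0.
have s_neq0 y : s y != 0 by rewrite gt_eqF.
have ss y : s y * s y = m y by rewrite -expr2 sqr_sqrtr // ltW.
pose A : 'M[R]_N := \matrix_(x, y) (s x * S x y / s y).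
pose E : 'M[R]_N := \matrix_(x, y) (s x * s y).
have A_sym a b : A a b = A b a.
  rewrite !mxE; apply: (mulfI (mulf_neq0 (s_neq0 a) (s_neq0 b))).
  transitivity (m a * S a b); last rewrite S_rev; rewrite -ss; by field.
have EE : E *m E = E.
  apply/matrixP => a b; rewrite !mxE -[RHS]mulr1 -m_sum1 mulr_sumr.
  by apply: eq_bigr => z _; rewrite !mxE -ss; ring.
have AE : A *m E = E.
  apply/matrixP => a b; rewrite !mxE -[RHS]mulr1 -(S_sum1 a) mulr_sumr.
  by apply: eq_bigr => z _; rewrite !mxE; field.
have EA : E *m A = E.
  apply: trmx_inj; rewrite trmx_mul.
  have -> : E^T = E by apply/matrixP => a b; rewrite !mxE mulrC.
  by have -> : A^T = A by apply/matrixP => a b; rewrite mxE A_sym.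
pose B := A - E.
have BC : map_mx toC B \is normalmx.
  apply/normalmxP; suff -> : (map_mx toC B) ^t* = map_mx toC B by [].
  apply/matrixP => a b; transitivity ((toC (B b a))^*); first by rewrite !mxE.
  rewrite [RHS]mxE; transitivity (toC (B b a)); first exact: conjc_real.
  by congr (toC _); rewrite mxE [RHS]mxE A_sym; congr (_ + _); rewrite !mxE mulrC.
have At j a b : (S ^+ j) a b = (A ^+ j) a b * s b / s a.
  elim: j a b => [|j IH] a b.
    by rewrite !expr0 !mxE; case: eqP => [->|_]; rewrite ?mul0r // mul1r divff.
  have expS (M : 'M[R]_N) : M ^+ j.+1 = M *m M ^+ j := exprS M j.
  rewrite !expS [LHS]mxE [(_ *m _) a b]mxE !mulr_suml; apply: eq_bigr => z _.
  by rewrite IH [A a z]mxE; field; rewrite !s_neq0.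
have Bt j a b : `|(A ^+ j.+1) a b - E a b| <= lam ^+ j.+1.
  have <- : (B ^+ j.+1) a b = (A ^+ j.+1) a b - E a b.
    have -> : B ^+ j.+1 = A ^+ j.+1 - E; last by rewrite !mxE.
    elim: j => [|j IH]; first by [].
    have EAj i : E * A ^+ i = E.
      by elim: i => [|i IHi]; rewrite ?expr0 ?mulr1 // exprS mulrA [E * A]EA.
    rewrite exprS IH mulrBl !mulrBr EAj [A * E]AE [E * E]EE -exprS.
    by rewrite subrr subr0.
  have norm_toC (z : R) : `|toC z| = toC `|z|.
    by rewrite normc_def /= expr0n addr0 sqrtr_sqr.
  rewrite -lecR -norm_toC rmorphXn /=.
  have -> : toC ((B ^+ j.+1) a b) = (map_mx toC B ^+ j.+1) a b.
    have -> : map_mx toC B ^+ j.+1 = map_mx toC (B ^+ j.+1); last by rewrite mxE.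
    elim: j => [|j IH]; first by [].
    by rewrite exprS IH [RHS]map_mxM.
  apply: normal_power_entry BC _ _ _ _ => d /eigenvalueP[v hv v0].
  (* The eigenvalue 0 of A - E on the stationary direction is harmless. *)
  have [->|d0] := eqVneq d 0; first by rewrite normr0 lecR.
  have vE : v *m map_mx toC E = 0.
    apply/eqP; rewrite -(inj_eq (scalerI d0)) scaler0 scalemxAl -hv -mulmxA -map_mxM.
    by rewrite mulmxBl AE EE subrr map_mx0 mulmx0.
  have vA : v *m map_mx toC A = d *: v.
    by rewrite -hv /B map_mxB mulmxBr vE subr0.
  pose u := \row_x (v 0 x * toC (s x)).
  have hu : u *m SC = d *: u.
    apply/rowP => y; rewrite !mxE; have /rowP/(_ y) := vA; rewrite !mxE mulrA => <-.
    rewrite mulr_suml; apply: eq_bigr => z _; rewrite !mxE.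
    have sy : toC (s y) != 0 by rewrite fmorph_eq0.
    by rewrite !rmorphM /= fmorphV; field.
  have u0 : u != 0.
    apply: contraNneq v0 => e; apply/eqP/rowP => y; move/rowP/(_ y): e; rewrite !mxE.
    by move/eqP; rewrite mulf_eq0 fmorph_eq0 (negbTE (s_neq0 y)) orbF => /eqP.
  have [|d1|dlam] := hl d; first by apply/eigenvalueP; exists u.
    have [|c hc] := hfix u; first by rewrite hu d1 scale1r.
    have hv' y : v 0 y = c * toC (s y).
      have sy : toC (s y) != 0 by rewrite fmorph_eq0.
      by apply: (mulIf sy); have := hc y; rewrite mxE => ->; rewrite -mulrA -rmorphM ss.
    have c0 : c = 0.
      have /rowP/(_ a) := vE; rewrite !mxE.
      under eq_bigr => z _ do
        rewrite !mxE hv' rmorphM /= mulrA -[c * _ * _]mulrA -rmorphM ss.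
      rewrite -mulr_suml -mulr_sumr -rmorph_sum m_sum1 rmorph1 mulr1.
      by move/eqP; rewrite mulf_eq0 fmorph_eq0 (negbTE (s_neq0 a)) orbF => /eqP.
    by case/eqP: v0; apply/rowP => y; rewrite hv' c0 mul0r mxE.
  by rewrite -[X in X <= _]/(toC (ComplexField.Normc.normc d)) lecR.
have m_le1 y : m y <= 1.
  by rewrite -m_sum1 (bigD1 y) //= lerDl sumr_ge0 // => z _; rewrite ltW.
have s_le1 y : s y <= 1 by rewrite -sqrtr1 ler_wsqrtr.
have smu a b : mu <= s a * s b.
  have smu1 y : Num.sqrt mu <= s y by rewrite ler_wsqrtr.
  rewrite -[mu]sqr_sqrtr ?(ltW mu_gt0) // expr2.
  by apply: ler_pM; rewrite ?sqrtr_ge0.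
have At' a b : `|(A ^+ t) a b - E a b| <= lam ^+ t.
  case: t => [|j]; last exact: Bt.
  rewrite !expr0 !mxE; case: eqP => [->|_] /=.
    by rewrite ss ger0_norm ?subr_ge0 // lerBlDr lerDl ltW.
  rewrite sub0r normrN ger0_norm ?mulr_ge0 ?(ltW (s_gt0 _)) //.
  by rewrite mulr_ile1 ?(ltW (s_gt0 _)).
have -> : lam ^+ t / (2 * mu) = 2^-1 * (lam ^+ t / mu) by rewrite invfM mulrCA mulrA.
rewrite /tv_dist; apply: ler_wpM2l; first by rewrite invr_ge0.
apply: (@le_trans _ _ (\sum_y lam ^+ t / mu * m y)); last first.
  by rewrite -mulr_sumr m_sum1 mulr1.
apply: ler_sum => y _; rewrite !mxE At.
have -> : (A ^+ t) x y * s y / s x - m y = ((A ^+ t) x y - E x y) * (m y / (s x * s y)).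
  rewrite [E x y]mxE -[m y]ss; field; by rewrite !s_neq0.
rewrite normrM [X in _ * X]ger0_norm; last by rewrite divr_ge0 ?mulr_ge0 // ltW.
rewrite -mulrA; apply: ler_pM => //.
  by rewrite divr_ge0 ?mulr_ge0 ?(ltW (s_gt0 _)) ?(ltW (m_gt0 _)).
by rewrite mulrC ler_wpM2r ?(ltW (m_gt0 _)) // lef_pV2 ?posrE ?mulr_gt0.
Qed.


End ReversibleChain.

(** * Spectral gap and mixing time *)

Section SpectralGap.

Variables (R : realType) (N : nat) (S : 'M[R]_N) (m : 'I_N -> R).
Hypothesis m_gt0 : forall x, 0 < m x.
Hypothesis S_rev : forall x y, m x * S x y = m y * S y x.
Hypothesis S_sum1 : forall x, \sum_y S x y = 1.
Hypothesis S_ge0 : forall x y, 0 <= S x y.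

Local Notation C := R[i].
Local Notation toC := (real_complex R).
Local Notation SC := (map_mx toC S).
Local Notation normc := ComplexField.Normc.normc.

Lemma toC_neq0 x : toC (m x) != 0.
Proof. by rewrite fmorph_eq0 gt_eqF. Qed.

(** Connectivity is stated as a property of functions constant along edges, which
    is the form in which it is both proved and used. *)
Lemma fixed_vector_unique :
  (forall r : 'I_N -> C, (forall x y, S x y != 0 -> r x = r y) ->
     forall x y, r x = r y) ->
  forall u : 'rV[C]_N, u *m SC = u -> exists c, forall x, u 0 x = c * toC (m x).
Proof.
move=> conn u hu; have [->|u0] := eqVneq u 0.
  by exists 0 => x; rewrite mxE mul0r.
have hu1 : u *m SC = 1 *: u by rewrite scale1r.
have [x0 ux0] : exists x, u 0 x != 0 by apply/rV0Pn.
pose r x := u 0 x / toC (m x).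
have rx0 : exists x, r x != 0.
  by exists x0; rewrite mulf_neq0 // invr_neq0 ?toC_neq0.
exists (r x0) => x; rewrite (conn r _ x0 x) ?divfK ?toC_neq0 // => a b Sab.
have := reversible_eigen_edge m_gt0 S_rev S_sum1 S_ge0
  (left_eigen_right m_gt0 S_rev hu1) rx0 (normr1 _) Sab.
by rewrite mul1r.
Qed.

(** If |l| = 1, two neighbours of the same state carry the same value of the
    eigenfunction, whichever sign l is; so it is constant, and l = 1. *)
Lemma reversible_gap :
  (forall r : 'I_N -> C, (forall x x' y, S x y != 0 -> S x' y != 0 -> r x = r x') ->
     forall x y, r x = r y) ->
  forall l : C, complex_eigenvalue S l -> l = 1 \/ normc l < 1.
Proof.
move=> conn l /eigenvalueP[u hu u0].
have [x0 ux0] : exists x, u 0 x != 0 by apply/rV0Pn.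
pose r x := u 0 x / toC (m x).
have rx0 : r x0 != 0 by rewrite mulf_neq0 // invr_neq0 ?toC_neq0.
have hr := left_eigen_right m_gt0 S_rev hu.
have exr : exists x, r x != 0 by exists x0.
have := reversible_eigen_norm m_gt0 S_rev S_sum1 S_ge0 hr exr.
rewrite -[`|l|]/(toC (normc l)) -(rmorph1 toC) lecR le_eqVlt => /orP[/eqP l1|].
  2: by right.
left; have normr_l : `|l| = 1 by rewrite -[`|l|]/(toC (normc l)) l1 rmorph1.
have edge x y :=
  reversible_eigen_edge m_gt0 S_rev S_sum1 S_ge0 hr exr normr_l (x := x) (y := y).
have cst : forall x y, r x = r y.
  by apply: conn => x x' y Sx Sx'; rewrite /r (edge x y Sx) (edge x' y Sx').
apply: (mulIf rx0); rewrite -hr mul1r.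
under eq_bigr => y _ do rewrite -[_ / _]/(r y) (cst y x0).
by rewrite -mulr_suml -rmorph_sum S_sum1 rmorph1 mul1r.
Qed.

Lemma stationary_unique : \sum_x m x = 1 ->
  (forall u : 'rV[C]_N, u *m SC = u -> exists c, forall x, u 0 x = c * toC (m x)) ->
  forall sigma, stationary S sigma -> sigma = \row_x m x.
Proof.
move=> m1 hfix sigma [_ s1 sS].
have [|c hc] := hfix (map_mx toC sigma); first by rewrite -map_mxM sS.
have c1 : c = 1.
  transitivity (\sum_x c * toC (m x)).
    by rewrite -mulr_sumr -rmorph_sum m1 rmorph1 mulr1.
  under eq_bigr => x _ do rewrite -hc mxE.
  by rewrite -rmorph_sum s1 rmorph1.
apply/rowP => x; rewrite mxE; apply: complexI.
by have := hc x; rewrite c1 mul1r mxE.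
Qed.

End SpectralGap.

Section LambdaStar.

Variables (R : realType) (N : nat) (S : 'M[R]_N).
Local Notation C := R[i].
Local Notation normc := ComplexField.Normc.normc.
Hypothesis gap : forall l : C, complex_eigenvalue S l -> l = 1 \/ normc l < 1.

Lemma normc_ge0 (l : C) : 0 <= normc l.
Proof. by rewrite -lecR -[(normc l)%:C%C]/(`|l|) normr_ge0. Qed.

(** The eigenvalues are finitely many, so that their supremum inherits the strict
    inequality. *)
Lemma second_eigenvalue_bound : exists2 b : R, b < 1 &
  forall l : C, complex_eigenvalue S l -> l != 1 -> normc l <= b.
Proof.
have [s hs] := closed_field_poly_normal (char_poly (map_mx (real_complex R) S)).
have mem_s l : complex_eigenvalue S l -> l \in s.
  rewrite /complex_eigenvalue eigenvalue_root_char hs (monicP (char_poly_monic _)).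
  by rewrite scale1r root_prod_XsubC.
have [b b1 hb] : exists2 b : R, b < 1 & forall l, l \in s -> normc l < 1 -> normc l <= b.
  elim: (s) => [|a s' [b b1 hb]]; first by exists 0.
  have [a1|a1] := ltP (normc a) 1; last first.
    exists b => // l; rewrite inE => /orP[/eqP->|]; last exact: hb.
    by rewrite ltNge a1.
  exists (Num.max b (normc a)); first by rewrite gt_max b1 a1.
  move=> l; rewrite inE => /orP[/eqP-> _|/hb h /h h']; first by rewrite le_max lexx orbT.
  by rewrite le_max h'.
exists b => // l hl l1; apply: hb; first exact: mem_s.
by have [e|//] := gap hl; rewrite e eqxx in l1.
Qed.

Local Notation moduli :=
  [set normc l | l in [set l | complex_eigenvalue S l /\ l != 1]]%classic.

Lemma lambda_star_ge l : complex_eigenvalue S l -> l = 1 \/ normc l <= lambda_star S.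
Proof.
move=> hl; have [->|l1] := eqVneq l 1; [by left | right].
have [b _ hb] := second_eigenvalue_bound.
apply: ub_le_sup; last by exists l.
by exists b => _ [l' [hl' l'1] <-]; apply: hb.
Qed.

Lemma lambda_star_bounds : 0 <= lambda_star S < 1.
Proof.
have [b b1 hb] := second_eigenvalue_bound.
have [[y0 my0]|E0] := pselect (moduli !=set0)%classic; last first.
  have -> : lambda_star S = 0.
    rewrite /lambda_star (_ : moduli = set0) ?sup0 //.
    by apply/eqP/negPn/negP => /set0P.
  by rewrite lexx ltr01.
apply/andP; split.
  case: my0 => l [hl l1] _; have [e|h] := lambda_star_ge hl.
    by rewrite e eqxx in l1.
  exact: le_trans (normc_ge0 l) h.
apply: le_lt_trans b1; apply: ge_sup; first by exists y0.
by move=> _ [l [hl l1] <-]; apply: hb.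
Qed.

End LambdaStar.

Section Mixing.

Variables (R : realType).

Lemma expR_half_le2 : expR (2^-1 : R) <= 2.
Proof.
have h := expR_ge1Dx (- 2^-1 : R).
rewrite -[X in X <= _]invrK -expRN -[X in _ <= X]invrK.
rewrite lef_pV2 ?posrE ?expR_gt0 ?invr_gt0 //.
by apply: le_trans h; lra.
Qed.

Lemma expR1_le4 : expR (1 : R) <= 4.
Proof.
have -> : expR (1 : R) = expR 2^-1 * expR 2^-1 by rewrite -expRD; congr expR; lra.
rewrite (_ : 4 = 2 * 2 :> R); last by lra.
by apply: ler_pM; rewrite ?expR_ge0 ?expR_half_le2.
Qed.

(** Rounding the time down to an integer costs a factor expR g at most. *)
Lemma truncated_decay (g a : R) : 0 < g <= 1 -> 0 < a <= 1 ->
  let t := Num.truncn (g^-1 * ln a^-1) in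
  t%:R <= g^-1 * ln a^-1 /\ (1 - g) ^+ t <= expR g * a.
Proof.
move=> /andP[g0 g1] /andP[a0 a1] t.
have b0 : 0 <= g^-1 * ln a^-1.
  by rewrite mulr_ge0 ?invr_ge0 ?(ltW g0) // ln_ge0 // invf_ge1.
have /andP[] := truncn_itv b0; rewrite -/t; clearbody t => t1 t2.
split=> //.
apply: (@le_trans _ _ (expR (- g) ^+ t)).
  rewrite lerXn2r ?nnegrE ?expR_ge0 ?subr_ge0 //.
  by have := expR_ge1Dx (- g).
rewrite -expRM_natl -[X in _ <= _ * X]lnK ?posrE // -expRD ler_expR.
move: t2; rewrite ltr_pdivrMl // lnV ?posrE // -natr1 => t2.
by have := ltW t2; rewrite mulrDr mulr1 mulrN (mulrC g); lra.
Qed.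

Lemma mixing_time_exists N (S : 'M[R]_N) sigma eps t0 (b : R) :
  mixed S sigma eps t0 -> t0%:R <= b ->
  exists2 t, is_mixing_time S sigma eps t & t%:R <= b.
Proof.
move=> ht0 t0b; have ex : exists t, `[< mixed S sigma eps t >].
  by exists t0; apply/asboolP.
have [t /asboolP ht tmin] := find_ex_minn ex.
exists t; first by split=> // s hs; apply: tmin; apply/asboolP.
by apply: le_trans t0b; rewrite ler_nat; apply: tmin; apply/asboolP.
Qed.

Lemma expmx_reindex N (f : 'I_N -> 'I_N) (S S' : 'M[R]_N) :
  injective f -> (forall x y, S' (f x) (f y) = S x y) ->
  forall t x y, (S' ^+ t) (f x) (f y) = (S ^+ t) x y.
Proof.
move=> fI h; elim=> [|t IH] x y; first by rewrite !expr0 !mxE (inj_eq fI).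
have expS (M : 'M[R]_N) : M ^+ t.+1 = M *m M ^+ t := exprS M t.
rewrite !expS !mxE (reindex_inj fI); apply: eq_bigr => z _.
by rewrite h IH.
Qed.

Lemma mixing_time_reindex N (f : 'I_N -> 'I_N) (S S' : 'M[R]_N) sigma eps (b : R) :
  injective f -> (forall x y, S' (f x) (f y) = S x y) ->
  (forall sigma, stationary S sigma ->
     exists2 t, is_mixing_time S sigma eps t & t%:R <= b) ->
  stationary S' sigma ->
  exists2 t, is_mixing_time S' sigma eps t & t%:R <= b.
Proof.
move=> fI h hS [sig0 sig1 sigS]; pose tau := \row_x sigma 0 (f x).
have tauS : stationary S tau.
  split=> [x||]; first by rewrite mxE.
    by rewrite -[RHS]sig1 [RHS](reindex_inj fI); apply: eq_bigr => x _; rewrite mxE.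
  apply/rowP => y; rewrite !mxE -[in RHS]sigS mxE [RHS](reindex_inj fI).
  by apply: eq_bigr => x _; rewrite mxE h.
have mx t : mixed S tau eps t <-> mixed S' sigma eps t.
  have [g fK gK] := injF_bij fI.
  have e x : tv_dist (row x (S ^+ t)) tau = tv_dist (row (f x) (S' ^+ t)) sigma.
    rewrite /tv_dist; congr (_ * _); rewrite [RHS](reindex_inj fI).
    by apply: eq_bigr => y _; rewrite !mxE (expmx_reindex fI h).
  split=> H x; last by rewrite e.
  by rewrite -[x]gK -e.
have [t [ht tmin] tb] := hS _ tauS.
exists t; last exact: tb.
split; first exact: (mx t).1 ht.
by move=> s hs; exact: tmin s ((mx s).2 hs).
Qed.

End Mixing.

(** * Stationary weights and connectivity of the walk *)

Lemma sum_states_split (V : nmodType) h (f : nat -> V) :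
  \sum_(1 <= l < h.*2.+1) f l = \sum_(x < h) f x.*2.+1 + \sum_(x < h) f x.*2.+2.
Proof.
elim: h => [|h IH]; first by rewrite big_geq // !big_ord0 addr0.
rewrite doubleS big_nat_recr //= big_nat_recr //= IH !big_ord_recr /=.
by rewrite -!addrA; congr (_ + _); rewrite addrCA.
Qed.

Lemma bigmin_le_nth (R : realDomainType) (s : seq nat) (f : nat -> R) x i :
  i \in s -> \big[Order.min/x]_(j <- s) f j <= f i.
Proof.
elim: s => // a s IH; rewrite inE big_cons => /orP[/eqP->|/IH h].
  by rewrite ge_min lexx.
by rewrite ge_min h orbT.
Qed.

(** The witness is the smallest j satisfying the triangle inequalities with both
    states; the bounds 2 <= n <= p - 2 are what keeps it in range. *)
Lemma fusion_common_neighbour p n i : (2 <= n <= p - 2)%N -> (0 < i)%N -> (i.+2 < p)%N ->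
  exists2 j, (0 < j < p)%N & fusion p n i j && fusion p n i.+2 j.
Proof.
move=> np i0 ip; exists (maxn (n + 1 - i) (i + 3 - n)); first by lia.
by rewrite /fusion; lia.
Qed.

Lemma fusion_sym p n i j : fusion p n i j = fusion p n j i.
Proof. by rewrite /fusion; lia. Qed.

Lemma odd_state p (x : 'I_p.-1./2) : (0 < x.*2.+1 < p)%N.
Proof. by have := ltn_ord x; lia. Qed.

Section WalkWeights.

Variables (p : nat) (k : fieldType) (pk : p \in [pchar k]).
Variables (R : realType) (w : nat -> R).
Hypothesis p_gt2 : (2 < p)%N.
Hypothesis w_gt0 : forall i : nat, (1 <= i <= p - 1)%N -> 0 < w i.
Hypothesis w_sym : forall i : nat, (1 <= i <= p - 1)%N -> w i = w (p - i)%N.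
Let p_prime : prime p := pcharf_prime pk.

Local Notation h := p.-1./2.
Local Notation toC := (real_complex R).
Local Notation normc := ComplexField.Normc.normc.

Lemma w_pos i : (0 < i < p)%N -> 0 < w i.
Proof. by move=> ip; apply: w_gt0; lia. Qed.

Lemma p_half : p = h.*2.+1.
Proof. by have := odd_p pk p_gt2; lia. Qed.

Lemma sum_states (f : nat -> R) :
  \sum_(1 <= l < p) f l = \sum_(x < h) f x.*2.+1 + \sum_(x < h) f x.*2.+2.
Proof. by rewrite -sum_states_split -p_half. Qed.

Section FixedN.

Variables (n : nat) (n_bounds : (2 <= n <= p - 2)%N).
Let n_range : (0 < n < p)%N. Proof. by lia. Qed.

Lemma edge_weight_gt0 i : (0 < i < p)%N -> 0 < edge_weight p w n i.
Proof.
move=> ip; pose j := ((i - n) + (n - i) + 1)%N.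
have jp : (0 < j < p)%N by rewrite /j; lia.
rewrite /edge_weight (bigD1_seq j) ?iota_uniq //=; last by rewrite mem_index_iota.
rewrite ltr_pwDl //.
  by rewrite (_ : fusion p n i j) ?mulr1 ?w_pos // /fusion /j; lia.
rewrite big_seq_cond; apply: sumr_ge0 => l /andP[]; rewrite mem_index_iota => lp _.
by rewrite mulr_ge0 // ltW // w_pos.
Qed.

Lemma stat_weightE i : (0 < i < p)%N ->
  stat_weight pk w n i = w i * edge_weight p w n i.
Proof.
move=> ip; rewrite /stat_weight /edge_weight; congr (_ * _).
rewrite big_mkcond; apply: eq_big_nat => l lp.
have brl : brick (V pk l) by apply: brick_V; lia.
have l0 : (0 < rdegree (V pk l))%N by rewrite /=; lia.
have := multiplicity_gt0 (tensor (V pk i) (V pk n)) brl l0.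
rewrite -/(walk_mult pk n i l) walk_mult_fusion //; last by lia.
by case: asboolP => [hs [/(_ hs)]|ns [_]]; case: (fusion _ _ _ _) => //;
  rewrite ?mulr1 ?mulr0 // => /(_ isT).
Qed.

Lemma stat_weight_gt0 i : (0 < i < p)%N -> 0 < stat_weight pk w n i.
Proof. by move=> ip; rewrite stat_weightE // mulr_gt0 ?w_pos ?edge_weight_gt0. Qed.

Lemma walk_ge0 i j : (0 < i < p)%N -> (0 < j < p)%N -> 0 <= walk pk w n i j.
Proof.
move=> ip jp; rewrite walkE //; last by lia.
by rewrite divr_ge0 ?mulr_ge0 // ltW // ?w_pos ?edge_weight_gt0.
Qed.

Lemma walk_neq0 i j : (0 < i < p)%N -> (0 < j < p)%N -> fusion p n i j ->
  walk pk w n i j != 0.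
Proof.
move=> ip jp fij; rewrite walkE // ?fij ?mulr1; last by lia.
by rewrite gt_eqF // divr_gt0 ?w_pos ?edge_weight_gt0.
Qed.

Lemma walk_reversible i j : (0 < i < p)%N -> (0 < j < p)%N ->
  stat_weight pk w n i * walk pk w n i j = stat_weight pk w n j * walk pk w n j i.
Proof.
move=> ip jp; rewrite !walkE ?stat_weightE //; try lia.
rewrite fusion_sym; field.
by rewrite !gt_eqF ?edge_weight_gt0.
Qed.

Lemma walk_sum1 i : (0 < i < p)%N -> \sum_(1 <= l < p) walk pk w n i l = 1.
Proof.
move=> ip.
transitivity (\sum_(1 <= l < p) w l * (fusion p n i l)%:R / edge_weight p w n i).
  by apply: eq_big_nat => l lp; rewrite walkE //; lia.
by rewrite -mulr_suml divff // gt_eqF ?edge_weight_gt0.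
Qed.

Lemma stat_weight_flip i : (0 < i < p)%N ->
  stat_weight pk w n (p - i) = stat_weight pk w n i.
Proof.
move=> ip; rewrite !stat_weightE -?w_sym //; try lia; congr (_ * _).
rewrite /edge_weight -[LHS]sum_flip; apply: eq_big_nat => l lp.
rewrite -(@w_sym l); last by lia.
by congr (_ * _%:R); rewrite /fusion; have := odd_p pk p_gt2; lia.
Qed.

Let W := \sum_(1 <= l < p) stat_weight pk w n l.

Lemma total_weight_gt0 : 0 < W.
Proof.
have p1 : (1 < p)%N by lia.
rewrite /W (bigD1_seq 1%N) ?iota_uniq ?mem_index_iota //=.
rewrite ltr_pwDl ?stat_weight_gt0 //.
rewrite big_seq_cond; apply: sumr_ge0 => l /andP[]; rewrite mem_index_iota => lp _.
by rewrite ltW // stat_weight_gt0.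
Qed.

Lemma stat_pi_gt0 i : (0 < i < p)%N -> 0 < stat_pi pk w n i.
Proof. by move=> ip; rewrite divr_gt0 ?stat_weight_gt0 ?total_weight_gt0. Qed.

Lemma stat_pi_sum1 : \sum_(1 <= l < p) stat_pi pk w n l = 1.
Proof. by rewrite -mulr_suml divff // gt_eqF ?total_weight_gt0. Qed.

Lemma stat_pi_reversible i j : (0 < i < p)%N -> (0 < j < p)%N ->
  stat_pi pk w n i * walk pk w n i j = stat_pi pk w n j * walk pk w n j i.
Proof.
by move=> ip jp; rewrite /stat_pi mulrAC walk_reversible // mulrAC.
Qed.

Lemma min_stat_pi_le i : (0 < i < p)%N -> min_stat_pi pk w n <= stat_pi pk w n i.
Proof. by move=> ip; apply: bigmin_le_nth; rewrite mem_index_iota. Qed.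

Lemma min_stat_pi_bounds : 0 < min_stat_pi pk w n <= 1.
Proof.
apply/andP; split.
  rewrite /min_stat_pi big_seq_cond; elim/big_ind: _ => //.
    by move=> x y x0 y0; rewrite lt_min x0 y0.
  by move=> i /andP[]; rewrite mem_index_iota => ip _; exact: (stat_pi_gt0 ip).
have p1 : (0 < 1 < p)%N by lia.
apply: le_trans (min_stat_pi_le p1) _.
rewrite -stat_pi_sum1 (bigD1_seq 1%N) ?iota_uniq ?mem_index_iota //= lerDl.
rewrite big_seq_cond; apply: sumr_ge0 => l /andP[]; rewrite mem_index_iota => lp _.
by rewrite ltW // stat_pi_gt0.
Qed.

Lemma sum_odd_stat_pi : \sum_(x < h) 2 * stat_pi pk w n x.*2.+1 = 1.
Proof.
have ph := p_half.
rewrite -mulr_sumr mulr_natl mulr2n -[RHS]stat_pi_sum1 sum_states.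
congr (_ + _); rewrite [RHS](reindex_inj rev_ord_inj); apply: eq_bigr => x _ /=.
have xh := ltn_ord x.
have -> : (h - x.+1).*2.+2 = (p - x.*2.+1)%N by lia.
by rewrite /stat_pi stat_weight_flip // odd_state.
Qed.

Lemma odd_walk_sum1 : odd n -> forall x, \sum_y odd_walk_mx pk w n x y = 1.
Proof.
move=> on x; have ph := p_half; have xp := odd_state x.
rewrite -(walk_sum1 xp) sum_states [X in _ = _ + X]big1 ?addr0.
  by apply: eq_bigr => y _; rewrite mxE.
move=> y _; apply: walk_parity => //; last by lia.
by have := ltn_ord y; lia.
Qed.

Lemma walk_mx_sum1 x : \sum_y walk_mx pk w n x y = 1.
Proof.
rewrite -(walk_sum1 (state_bounds x)) big_add1 big_mkord.
by apply: eq_bigr => y _; rewrite mxE.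
Qed.

Lemma odd_walk_connected (T : Type) (r : 'I_h -> T) : odd n ->
  (forall x x' y, odd_walk_mx pk w n x y != 0 -> odd_walk_mx pk w n x' y != 0 ->
     r x = r x') -> forall x y, r x = r y.
Proof.
move=> on hr.
have step (x x' : 'I_h) : x' = x.+1 :> nat -> r x = r x'.
  move=> xx'; have ph := p_half; have x'h := ltn_ord x'.
  have ip : (x.*2.+1.+2 < p)%N by lia.
  have [j jp /andP[f1 f2]] := fusion_common_neighbour n_bounds (ltn0Sn _) ip.
  have oj : odd j by move: f1; rewrite /fusion; lia.
  have jh : (j./2 < h)%N by lia.
  have ej : j = (j./2).*2.+1 by lia.
  apply: (hr _ _ (Ordinal jh)); rewrite mxE /= -ej.
    by apply: walk_neq0 => //; apply: odd_state.
  rewrite xx' doubleS; apply: walk_neq0 => //; lia.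
have all0 m (x y : 'I_h) : (x + m)%N = y -> r x = r y.
  elim: m y => [|m IH] y; first by rewrite addn0 => e; congr r; apply: val_inj.
  rewrite addnS => e; have yh := ltn_ord y.
  have mh : (x + m < h)%N by rewrite -e in yh; apply: ltnW.
  by rewrite (IH (Ordinal mh)) //; apply: step.
by move=> x y; case: (leqP x y) => [xy|/ltnW xy];
  [|apply: esym]; apply: all0; apply: subnKC xy.
Qed.

Lemma walk_connected (T : Type) (r : 'I_p.-1 -> T) : ~~ odd n ->
  (forall x y, walk_mx pk w n x y != 0 -> r x = r y) -> forall x y, r x = r y.
Proof.
move=> en hr.
have edge (x y : 'I_p.-1) : fusion p n x.+1 y.+1 -> r x = r y.
  by move=> f; apply: hr; rewrite mxE; apply: walk_neq0; rewrite ?state_bounds.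
have step (x x' : 'I_p.-1) : x' = x.+2 :> nat -> r x = r x'.
  move=> xx'; have x'h := ltn_ord x'.
  have ip : (x.+1.+2 < p)%N by lia.
  have [j jp /andP[f1 f2]] := fusion_common_neighbour n_bounds (ltn0Sn _) ip.
  have jh : (j.-1 < p.-1)%N by lia.
  have ej : j = (j.-1).+1 by lia.
  rewrite (edge _ (Ordinal jh)) /= -?ej //; apply/esym.
  by rewrite (edge _ (Ordinal jh)) /= -?ej // xx'.
have all0 m (x y : 'I_p.-1) : (x + m.*2)%N = y -> r x = r y.
  elim: m y => [|m IH] y; first by rewrite addn0 => e; congr r; apply: val_inj.
  rewrite doubleS !addnS => e; have yh := ltn_ord y.
  have mh : (x + m.*2 < p.-1)%N by lia.
  by rewrite (IH (Ordinal mh)) //; apply: step.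
have z0 : (0 < p.-1)%N by lia.
have n1 : (n.-1 < p.-1)%N by lia.
have r01 : r (Ordinal z0) = r (Ordinal n1).
  by apply: edge; rewrite /fusion /=; lia.
have to0 x : r x = r (Ordinal z0).
  (* Steps of length two connect the states of equal parity, and V_n, a summand
     of V_1 tensored with V_n, links both parities as n is even. *)
  have [xo|xe] := boolP (odd x); last first.
    by apply/esym/(all0 x./2) => /=; lia.
  rewrite r01; case: (leqP x n.-1) => xn.
    by apply: (all0 (n.-1 - x)./2) => /=; lia.
  by apply/esym/(all0 (x - n.-1)./2) => /=; lia.
by move=> x y; rewrite !to0.
Qed.

End FixedN.
End WalkWeights.

(** * Spectrum and mixing of the walk *)

Section WalkSpectrum.

Variables (p : nat) (k : fieldType) (pk : p \in [pchar k]).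
Variables (R : realType) (w : nat -> R).
Hypothesis p_gt2 : (2 < p)%N.
Hypothesis w_gt0 : forall i : nat, (1 <= i <= p - 1)%N -> 0 < w i.
Hypothesis w_sym : forall i : nat, (1 <= i <= p - 1)%N -> w i = w (p - i)%N.

Local Notation h := p.-1./2.
Local Notation toC := (real_complex R).
Local Notation normc := ComplexField.Normc.normc.
Local Notation Q n := (walk_mx pk w n).
Local Notation Qbar n := (walk_bar pk w n).

Lemma char_poly_walk n : (2 <= n <= p - 2)%N ->
  char_poly (map_mx toC (Q n)) = char_poly (map_mx toC (Qbar n)) *
    char_poly (if odd n then map_mx toC (Qbar n) else - map_mx toC (Qbar n)).
Proof.
move=> np; have ph := p_half pk p_gt2.
have st a : (a < h + h)%N -> ((folded_state p a).-1 < p.-1)%N.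
  by rewrite /folded_state; case: ifP; lia.
pose f (a : 'I_(h + h)) : 'I_p.-1 := Ordinal (st a (ltn_ord a)).
have fI : injective f.
  move=> a b /(congr1 val) /=; have := (ltn_ord a, ltn_ord b) => -[ah bh].
  rewrite /folded_state => e; apply: val_inj => /=; move: e.
  by case: ifP; case: ifP; lia.
have fS a : (f a).+1 = folded_state p a.
  by rewrite /= /folded_state; have := ltn_ord a; case: ifP; lia.
rewrite -(@char_poly_mxsub_bij _ _ _ f) //; last by lia.
have -> : mxsub f f (map_mx toC (Q n)) = map_mx toC (folded_walk_mx pk w n).
  by apply/matrixP => a b; rewrite !mxE -!fS.
rewrite folded_walk_kron // swap_exp /kron2 map_block_mx.
case: (odd n); rewrite !mxE /= ?scale0r ?scale1r map_mx0.
  by rewrite char_poly_block_diag.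
by rewrite char_poly_block_antidiag.
Qed.

Lemma walk_even_multiplicity n : (2 <= n <= p - 2)%N -> odd n ->
  forall l, ~~ odd (eigen_multiplicity (Q n) l).
Proof.
move=> np on l; rewrite /eigen_multiplicity char_poly_walk // on.
by rewrite mupM ?monic_neq0 ?char_poly_monic // oddD addbb.
Qed.

Lemma walk_signed_pairs n : (2 <= n <= p - 2)%N -> ~~ odd n ->
  forall l, eigen_multiplicity (Q n) l = eigen_multiplicity (Q n) (- l).
Proof.
move=> np on l; rewrite /eigen_multiplicity (char_poly_walk np) (negbTE on).
move: (map_mx _ _) => A.
have nz (B : 'M[R[i]]_h) : char_poly B != 0 by rewrite monic_neq0 ?char_poly_monic.
have e x : mup x (char_poly A * char_poly (- A)) =
    (mup x (char_poly A) + mup (- x) (char_poly A))%N.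
  exact: etrans (mupM x (nz A) (nz (- A))) (congr1 (addn _) (mup_char_polyN A x)).
by rewrite (e l) (e (- l)) opprK; exact: addnC.
Qed.

Section OddChain.

Variable n : nat.
Hypotheses (n_bounds : (2 <= n <= p - 2)%N) (n_odd : odd n).
Local Notation S := (odd_walk_mx pk w n).
(** Complementation to p exchanges odd and even states and preserves pi, so each
    half of the states has mass 1/2. *)
Let m (x : 'I_h) := 2 * stat_pi pk w n x.*2.+1.

Let m_gt0 x : 0 < m x.
Proof. by rewrite mulr_gt0 // stat_pi_gt0 // odd_state. Qed.

Let S_rev x y : m x * S x y = m y * S y x.
Proof.
by rewrite !mxE /m -!(mulrA 2) stat_pi_reversible // odd_state.
Qed.

Let S_sum1 : forall x, \sum_y S x y = 1.
Proof. exact: odd_walk_sum1. Qed.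

Let S_ge0 x y : 0 <= S x y.
Proof. by rewrite mxE walk_ge0 // odd_state. Qed.

Lemma odd_walk_gap l : complex_eigenvalue S l -> l = 1 \/ normc l < 1.
Proof.
apply: (reversible_gap m_gt0 S_rev S_sum1 S_ge0) => r hr.
exact: (odd_walk_connected (pk := pk) p_gt2 w_gt0 n_bounds n_odd hr).
Qed.

Let fixed (u : 'rV[R[i]]_h) : u *m map_mx toC S = u ->
  exists c, forall x, u 0 x = c * toC (m x).
Proof.
move=> hu; apply: (fixed_vector_unique m_gt0 S_rev S_sum1 S_ge0) => // r hr.
apply: (odd_walk_connected (pk := pk) p_gt2 w_gt0 n_bounds n_odd) => x x' y Sx Sx'.
by rewrite (hr _ _ Sx) (hr _ _ Sx').
Qed.

(** The masses of the subchain are at least 2 min pi, so the distance at time t is at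
    most lambda^t / (4 min pi), and rounding t costs a factor e < 4. *)
Lemma odd_walk_mixing eps sigma : 0 < eps -> eps < 1 -> stationary S sigma ->
  exists2 t : nat, is_mixing_time S sigma eps t &
    t%:R <= (1 - lambda_star S)^-1 * ln (eps * min_stat_pi pk w n)^-1.
Proof.
move=> eps0 eps1 hsig.
have m1 : \sum_x m x = 1 by exact: sum_odd_stat_pi.
rewrite (stationary_unique m1 fixed hsig).
have /andP[mu0 mu1] := min_stat_pi_bounds pk p_gt2 w_gt0 n_bounds.
set mu := min_stat_pi pk w n in mu0 mu1 *.
have /andP[lam0 lam1] := lambda_star_bounds odd_walk_gap.
set lam := lambda_star S in lam0 lam1 *.
have g01 : 0 < 1 - lam <= 1 by apply/andP; split; lra.
have e4 : expR (1 - lam) <= 4.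
  by apply: le_trans (expR1_le4 R); rewrite ler_expR; lra.
have a01 : 0 < eps * mu <= 1 by rewrite mulr_gt0 //= mulr_ile1 // ltW.
have [t_le decay] := truncated_decay g01 a01.
apply: mixing_time_exists t_le; set t := Num.truncn _ in decay * => x.
apply: le_trans (reversible_mixing m_gt0 S_rev S_sum1 m1 (mu := 2 * mu) (lam := lam)
  _ _ lam0 _ fixed t x) _.
- by move=> y; rewrite /m ler_pM2l // min_stat_pi_le // odd_state.
- by rewrite mulr_gt0.
- by move=> l; apply: (lambda_star_ge odd_walk_gap).
rewrite subKr in decay.
rewrite ler_pdivrMr ?mulr_gt0 //; apply: le_trans decay _.
apply: le_trans (ler_wpM2r (ltW (mulr_gt0 eps0 mu0)) e4) _.
by rewrite le_eqVlt; apply/orP; left; apply/eqP; ring.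
Qed.

End OddChain.

(** The case of even n reduces to that of p - n, which is odd. *)
Lemma walk_bar_gap n : (2 <= n <= p - 2)%N ->
  forall l, complex_eigenvalue (Qbar n) l -> l = 1 \/ normc l < 1.
Proof.
move=> np l; have [on|en] := boolP (odd n).
  by rewrite walk_bar_odd //; apply: odd_walk_gap.
have op := odd_p pk p_gt2.
rewrite -walk_bar_sym // walk_bar_odd; last by lia.
by apply: odd_walk_gap; lia.
Qed.

Section EvenChain.

Variable n : nat.
Hypotheses (n_bounds : (2 <= n <= p - 2)%N) (n_even : ~~ odd n).
Local Notation S := (walk_mx pk w n).
Local Notation L := (lazy_walk_mx pk w n).
Let m (x : 'I_p.-1) := stat_pi pk w n x.+1.

Let m_gt0 x : 0 < m x.
Proof. by rewrite stat_pi_gt0 // state_bounds. Qed.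

Let S_rev x y : m x * S x y = m y * S y x.
Proof. by rewrite !mxE /m stat_pi_reversible // state_bounds. Qed.

Let S_sum1 : forall x, \sum_y S x y = 1.
Proof. exact: walk_mx_sum1. Qed.

Let S_ge0 x y : 0 <= S x y.
Proof. by rewrite mxE walk_ge0 // state_bounds. Qed.

Let LE x y : L x y = 2^-1 * (S x y + (x == y)%:R).
Proof. by rewrite !mxE. Qed.

Let L_rev x y : m x * L x y = m y * L y x.
Proof.
rewrite !LE mulrCA [RHS]mulrCA; congr (_ * _).
rewrite !mulrDr S_rev [y == x]eq_sym; congr (_ + _).
by case: eqP => [->|_]; rewrite // !mulr0.
Qed.

Let L_sum1 x : \sum_y L x y = 1.
Proof.
under eq_bigr => y _ do rewrite LE.
rewrite -mulr_sumr big_split /= S_sum1 (bigD1 x) //= eqxx big1 => [|y ny].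
  by rewrite addr0 /= mulVf // (pnatr_eq0 R 2).
by rewrite eq_sym (negbTE ny).
Qed.

Let lazy_left (u : 'rV[R[i]]_p.-1) l : u *m map_mx toC L = l *: u ->
  u *m map_mx toC S = (2 * l - 1) *: u.
Proof.
have -> : map_mx toC L = 2^-1 *: (map_mx toC S + 1%:M).
  apply/matrixP => x y; rewrite [LHS]mxE LE !mxE rmorphM rmorphD /= fmorphV.
  by rewrite !rmorph_nat.
rewrite -scalemxAr mulmxDr mulmx1 => e.
rewrite scalerBl scale1r -scalerA -e scalerA divff ?scale1r ?addrK //.
by rewrite pnatr_eq0.
Qed.

Let fixed (u : 'rV[R[i]]_p.-1) : u *m map_mx toC L = u ->
  exists c, forall x, u 0 x = c * toC (m x).
Proof.
move=> hu; have hu1 : u *m map_mx toC L = 1 *: u by rewrite scale1r.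
apply: (fixed_vector_unique m_gt0 S_rev S_sum1 S_ge0).
  by move=> r hr; apply: (walk_connected (pk := pk) p_gt2 w_gt0 n_bounds n_even).
by rewrite (lazy_left hu1) (_ : 2 * 1 - 1 = 1) ?scale1r //; ring.
Qed.

(** An eigenvalue l of the lazy chain comes from an eigenvalue 2 l - 1 of Q, which is
    up to sign an eigenvalue of Qbar; the eigenvalue -1 of the periodic chain Q
    becomes 0. *)
Lemma lazy_eigenvalue l : complex_eigenvalue L l ->
  l = 1 \/ normc l <= (1 + lambda_star (Qbar n)) / 2.
Proof.
move=> /eigenvalueP[u /lazy_left hu u0].
have /andP[lam0 lam1] := lambda_star_bounds (walk_bar_gap n_bounds).
set lam := lambda_star _ in lam0 lam1 *.
have normcE (z : R[i]) : `|z| = toC (normc z) by [].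
have bound (s : R[i]) : `|s| <= toC lam -> normc ((1 + s) / 2) <= (1 + lam) / 2.
  move=> hs; rewrite -lecR -normcE normrM normfV (ger0_norm (ler0n _ 2)).
  rewrite rmorphM fmorphV rmorphD /= rmorph1 rmorph_nat.
  rewrite ler_wpM2r ?invr_ge0 ?ler0n //.
  by apply: le_trans (ler_normD _ _) _; rewrite normr1 lerD2l.
have le : l = (1 + (2 * l - 1)) / 2 by field.
have : root (char_poly (map_mx toC S)) (2 * l - 1).
  by rewrite -eigenvalue_root_char; apply/eigenvalueP; exists u.
rewrite char_poly_walk // (negbTE n_even) rootM -!eigenvalue_root_char => /orP[].
  move=> /(lambda_star_ge (walk_bar_gap n_bounds))[e|hl].
    by left; rewrite le e; field.
  by right; rewrite le; apply: bound; rewrite normcE lecR.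
move=> /eigenvalueP[v hv v0].
have : complex_eigenvalue (Qbar n) (- (2 * l - 1)).
  by apply/eigenvalueP; exists v => //; rewrite scaleNr -hv mulmxN opprK.
move=> /(lambda_star_ge (walk_bar_gap n_bounds))[e|hl]; right; last first.
  by rewrite le; apply: bound; rewrite -normrN normcE lecR.
have -> : l = 0 by rewrite le -[2 * l - 1]opprK e; field.
by rewrite ComplexField.Normc.normc0; lra.
Qed.

(** The lazy chain has gap (1 - lambda) / 2, which is at most 1/2, so rounding costs
    a factor expR (1/2) <= 2, paid by the 1/2 in the total variation distance. *)
Lemma lazy_walk_mixing eps sigma : 0 < eps -> eps < 1 -> stationary L sigma ->
  exists2 t : nat, is_mixing_time L sigma eps t &
    t%:R / 2 <= (1 - lambda_star (Qbar n))^-1 * ln (eps * min_stat_pi pk w n)^-1.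
Proof.
move=> eps0 eps1 hsig.
have m1 : \sum_x m x = 1.
  by rewrite -(stat_pi_sum1 pk p_gt2 w_gt0 n_bounds) big_add1 big_mkord.
rewrite (stationary_unique m1 fixed hsig).
have /andP[mu0 mu1] := min_stat_pi_bounds pk p_gt2 w_gt0 n_bounds.
set mu := min_stat_pi pk w n in mu0 mu1 *.
have /andP[lam0 lam1] := lambda_star_bounds (walk_bar_gap n_bounds).
have hlazy := lazy_eigenvalue.
set lam := lambda_star _ in lam0 lam1 hlazy *.
have g01 : 0 < (1 - lam) / 2 <= 1 by apply/andP; split; lra.
have lam2 : 0 <= (1 + lam) / 2 by lra.
have rateE : 1 - (1 - lam) / 2 = (1 + lam) / 2 by lra.
have e2 : expR ((1 - lam) / 2) <= 2.
  by apply: le_trans (expR_half_le2 R); rewrite ler_expR; lra.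
have a01 : 0 < eps * mu <= 1 by rewrite mulr_gt0 //= mulr_ile1 // ltW.
have [t_le decay] := truncated_decay g01 a01.
suff : exists2 t, is_mixing_time L (\row_x m x) eps t &
    t%:R <= ((1 - lam) / 2)^-1 * ln (eps * mu)^-1.
  move=> [t ht tb]; exists t => //; rewrite ler_pdivrMr //; apply: le_trans tb _.
  by rewrite invfM invrK mulrAC.
apply: mixing_time_exists t_le; set t := Num.truncn _ in decay * => x.
apply: le_trans (reversible_mixing m_gt0 L_rev L_sum1 m1 (mu := mu)
  (lam := (1 + lam) / 2) _ mu0 lam2 hlazy fixed t x) _.
- by move=> y; rewrite /m min_stat_pi_le // state_bounds.
rewrite rateE in decay.
rewrite ler_pdivrMr ?mulr_gt0 //; apply: le_trans decay _.
apply: le_trans (ler_wpM2r (ltW (mulr_gt0 eps0 mu0)) e2) _.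
by rewrite le_eqVlt; apply/orP; left; apply/eqP; ring.
Qed.

End EvenChain.

End WalkSpectrum.

Theorem proposition5p7 (p : nat) (p_prime : prime p) (p_gt2 : (2 < p)%N)
    (k : closedFieldType) (pk : p \in [pchar k])
    (n : nat) (n_bounds : (2 <= n <= p - 2)%N)
    (R : realType) (w : nat -> R)
    (w_gt0 : forall i : nat, (1 <= i <= p - 1)%N -> 0 < w i)
    (w_sym : forall i : nat, (1 <= i <= p - 1)%N -> w i = w (p - i)%N) :
  let Q := walk_mx pk w in
  let Qbar := walk_bar pk w in
  let T := reflection_mx R p in
  (Q n = T *m Q (p - n)%N /\ Q n = Q (p - n)%N *m T) /\
  T *m Q n *m T = Q n /\
  (forall i j : nat, (1 <= i <= p - 1)%N -> (1 <= j <= p - 1)%N ->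
     walk pk w n (p - i) (p - j) = walk pk w n i j) /\
  (odd n -> chain_isomorphic (odd_walk_mx pk w n) (even_walk_mx pk w n)) /\
  Qbar (p - n)%N = Qbar n /\
  folded_walk_mx pk w n = kron2 (Qbar n) (swap_mx R ^+ n.+1) /\
  ((odd n -> forall l : R[i], complex_eigenvalue (Q n) l ->
      ~~ odd (eigen_multiplicity (Q n) l)) /\
   (~~ odd n -> forall l : R[i],
      eigen_multiplicity (Q n) l = eigen_multiplicity (Q n) (- l))) /\
  (forall eps : R, 0 < eps -> eps < 1 ->
     let bound := (1 - lambda_star (Qbar n))^-1 *
                  ln ((eps * min_stat_pi pk w n)^-1) in
     (odd n -> forall S, S = odd_walk_mx pk w n \/ S = even_walk_mx pk w n ->
        forall sigma, stationary S sigma ->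
        exists2 t : nat, is_mixing_time S sigma eps t & t%:R <= bound) /\
     (~~ odd n -> forall sigma, stationary (lazy_walk_mx pk w n) sigma ->
        exists2 t : nat, is_mixing_time (lazy_walk_mx pk w n) sigma eps t &
          t%:R / 2 <= bound)).

Proof.
move=> Q Qbar T.
have n_range : (0 < n < p)%N by lia.
have np' : (2 <= p - n <= p - 2)%N by lia.
have rng i : (1 <= i <= p - 1)%N -> (0 < i < p)%N by lia.
split; first by split; [apply: walk_mx_reflect_l | apply: walk_mx_reflect_r].
split; first exact: walk_mx_reflect.
split; first by move=> i j /rng ip /rng jp; apply: walk_flip.
split; first by move=> _; apply: odd_even_isomorphic.
split; first exact: walk_bar_sym.
split; first exact: folded_walk_kron.
split.
  split=> [on l _|en l]; first exact: walk_even_multiplicity.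
  exact: walk_signed_pairs.
move=> eps eps0 eps1 bound; split=> [on S hS|en] sigma hsig; last first.
  exact: lazy_walk_mixing.
have odd_mix sigma' : stationary (odd_walk_mx pk w n) sigma' ->
  exists2 t, is_mixing_time (odd_walk_mx pk w n) sigma' eps t & t%:R <= bound.
  by rewrite /bound /Qbar walk_bar_odd //; apply: odd_walk_mixing.
case: hS hsig => -> hsig; first exact: odd_mix.
apply: (mixing_time_reindex (@rev_ord_inj _) _ odd_mix hsig).
exact: even_walk_rev.
Qed.
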